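(* Let $n,m\in\mathbb{N}$. Then the Brinkmann Conjugacy Problem for all endomorphisms of $F_n\times\mathbb{Z}^m$ is decidable; that is, there is an algorithm which, given an endomorphism $\Phi\in\operatorname{End}(F_n\times\mathbb{Z}^m)$ and two elements $x,y\in F_n\times\mathbb{Z}^m$, decides whether there exists some $k\in\mathbb{N}$ such that $(x)\Phi^k$ and $y$ are conjugate in $F_n\times\mathbb{Z}^m$.
   Context: $\mathbb{N}=\{0,1,2,\dots\}$. $F_n$ denotes the free group of rank $n$ and $\mathbb{Z}^m$ the free-abelian group of rank $m$. The group $F_n\times\mathbb{Z}^m$ is given by the finite presentation $\langle x_1,\dots,x_n,t_1,\dots,t_m \mid t_it_j=t_jt_i,\ t_ix_k=x_kt_i,\ i,j\in[1,m],\ k\in[1,n]\rangle$. Elements are given to the algorithm as words in the generators (and inverses), and endomorphisms are given as the list of words representing the images of the generators. Homomorphisms act on the right: $(x)\Phi$ is the image of $x$ under $\Phi$, and $\Phi^k$ is the $k$-fold composition, with $\Phi^0=\mathrm{id}$. *)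

(* Defs.v *)
From HB Require Import structures.
From mathcomp Require Import all_boot all_order all_algebra.

Set Implicit Arguments.
Unset Strict Implicit.
Unset Printing Implicit Defensive.

Local Open Scope group_scope.

Section Words.
Variable T : Type.

(* The letter (x, false) stands for x and (x, true) for its inverse. *)
Definition word := seq (T * bool).

Definition linv (a : T * bool) : T * bool := (a.1, ~~ a.2).

Definition winv (w : word) : word := rev (map linv w).

Definition word_eval (G : groupType) (f : T -> G) (w : word) : G :=
  \prod_(a <- w) (if a.2 then (f a.1)^-1 else f a.1).

Lemma linvK : involutive linv.
Proof. by case=> x b; rewrite /linv /= negbK. Qed.

End Words.

Section FreeGroup.
Variable T : choiceType.
Implicit Types (a b : T * bool) (u v w : word T).

Definition reduced w : bool := sorted (fun a b => b != linv a) w.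

Definition push a w : word T :=
  if w is b :: w' then if b == linv a then w' else a :: w else [:: a].

Definition reduce w : word T := foldr push [::] w.

Lemma reduced_push a w : reduced w -> reduced (push a w).
Proof.
case: w => [//|b w] /= rw; case: eqP => [_|/eqP ne]; last by rewrite /= ne.
exact: path_sorted rw.
Qed.

Lemma reduced_foldr u w : reduced w -> reduced (foldr push w u).
Proof. by move=> rw; elim: u => //= a u; apply: reduced_push. Qed.

Lemma reduce_reduced w : reduced (reduce w).
Proof. exact: reduced_foldr. Qed.

Lemma reduce_id w : reduced w -> reduce w = w.
Proof.
elim: w => [//|a w IH] raw; have rw : reduced w := path_sorted raw.
rewrite /reduce /= -/(reduce w) (IH rw).
by case: w raw {IH rw} => //= b w /andP[/negbTE ->].
Qed.

Lemma pushK a w : reduced w -> push (linv a) (push a w) = w.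
Proof.
case: w => [|b w] /=; first by rewrite linvK eqxx.
case: eqP => [-> |_] /=; last by rewrite linvK eqxx.
by case: w => //= c w /andP[/negbTE ->].
Qed.

Lemma foldr_push a u w : reduced w ->
  foldr push w (push a u) = push a (foldr push w u).
Proof.
case: u => [//|b u] /= rw; case: eqP => [-> |//].
by have /= := pushK (linv a) (reduced_foldr u rw); rewrite linvK => ->.
Qed.

Lemma foldr_reduce u w : reduced w ->
  foldr push w (reduce u) = foldr push w u.
Proof.
move=> rw; elim: u => //= a u IH.
by rewrite -/(reduce u) foldr_push // IH.
Qed.

Lemma reduce_cat u w : reduce (u ++ w) = foldr push (reduce w) u.
Proof. by rewrite /reduce foldr_cat. Qed.

Lemma reduce_catl u w : reduce (reduce u ++ w) = reduce (u ++ w).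
Proof. by rewrite !reduce_cat foldr_reduce // reduce_reduced. Qed.

Lemma reduce_catr u w : reduce (u ++ reduce w) = reduce (u ++ w).
Proof. by rewrite !reduce_cat (reduce_id (reduce_reduced w)). Qed.

Lemma reduce_winv w : reduce (winv w ++ w) = [::].
Proof.
elim: w => [//|a w IH].
rewrite /winv map_cons rev_cons cat_rcons reduce_cat /= -/(reduce w).
by rewrite pushK ?reduce_reduced // -reduce_cat.
Qed.

Lemma winvK : involutive (@winv T).
Proof.
move=> w; rewrite /winv map_rev revK -map_comp map_id_in // => a _ /=.
by rewrite linvK.
Qed.

Record freegroup := FreeGroup { fword :> word T; _ : reduced fword }.

HB.instance Definition _ := [isSub for fword].
HB.instance Definition _ := [Choice of freegroup by <:].

Definition free_of_word w : freegroup := FreeGroup (reduce_reduced w).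

Let one := free_of_word [::].
Let mul (x y : freegroup) := free_of_word (fword x ++ fword y).
Let inv (x : freegroup) := free_of_word (winv x).

Let freeE (x : freegroup) : reduce x = x :> word T.
Proof. by case: x => w rw; apply: reduce_id. Qed.

Fact free_mulgA : associative mul.
Proof.
by move=> x y z; apply: val_inj; rewrite /= reduce_catr reduce_catl catA.
Qed.

Fact free_mul1g : left_id one mul.
Proof. by move=> x; apply: val_inj; rewrite /= freeE. Qed.

Fact free_mulg1 : right_id one mul.
Proof. by move=> x; apply: val_inj; rewrite /= cats0 freeE. Qed.

Fact free_mulVg : left_inverse one inv mul.
Proof. by move=> x; apply: val_inj; rewrite /= reduce_catl reduce_winv. Qed.

Fact free_mulgV : right_inverse one inv mul.
Proof.
move=> x; apply: val_inj; rewrite /= reduce_catr.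
by rewrite -{1}[fword x]winvK reduce_winv.
Qed.

HB.instance Definition _ := isGroup.Build freegroup
  free_mulgA free_mul1g free_mulg1 free_mulVg free_mulgV.

Definition free_gen (x : T) : freegroup := free_of_word [:: (x, false)].

End FreeGroup.

Section FreeTimesFreeAbelian.
Variables n m : nat.

(* F_n x Z^m, the second factor being written multiplicatively. *)
Definition FxZ : groupType :=
  (freegroup 'I_n * Algebra.to_multiplicative 'rV[int]_m)%type.

(* The generators x_i are inl i and the generators t_j are inr j. *)
Definition FxZ_gen (g : 'I_n + 'I_m) : FxZ :=
  match g with
  | inl i => (free_gen i, 1)
  | inr j => (1, delta_mx 0%R j : 'rV[int]_m)
  end.

Definition FxZ_word := word ('I_n + 'I_m).

Definition FxZ_eval (w : FxZ_word) : FxZ := word_eval FxZ_gen w.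

Definition represents (Phi : {multiplicative FxZ -> FxZ})
    (us : n.-tuple FxZ_word) (vs : m.-tuple FxZ_word) : Prop :=
  (forall i, Phi (FxZ_gen (inl i)) = FxZ_eval (tnth us i)) /\
  (forall j, Phi (FxZ_gen (inr j)) = FxZ_eval (tnth vs j)).

Definition letter_code (a : ('I_n + 'I_m) * bool) : nat :=
  ((match a.1 with inl i => val i | inr j => (n + j)%N end).*2 + a.2)%N.

Definition word_code (w : FxZ_word) : nat := CodeSeq.code (map letter_code w).

(* Words representing the images of x_1, ..., x_n, then those of t_1, ..., t_m, *)
(* then the two elements.                                                     *)
Definition BrCP_input (us : n.-tuple FxZ_word) (vs : m.-tuple FxZ_word)
    (wx wy : FxZ_word) : (n + (m + 2)).-tuple nat :=
  [tuple of map word_code (us ++ vs ++ [tuple wx; wy])].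

End FreeTimesFreeAbelian.

Definition conjugate (G : groupType) (x y : G) : Prop := exists g : G, x ^ g = y.

(* Syntax of the mu-recursive partial functions of k natural arguments. The    *)
(* recursion or minimisation variable is the first argument; in RPrec f g, the *)
(* step g is applied to the index, the previous value and the parameters.      *)
Inductive recfun : nat -> Type :=
| RZero : recfun 0
| RSucc : recfun 1
| RProj k (i : 'I_k) : recfun k
| RComp k l (f : recfun k) (gs : 'I_k -> recfun l) : recfun l
| RPrec k (f : recfun k) (g : recfun k.+2) : recfun k.+1
| RMu k (f : recfun k.+1) : recfun k.

Fixpoint prec_rel (F : nat -> Prop) (G : nat -> nat -> nat -> Prop) (i v : nat)
    : Prop :=
  if i is i'.+1 then exists2 w, prec_rel F G i' w & G i' w v else F v.

(* computes f s v: the evaluation of f at s terminates with value v. *)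
Fixpoint computes k (f : recfun k) : k.-tuple nat -> nat -> Prop :=
  match f in recfun k return k.-tuple nat -> nat -> Prop with
  | RZero => fun _ v => v = 0%N
  | RSucc => fun s v => v = (thead s).+1
  | RProj _ i => fun s v => v = tnth s i
  | RComp k _ f gs => fun s v =>
      exists2 t : k.-tuple nat,
        forall i, computes (gs i) s (tnth t i) & computes f t v
  | RPrec _ f g => fun s v =>
      prec_rel (computes f (behead_tuple s))
        (fun i w => computes g [tuple of i :: w :: behead_tuple s]) (thead s) v
  | RMu _ f => fun s v =>
      computes f [tuple of v :: s] 0 /\
      forall i, (i < v)%N -> exists w, computes f [tuple of i :: s] w.+1
  end.

(* A halts on s, with output 1 if P holds and 0 otherwise. *)
Definition answers k (A : recfun k) (s : k.-tuple nat) (P : Prop) : Prop :=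
  exists b : bool, computes A s b /\ (b <-> P).

(* Main.v *)
Require Import Defs.
From mathcomp Require Import all_boot all_order perm all_algebra all_field.
From mathcomp Require Import ring lra zify.
From mathcomp Require Import mpoly.

Set Implicit Arguments.
Unset Strict Implicit.
Unset Printing Implicit Defensive.

Import Order.TTheory GRing.Theory Num.Theory.

(* The least k such that x Phi^k is conjugate to y, if there is one, is bounded by
   an elementary function of the size of the input, and so is the size of a
   conjugator; hence a bounded search, which is primitive recursive, decides.

   For the bound let M be such that the M-th power of every endomorphism A of Z^N
   is idempotent modulo 2 and 3, let psi = Phi^M and suppose that x psi^q ~ y with
   q large. Mapping x_i to the generic matrix 1 + X_i and taking traces turns psi
   into a substitution on integer polynomials without constant term. Modulo high
   degree it is an integer matrix A and one gets z A^q = w with q large compared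
   to A, z, w; Cramer's rule and a theorem of Kronecker show that only the
   eigenvalues 0 and 1 matter and that 1 has no Jordan block, so that w A = w. Thus
   y psi and y have the same trace at every representation of F_n in SL_2(Q), and
   the same exponents. The differences of the traces of x psi^j and y psi^j are
   then the iterates of one function of N variables under a map, and vanish at
   j = q; as N + 1 polynomials in N variables are algebraically dependent, they
   vanish for all j >= N. But only finitely many conjugacy classes of F_n x Z^m
   have the traces and the exponents of y, since the traces determine the cyclic
   length. So two of the x psi^j are conjugate and k can be decreased. When some
   t_j is mapped outside of the centre the image of Phi is abelian and exponents
   alone suffice. *)

(** * Integer matrices with a bounded orbit *)

Local Open Scope ring_scope.

Lemma norm_coef_prod_XsubC (s : seq algC) :
  (forall x, x \in s -> `|x| <= 2) ->
  forall i, `|(\prod_(x <- s) ('X - x%:P))`_i| <= 3 ^+ size s.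
Proof.
elim: s => [|x s IH] xs i.
  by rewrite big_nil coef1 expr0 normr_nat lern1 leq_b1.
rewrite big_cons mulrBl coefB coefXM coefCM exprS.
have {}IH := IH (fun y ys => xs y (@mem_behead _ (x :: s) y ys)).
set p := \prod_(_ <- s) _ in IH *.
(* A factor ['X - x%:P] multiplies the bound by at most 1 + |x|, hence by at most 3. *)
have h1 : `|if i == 0%N then 0 else p`_i.-1| <= 3 ^+ size s.
  by case: ifP => _; rewrite ?IH // normr0 exprn_ge0.
have h2 : `|x * p`_i| <= 2 * 3 ^+ size s.
  by rewrite normrM ler_pM ?normr_ge0 ?IH // xs ?mem_head.
by apply: le_trans (ler_normB _ _) _; rewrite (mulrDl 1 2) mul1r lerD.
Qed.

(** Split ['X^j - x%:P] into linear factors and evaluate at [C]: the product is singular, so some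
    factor is. *)
Lemma eigenvalue_exp (F : closedFieldType) r (C : 'M[F]_r.+1) j x :
  (0 < j)%N -> eigenvalue (C ^+ j) x ->
  exists2 y, eigenvalue C y & y ^+ j = x.
Proof.
move=> j0; rewrite eigenvalue_root_char => Cx.
have [s Es] := closed_field_poly_normal ('X^j - x%:P : {poly F}).
have mon : lead_coef ('X^j - x%:P : {poly F}) = 1.
  by apply/monicP; rewrite monicXnsubC.
rewrite mon scale1r in Es.
have detE (B : 'M[F]_r.+1) z : (root (char_poly B) z) = (\det (B - z%:M) == 0).
  rewrite -eigenvalue_root_char.
  apply/eigenvalueP/det0P => [[v Av vn0]|[v vn0 Av]]; exists v => //.
    by rewrite mulmxBr Av mul_mx_scalar subrr.
  by apply/eqP; rewrite -mul_mx_scalar -subr_eq0 -mulmxBr Av.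
move: Cx; rewrite detE.
have -> : C ^+ j - x%:M = \prod_(z <- s) (C - z%:M).
  have := congr1 (horner_mx C) Es.
  rewrite rmorphB rmorph_prod rmorphXn /= horner_mx_X horner_mx_C => ->.
  by apply: eq_bigr => z _; rewrite rmorphB /= horner_mx_X horner_mx_C.
rewrite (big_morph (@determinant F r.+1) (@det_mulmx F r.+1) (@det1 F r.+1)).
rewrite prodf_seq_eq0 => /hasP[z zs /= dz]; exists z.
  by rewrite eigenvalue_root_char detE.
have /rootP : root (\prod_(z <- s) ('X - z%:P)) z by rewrite root_prod_XsubC.
by rewrite -Es !hornerE => /eqP; rewrite subr_eq0 => /eqP.
Qed.

(** The coefficients are rational because [C] is, and algebraic integers because the roots are. *)
Lemma char_poly_Aint_coef r (C : 'M[rat]_r.+1) :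
  (forall x, eigenvalue (map_mx ratr C : 'M[algC]_r.+1) x -> x \in Aint) ->
  (forall x, eigenvalue (map_mx ratr C : 'M[algC]_r.+1) x -> `|x| <= 2) ->
  forall i, exists2 a : int, (char_poly (map_mx ratr C : 'M[algC]_r.+1))`_i = a%:~R
     & `|a| <= 3 ^+ r.+1.
Proof.
move=> CA C2 i; set p := char_poly _.
have [s Es] := closed_field_poly_normal p.
have mon : lead_coef p = 1 by apply/monicP; rewrite char_poly_monic.
rewrite mon scale1r in Es.
have rs x : x \in s -> eigenvalue (map_mx ratr C : 'M[algC]_r.+1) x.
  by rewrite eigenvalue_root_char -/p Es root_prod_XsubC.
have ss : size s = r.+1.
  have := size_char_poly (map_mx ratr C : 'M[algC]_r.+1).
  by rewrite -/p Es size_prod_XsubC => -[].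
have pA : p`_i \in Aint.
  have : p \is a polyOver Aint.
    rewrite Es big_seq; apply: rpred_prod => x xs.
    by rewrite polyOverXsubC; apply/CA/rs.
  by move/polyOverP.
have pQ : p`_i \in Crat.
  by rewrite /p -map_char_poly coef_map /= Crat_rat.
have /intrP[a Ea] := Cint_rat_Aint pQ pA.
exists a => //.
have : `|p`_i| <= 3 ^+ size s.
  by rewrite Es; apply: norm_coef_prod_XsubC => x xs; apply/C2/rs.
rewrite Ea ss.
have -> : (3 ^+ r.+1 : algC) = (3 ^+ r.+1 : int)%:~R by rewrite rmorphXn.
by rewrite -intr_norm ler_int.
Qed.

(** Counts the roots of all integer polynomials with r + 2 coefficients of absolute value at most
    3^(r+1). *)
Definition kron_bound (r : nat) := (r.+1 * (2 * 3 ^ r.+1).+1 ^ r.+2)%N.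

(* The characteristic polynomials of C, ..., C^(J+1) lie in a finite set, hence so do
   the powers of x. *)
Lemma kronecker_eigenvalues r (C : 'M[rat]_r.+1) :
  (forall x, eigenvalue (map_mx ratr C : 'M[algC]_r.+1) x -> x \in Aint) ->
  (forall x, eigenvalue (map_mx ratr C : 'M[algC]_r.+1) x ->
     `|x| ^+ (kron_bound r).+1 <= 2) ->
  forall x, eigenvalue (map_mx ratr C : 'M[algC]_r.+1) x ->
    exists i j, (i < j)%N /\ x ^+ i = x ^+ j.
Proof.
move=> CA C2 x Cx; set J := kron_bound r in C2.
pose B := (3 ^ r.+1)%N.
pose P (f : {ffun 'I_r.+2 -> 'I_(2 * B).+1}) : {poly algC} :=
  \poly_(i < r.+2) ((f (inord i) : nat)%:R - B%:R).
(* For [P f = 0] the list of roots is arbitrary; the cut bounds its length and removes nothing in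
   degree r + 1. *)
pose roots (f : {ffun 'I_r.+2 -> 'I_(2 * B).+1}) : seq algC :=
  take r.+1 (sval (closed_field_poly_normal (P f))).
pose S := flatten [seq roots f | f <- enum {ffun 'I_r.+2 -> 'I_(2 * B).+1}].
have sS : (size S <= J)%N.
  rewrite /S size_flatten sumnE /shape -map_comp big_map.
  apply: (@leq_trans (\sum_(f <- enum {ffun 'I_r.+2 -> 'I_(2 * B).+1}) r.+1)).
    by apply: leq_sum => f _; rewrite /= /roots size_take_min geq_minl.
  rewrite big_enum sum_nat_const card_ffun !card_ord.
  by rewrite /J /kron_bound -/B mulnC.
have inS j : (0 < j <= J.+1)%N -> x ^+ j \in S.
  move=> /andP[j0 jJ].
  (* The bound is assumed for one high power only; all lower powers inherit it, so that
     [char_poly_Aint_coef] applies to each [C ^+ j]. *)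
  have e2 (y : algC) : `|y| ^+ J.+1 <= 2 -> `|y| ^+ j <= 2.
    move=> y2; have [y1|y1] := boolP (`|y| <= 1).
      by apply: (@le_trans _ _ 1); rewrite ?exprn_ile1 ?ler1n.
    apply: le_trans y2; apply: ler_weXn2l => //.
    by rewrite real_leNgt ?num_real ?normr_real //; apply: contra y1 => /ltW.
  have mE : (map_mx ratr (C ^+ j) : 'M[algC]_r.+1) = (map_mx ratr C) ^+ j.
    by rewrite rmorphXn.
  have Cx' y : eigenvalue (map_mx ratr (C ^+ j) : 'M[algC]_r.+1) y ->
      exists2 z, eigenvalue (map_mx ratr C : 'M[algC]_r.+1) z & z ^+ j = y.
    by rewrite mE; apply: eigenvalue_exp.
  have coefE : forall i, exists2 a : int,
      (char_poly (map_mx ratr (C ^+ j) : 'M[algC]_r.+1))`_i = a%:~R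
      & `|a| <= 3 ^+ r.+1.
    apply: char_poly_Aint_coef => y /Cx'[z Cz <-].
      by rewrite rpredX // CA.
    by rewrite normrX e2 // C2.
  set p := char_poly _ in coefE.
  have [f Ef] : exists f, p = P f.
    have/fin_all_exists[g hg] : forall i : 'I_r.+2, exists k : 'I_(2 * B).+1,
        p`_i = k%:R - B%:R.
      move=> i; have [a Ea aB] := coefE i.
      have B0 : (3 ^+ r.+1 = B :> int) by rewrite -[RHS]natz natrX.
      rewrite B0 in aB.
      clear -aB Ea; move: B aB => b aB.
      have hk : (`|(a + b%:Z)%R|%N < (2 * b).+1)%N by lia.
      exists (Ordinal hk) => /=; rewrite Ea.
      have {1}-> : a = `|(a + b%:Z)%R|%N%:Z - b%:Z by lia.
      by rewrite intrB.
    exists (finfun g); apply/polyP => i; rewrite coef_poly.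
    case: ltnP => iR; last first.
      by rewrite nth_default // (size_char_poly (map_mx ratr (C ^+ j) : 'M[algC]_r.+1)).
    by rewrite ffunE -hg inordK.
  apply/flattenP; exists (roots f).
    by apply: map_f; rewrite mem_enum.
  rewrite /roots; case: closed_field_poly_normal => s /= Es.
  have lc : lead_coef (P f) = 1 by rewrite -Ef; apply/monicP; rewrite char_poly_monic.
  rewrite lc scale1r in Es.
  rewrite take_oversize.
    rewrite -root_prod_XsubC -Es -Ef -eigenvalue_root_char mE.
    have /eigenvalueP[v Av vn0] := Cx; apply/eigenvalueP; exists v => //.
    elim: (j) => [|k IH]; first by rewrite !expr0 mulmx1 scale1r.
    by rewrite exprSr mulmxA IH -scalemxAl Av scalerA -exprSr.
  have := size_char_poly (map_mx ratr (C ^+ j) : 'M[algC]_r.+1).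
  by rewrite -/p Ef Es size_prod_XsubC => -[->].
(* [J + 1] powers of [x] lie in a list of at most [J] numbers. *)
have nu : ~~ uniq [seq x ^+ j | j <- iota 1 J.+1].
  apply/negP => u.
  have : (size [seq x ^+ j | j <- iota 1 J.+1] <= size S)%N.
    apply: uniq_leq_size => // y /mapP[j]; rewrite mem_iota => hj ->.
    by apply: inS; lia.
  by rewrite size_map size_iota leqNgt ltnS sS.
have /(uniqPn 0)[i [j [ij jl Eij]]] := nu.
rewrite size_map size_iota in jl.
exists i.+1, j.+1; split=> //.
by move: Eij; rewrite !(nth_map 0%N) ?size_iota ?nth_iota //; lia.
Qed.

(** Evaluate at 1 the quotient of X^o - 1 by X - 1, once as a product and once as a geometric
    sum. *)
Lemma prod_1sub_prim_root (z : algC) o : o.-primitive_root z -> (0 < o)%N ->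
  \prod_(1 <= j < o) (1 - z ^+ j) = o%:R.
Proof.
move=> pz o0; have /esym E := factor_Xn_sub_1 pz.
move: E; case: o o0 pz => // o _ pz; rewrite big_nat_recl // expr0.
have -> : ('X^(o.+1) - 1 : {poly algC}) = ('X - 1%:P) * \sum_(i < o.+1) 'X^i.
  by rewrite subrX1.
move/(mulfI _) => /(_ (negbT (polyXsubC_eq0 _))) /(congr1 (fun p : {poly algC} => p.[1])) /=.
rewrite horner_sum (eq_bigr (fun=> 1)) => [|i _]; last first.
  by rewrite !hornerE expr1n.
rewrite sumr_const card_ord => ->.
rewrite horner_prod big_add1 /=.
by apply: eq_bigr => i _; rewrite hornerXsubC.
Qed.

(** Since [1 - z] divides [o] among the algebraic integers, [p] divides [o ^ e] there, and a
    rational algebraic integer is an integer. *)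
Lemma Aint_dvd_unity_root (z : algC) (o e p : nat) : (0 < p)%N ->
  o.-primitive_root z -> (1 < o)%N -> (z - 1) ^+ e / p%:R \in Aint ->
  (p %| o ^ e)%N.
Proof.
move=> p0 pz o1 ze.
have o0 : (0 < o)%N by apply: ltnW.
have zA : z \in Aint by apply: Aint_prim_root pz.
have oE := prod_1sub_prim_root pz o0.
have : (o ^ e)%:R / p%:R \in Aint.
  rewrite natrX -oE big_ltn // expr1 exprMn mulrAC rpredM //.
    by rewrite -opprB exprNn -mulrA rpredM // rpredX // rpredN.
  by rewrite rpredX // rpred_prod // => i _; rewrite rpredB // rpredX.
move=> A1; have /intrP[a Ea] : ((o ^ e)%:R / p%:R : algC) \is a Num.int.
  by apply: Cint_rat_Aint A1; rewrite rpred_div // rpred_nat.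
have pn0 : p%:R != 0 :> algC by rewrite pnatr_eq0 -lt0n.
have : ((o ^ e)%:Z)%:~R = (a * p%:Z)%:~R :> algC.
  by rewrite intrM /= -Ea divfK.
move/intr_inj => h.
have := dvdz_mull a (dvdzz p%:Z); rewrite -h.
by rewrite /dvdz /=.
Qed.

(* Reduce to z of prime order: by the product of the 1 - z^j this prime is both 2 and 3. *)
Lemma unity_root_23 (z : algC) (e : nat) : (exists2 o, (0 < o)%N & z ^+ o = 1) ->
  (z - 1) ^+ e / 2 \in Aint -> (z - 1) ^+ e / 3 \in Aint -> z = 1.
Proof.
move=> [k k0 zk1] z2 z3.
have [o po ok] := prim_order_exists k0 zk1.
case: (leqP o 1) => [o1|o1].
  have o1' : o = 1%N by have := prim_order_gt0 po; lia.
  by have := prim_expr_order po; rewrite o1' expr1.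
have prq := pdiv_prime o1; set q := pdiv o in prq.
have qo : (q %| o)%N := pdiv_dvd o.
have pq : q.-primitive_root (z ^+ (o %/ q)).
  have := exp_prim_root po (o %/ q).
  rewrite (_ : (o %/ gcdn (o %/ q) o)%N = q) //.
  rewrite (gcdn_idPl _).
    by rewrite divnA // mulKn //; lia.
  by apply/dvdnP; exists q; rewrite mulnC divnK.
have zA : z \in Aint by apply: Aint_prim_root po.
(* z^k - 1 is a multiple of z - 1, so the divisibility passes to powers of [z]. *)
have step p : (z - 1) ^+ e / p%:R \in Aint ->
    (z ^+ (o %/ q) - 1) ^+ e / p%:R \in Aint.
  move=> h; rewrite subrX1 exprMn mulrAC rpredM // rpredX // rpred_sum // => i _.
  by rewrite rpredX.
have q1 : (1 < q)%N := prime_gt1 prq.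
have d2 : (2 %| q ^ e)%N by apply: Aint_dvd_unity_root pq q1 (step 2%N z2).
have d3 : (3 %| q ^ e)%N by apply: Aint_dvd_unity_root pq q1 (step 3%N z3).
move: d2 d3; rewrite !Euclid_dvdX // => /andP[d2 _] /andP[d3 _].
by move: d2 d3; rewrite !dvdn_prime2 // => /eqP <- .
Qed.

Lemma eigenvalue_int_Aint d (A : 'M[int]_d.+1) (x : algC) :
  eigenvalue (map_mx intr A) x -> x \in Aint.
Proof.
rewrite eigenvalue_root_char => rx.
apply: (root_monic_Aint rx); first exact: char_poly_monic.
rewrite -map_char_poly; apply/polyOverP => i; rewrite coef_map /=.
exact: intr_int.
Qed.

(** An eigenvector of [A] for [x] is an eigenvector of the integer matrix [N] for the displayed
    number. *)
Lemma eigenvalue_mod d e (p : nat) (A N : 'M[int]_d.+1) (x : algC) : (0 < p)%N ->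
  (A * (A - 1)) ^+ e = N *+ p -> eigenvalue (map_mx intr A) x ->
  (x * (x - 1)) ^+ e / p%:R \in Aint.
Proof.
move=> p0 AN /eigenvalueP[v Av v0].
apply: (@eigenvalue_int_Aint d N); apply/eigenvalueP; exists v => //.
have pn0 : p%:R != 0 :> algC by rewrite pnatr_eq0 -lt0n.
set B := map_mx intr A in Av.
have h1 : v *m (B * (B - 1)) = (x * (x - 1)) *: v.
  by rewrite -[B * _]/(B *m _) mulmxA Av mulmxBr mulmx1 -!scalemxAl Av -scalerBr
    -[X in _ *: (_ - X)]scale1r -scalerBl scalerA.
have h2 : v *m (B * (B - 1)) ^+ e = (x * (x - 1)) ^+ e *: v.
  elim: e {AN} => [|e IH]; first by rewrite !expr0 mulmx1 scale1r.
  by rewrite exprSr mulmxA IH -scalemxAl h1 scalerA exprSr.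
have h3 : (B * (B - 1)) ^+ e = p%:R *: map_mx intr N.
  have -> : (B * (B - 1)) ^+ e = map_mx intr ((A * (A - 1)) ^+ e).
    by rewrite rmorphXn rmorphM rmorphB rmorph1.
  by rewrite AN raddfMn scaler_nat.
move: h2; rewrite h3 -scalemxAr => h2.
apply: (scalerI pn0); rewrite h2 scalerA mulrCA divff ?mulr1 //; reflexivity.
Qed.

Lemma eigenvalue_01 d e (A N2 N3 : 'M[int]_d.+1) (x : algC) :
  (A * (A - 1)) ^+ e = N2 *+ 2 -> (A * (A - 1)) ^+ e = N3 *+ 3 ->
  eigenvalue (map_mx intr A) x ->
  (exists i j, (i < j)%N /\ x ^+ i = x ^+ j) -> x = 0 \/ x = 1.
Proof.
move=> A2 A3 Ax [i [j [ij E]]].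
have [x0|xn0] := eqVneq x 0; [by left|right].
have xo : x ^+ (j - i) = 1.
  apply: (mulfI (expf_neq0 i xn0)); rewrite mulr1 -exprD E; congr (_ ^+ _); lia.
(* The inverse of a root of unity is integral, which allows the factor [x ^+ e] to be cancelled. *)
have xA : x^-1 \in Aint.
  rewrite (_ : x^-1 = x ^+ (j - i).-1).
    by rewrite rpredX // (eigenvalue_int_Aint Ax).
  by apply: (mulfI xn0); rewrite divff // -exprS prednK ?xo //; lia.
have step p N : (0 < p)%N -> (A * (A - 1)) ^+ e = N *+ p -> (x - 1) ^+ e / p%:R \in Aint.
  move=> p0 AN; have := eigenvalue_mod p0 AN Ax.
  rewrite exprMn => h.
  have -> : (x - 1) ^+ e / p%:R = (x^-1) ^+ e * (x ^+ e * (x - 1) ^+ e / p%:R).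
    by rewrite !mulrA -exprMn mulVf // expr1n mul1r.
  by rewrite rpredM // rpredX.
apply: (@unity_root_23 x e); [by exists (j - i)%N; rewrite ?subn_gt0| |].
  exact: step A2.
exact: step A3.
Qed.

Lemma norm_det_le r (M : 'M[int]_r) (h : nat) :
  (forall i j, `|M i j| <= h%:Z) -> `|\det M| <= (r`! * h ^ r)%N%:Z.
Proof.
move=> Mh; apply: le_trans (ler_norm_sum _ _ _) _.
apply: (@le_trans _ _ (\sum_(s : 'S_r) (h ^ r)%N%:Z)).
  apply: ler_sum => s _; rewrite normrM normrX normrN1 expr1n mul1r normr_prod.
  rewrite -[X in _ <= X]natz natrX natz.
  apply: (@le_trans _ _ (\prod_(i < r) h%:Z)).
    by apply: ler_prod => i _; rewrite normr_ge0 Mh.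
  by rewrite prodr_const card_ord.
by rewrite sumr_const card_Sn -mulr_natl natz -PoszM.
Qed.

Lemma norm_krylov d (A : 'M[int]_d.+1) (z : 'rV[int]_d.+1) (h i : nat) :
  (forall j k, `|A j k| <= h%:Z) -> (forall k, `|z 0 k| <= h%:Z) ->
  forall k, `|(z *m A ^+ i) 0 k| <= (h * (d.+1 * h) ^ i)%N%:Z.
Proof.
move=> Ah zh; elim: i => [|i IH] k; first by rewrite expr0 mulmx1 muln1.
rewrite exprSr -[_ * A]/(_ *m A) mulmxA mxE; apply: le_trans (ler_norm_sum _ _ _) _.
apply: (@le_trans _ _ (\sum_(j < d.+1) (h * (d.+1 * h) ^ i * h)%N%:Z)).
  by apply: ler_sum => j _; rewrite normrM PoszM ler_pM.
rewrite sumr_const card_ord -mulr_natl natz -PoszM lez_nat expnS; lia.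
Qed.

(** Select r + 1 independent columns of [E]. Their determinant is a non-zero integer, so its
    absolute value is at least 1, and Cramer's rule leaves only the cofactors to be estimated. *)
Lemma cramer_bound r d (E : 'M[int]_(r.+1, d)) (w : 'rV[int]_d) (g : 'rV[rat]_r.+1)
    (h1 h2 : nat) :
  row_free (map_mx intr E : 'M[rat]_(r.+1, d)) ->
  (forall i j, `|E i j| <= h1%:Z) -> (forall j, `|w 0 j| <= h2%:Z) ->
  g *m map_mx intr E = map_mx intr w ->
  forall i, `|g 0 i| <= (r.+1 * (h2 * (r`! * h1 ^ r)))%N%:R.
Proof.
move=> Efree Eh wh gE i.
have Efull : row_full (map_mx intr E : 'M[rat]_(r.+1, d))^T.
  by rewrite /row_full mxrank_tr.
pose f := fullrankfun Efull.
have Su : (map_mx intr (colsub f E) : 'M[rat]_r.+1) \in unitmx.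
  rewrite -unitmx_tr (_ : _^T = rowsub f (map_mx intr E)^T) ?fullrowsub_unit //.
  by apply/matrixP => a b; rewrite !mxE.
have gS : g *m map_mx intr (colsub f E) = map_mx intr (colsub f w).
  by rewrite !map_mxsub -gE mulmx_colsub.
set S := colsub f E in Su gS.
have Dn0 : \det S != 0.
  move: Su; rewrite unitmxE det_map_mx unitfE; apply: contra => /eqP->.
  by rewrite rmorph0.
have gD : (\det S)%:~R *: g = map_mx intr (colsub f w *m \adj S).
  rewrite map_mxM -gS -mulmxA map_mx_adj mul_mx_adj det_map_mx.
  by rewrite -scalemx1 -scalemxAr mulmx1.
have D1 : 1 <= `|(\det S)%:~R| :> rat.
  by rewrite -intr_norm ler1z; move: Dn0; lia.
apply: (@le_trans _ _ `|(\det S)%:~R * g 0 i|).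
  by rewrite normrM ler_peMl.
have /matrixP/(_ 0 i) := gD; rewrite !mxE => ->.
rewrite -intr_norm -[X in _ <= X]/((r.+1 * (h2 * (r`! * h1 ^ r)))%N%:Z%:~R).
rewrite ler_int.
apply: le_trans (ler_norm_sum _ _ _) _.
apply: (@le_trans _ _ (\sum_(j < r.+1) (h2 * (r`! * h1 ^ r))%N%:Z)).
  apply: ler_sum => j _; rewrite normrM !mxE PoszM ler_pM //.
  rewrite /cofactor normrM normrX normrN1 expr1n mul1r.
  by apply: norm_det_le => a b; rewrite !mxE.
by rewrite sumr_const card_ord -mulr_natl natz -PoszM.
Qed.

(** The characteristic polynomial is X^a (X - 1)^b with a at most r + 1; raising a to r + 1 keeps
    the product zero by Cayley-Hamilton. *)
Lemma charpoly01 r (C : 'M[rat]_r.+1) :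
  (forall x, eigenvalue (map_mx ratr C : 'M[algC]_r.+1) x -> x = 0 \/ x = 1) ->
  exists b, C ^+ r.+1 * (C - 1) ^+ b = 0.
Proof.
move=> C01; set p := char_poly C.
have [s Es] := closed_field_poly_normal (map_poly ratr p : {poly algC}).
have mon : lead_coef (map_poly ratr p : {poly algC}) = 1.
  by apply/monicP; rewrite map_monic char_poly_monic.
rewrite mon scale1r in Es.
have s01 x : x \in s -> x = 0 \/ x = 1.
  rewrite -root_prod_XsubC -Es map_char_poly -eigenvalue_root_char; exact: C01.
have ss : size s = r.+1.
  have := size_char_poly (map_mx ratr C : 'M[algC]_r.+1).
  by rewrite -map_char_poly -/p Es size_prod_XsubC => -[].
have [a [b [Eab ar]]] : exists a b, \prod_(x <- s) ('X - x%:P) =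
     'X ^+ a * ('X - 1) ^+ b :> {poly algC} /\ (a <= size s)%N.
  elim: s s01 {Es ss} => [|x s IH] s01.
    by exists 0%N, 0%N; rewrite big_nil !expr0 mulr1.
  have [a [b [E al]]] := IH (fun y ys => s01 y (@mem_behead _ (x :: s) y ys)).
  rewrite big_cons E.
  have [-> | ->] := s01 x (mem_head _ _).
    by exists a.+1, b; split; [rewrite subr0 exprS mulrA | rewrite /= ltnS].
  exists a, b.+1; split; last by apply: leq_trans al _.
  by rewrite exprS mulrCA.
have Ep : p = 'X ^+ a * ('X - 1) ^+ b.
  apply: (map_poly_inj (ratr : {rmorphism rat -> algC})).
  by rewrite Es Eab rmorphM !rmorphXn rmorphB /= map_polyX rmorph1.
exists b; have := Cayley_Hamilton C; rewrite -/p Ep rmorphM !rmorphXn rmorphB rmorph1 /=.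
rewrite horner_mx_X => CH.
have h k : (a <= k)%N -> C ^+ k * (C - 1) ^+ b = 0.
  by move=> /subnK <-; rewrite exprD -mulrA CH mulr0.
by apply: h; rewrite -ss.
Qed.

(** The estimate of [cramer_bound] for the rows [z A^i] with i at most [d], whose entries are
    bounded in [norm_krylov]. *)
Definition gamma_bound (d h : nat) :=
  (d.+1 * (h * (d`! * (h * (d.+1 * h) ^ d) ^ d)))%N.

(** The first two summands meet the hypothesis of [companion_eigenvalue_le] for
    [J = (kron_bound d).+1], the third, with the successor, that of [companion_no_jordan]. *)
Definition orbit_bound (d h : nat) :=
  (d.+1 + (kron_bound d).+1 * (d.+1 * gamma_bound d h)
    + d.+1 * d.+1 * gamma_bound d h).+1.

Lemma kron_bound_mono r d : (r <= d)%N -> (kron_bound r <= kron_bound d)%N.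
Proof.
move=> rd; rewrite /kron_bound leq_mul //.
apply: leq_trans (_ : (2 * 3 ^ d.+1).+1 ^ r.+2 <= _)%N; last by rewrite leq_pexp2l.
by rewrite leq_exp2r // ltnS leq_mul // leq_pexp2l.
Qed.

Lemma gamma_bound_mono r d h : (0 < h)%N -> (r <= d)%N ->
  (r.+1 * (h * (r`! * (h * (d.+1 * h) ^ d) ^ r)) <= gamma_bound d h)%N.
Proof.
move=> h0 rd; rewrite /gamma_bound; apply: leq_mul => //; apply: leq_mul => //.
apply: leq_mul; first by apply: leq_fact.
by rewrite leq_pexp2l // muln_gt0 h0 expn_gt0 muln_gt0 h0.
Qed.

(** * Cyclic subspaces and their companion matrices *)

Section Krylov.
Variables (d : nat) (A : 'M[rat]_d.+1) (z : 'rV[rat]_d.+1).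

Definition krylov r : 'M[rat]_(r, d.+1) := \matrix_(i < r) (z *m A ^+ i).

Lemma row_krylov r (i : 'I_r) : row i (krylov r) = z *m A ^+ i.
Proof. by rewrite rowK. Qed.

(** Solve the relation for the row with the last non-zero coefficient. *)
Lemma krylov_dependent r (v : 'rV_r) : v != 0 -> v *m krylov r = 0 ->
  exists2 i, (i < r)%N & (z *m A ^+ i <= krylov i)%MS.
Proof.
move=> v0 vE; have [i0 vi0] : exists i, v 0 i != 0 by apply/rV0Pn.
pose i := [arg max_(i > i0 | v 0 i != 0) (i : nat)].
have [vi imax] : v 0 i != 0 /\ forall j, v 0 j != 0 -> (j <= i)%N.
  by rewrite /i; case: arg_maxnP.
exists i => //.
have -> : z *m A ^+ i = (v 0 i)^-1 *: - \sum_(j < r | (j < i)%N) v 0 j *: (z *m A ^+ j).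
  apply: (scalerI vi); rewrite scalerA divff // scale1r.
  apply/eqP; rewrite -addr_eq0; apply/eqP; rewrite -[RHS]vE [RHS]mulmx_sum_row.
  rewrite [RHS](bigD1 i) //= row_krylov; congr (_ + _).
  rewrite big_mkcond [RHS]big_mkcond; apply: eq_bigr => j _; rewrite row_krylov.
  case: ltngtP => [ji|ij|/val_inj ->]; last by rewrite eqxx.
    by rewrite (_ : j != i) // -val_eqE /= neq_ltn ji.
  case: eqP => //= _; have [->|/imax] := eqVneq (v 0 j) 0; first by rewrite scale0r.
  by rewrite leqNgt ij.
rewrite scalemx_sub // eqmx_opp summx_sub // => j ji.
rewrite scalemx_sub // (_ : z *m A ^+ j = row (Ordinal ji) (krylov i)) ?row_sub //.
by rewrite row_krylov.
Qed.

Lemma krylov_stop : exists2 r, (r <= d.+1)%N & (z *m A ^+ r <= krylov r)%MS.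
Proof.
have [free|] := boolP (row_free (krylov d.+2)).
  by have := rank_leq_col (krylov d.+2); rewrite (eqP free) ltnn.
rewrite -kermx_eq0 => /rowV0Pn[v /sub_kermxP vE v0].
by have [i id h] := krylov_dependent v0 vE; exists i.
Qed.

(** Stop at the first power that depends on the earlier ones: minimality gives independence, and the
    span is stable under [A]. The matrix [C] describes [A] on this cyclic subspace. *)
Lemma krylov_basis : z != 0 -> exists r (C : 'M[rat]_r.+1),
  [/\ (r <= d)%N, row_free (krylov r.+1) & krylov r.+1 *m A = C *m krylov r.+1].
Proof.
move=> z0; have ex : exists r, (z *m A ^+ r <= krylov r)%MS.
  by have [r _ h] := krylov_stop; exists r.
case: (ex_minnP ex) => r hr rmin.
have rd : (r <= d.+1)%N.
  by have [r' r'd h] := krylov_stop; apply: leq_trans r'd; apply: rmin.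
case: r hr rmin rd => [|r] hr rmin rd.
  move: hr; rewrite expr0 mulmx1 => /submxP[D]; rewrite [D]thinmx0 mul0mx => z00.
  by rewrite z00 eqxx in z0.
have free : row_free (krylov r.+1).
  apply: inj_row_free => v vE; apply/eqP; apply: contraT => v0.
  have [i ir /rmin] := krylov_dependent v0 vE.
  by rewrite leqNgt ir.
have st : (krylov r.+1 *m A <= krylov r.+1)%MS.
  apply/row_subP => i; rewrite row_mul row_krylov -mulmxA -[_ *m A]/(_ * A) -exprSr.
  have [ir|ir] := ltnP i.+1 r.+1; last first.
    by have -> : i.+1 = r.+1 by apply/eqP; rewrite eqn_leq ir ltn_ord.
  by rewrite (_ : z *m _ = row (Ordinal ir) (krylov r.+1)) ?row_sub // row_krylov.
by exists r, (krylov r.+1 *m A *m pinvmx (krylov r.+1)); split=> //; rewrite mulmxKpV.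
Qed.
End Krylov.

Section Companion.
Variables (d r : nat) (A : 'M[rat]_d.+1) (z : 'rV[rat]_d.+1) (C : 'M[rat]_r.+1).
Hypothesis free : row_free (krylov A z r.+1).
Hypothesis AC : krylov A z r.+1 *m A = C *m krylov A z r.+1.

(** The first row of [C ^+ k] holds the coordinates of [z A^k] in the basis z, ..., z A^r. For k = q
    these are the numbers that Cramer's rule bounds. *)
Lemma krylov_companion k : row 0 (C ^+ k) *m krylov A z r.+1 = z *m A ^+ k.
Proof.
suff h : C ^+ k *m krylov A z r.+1 = krylov A z r.+1 *m A ^+ k.
  by rewrite -row_mul h row_mul row_krylov expr0 mulmx1.
elim: k => [|k IH]; first by rewrite !expr0 mulmx1 mul1mx.
rewrite exprS -[C * _]/(C *m _) -mulmxA IH mulmxA -AC -mulmxA.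
by rewrite -[A *m _]/(A * _) -exprS.
Qed.

Lemma row0_companion_exp (i : 'I_r.+1) : row 0 (C ^+ i) = delta_mx 0 i.
Proof.
by apply: (row_free_inj free); rewrite krylov_companion -rowE row_krylov.
Qed.

(** All coordinates of a column can thus be read off the coordinate 0 of its images under the powers
    of [C]; for an eigenvector they form a geometric progression. *)
Lemma companion_entry (R : fieldType) (f : {rmorphism rat -> R}) (u : 'cV[R]_r.+1) (i : 'I_r.+1) :
  u i 0 = (map_mx f (row 0 (C ^+ i)) *m u) 0 0.
Proof. by rewrite row0_companion_exp map_delta_mx -rowE mxE. Qed.

Lemma companion_eigenvalue (x : algC) : eigenvalue (map_mx ratr C) x ->
  eigenvalue (map_mx ratr A) x.
Proof.
move=> /eigenvalueP[v Cv v0]; apply/eigenvalueP.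
exists (v *m map_mx ratr (krylov A z r.+1)).
  by rewrite -mulmxA -map_mxM AC map_mxM mulmxA Cv -scalemxAl.
by rewrite mulmx_free_eq0 ?row_free_map.
Qed.

Variables (q G : nat).
Hypothesis gammaG : forall i, `|(row 0 (C ^+ q)) 0 i| <= G%:R.

(* Evaluate the expression of C^q in terms of 1, C, ..., C^r at an eigenvector. *)
Lemma companion_eigenvalue_pow (x : algC) : eigenvalue (map_mx ratr C) x ->
  x ^+ q = \sum_(i < r.+1) ratr ((row 0 (C ^+ q)) 0 i) * x ^+ i.
Proof.
rewrite eigenvalue_root_char => rx.
have /eqP : \det (map_mx ratr C - x%:M)^T = 0.
  rewrite det_tr; apply/eqP/det0P.
  move: rx; rewrite -eigenvalue_root_char => /eigenvalueP[v Cv v0].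
  by exists v => //; rewrite mulmxBr Cv mul_mx_scalar subrr.
move=> /det0P[v v0 vC].
pose u := v^T.
have Cu : map_mx ratr C *m u = x *: u.
  move: vC => /(congr1 trmx); rewrite trmx_mul trmxK trmx0 mulmxBl mul_scalar_mx.
  by move/eqP; rewrite subr_eq0 => /eqP.
have Cku k : map_mx ratr (C ^+ k) *m u = x ^+ k *: u.
  elim: k => [|k IH]; first by rewrite !expr0 map_mx1 mul1mx scale1r.
  by rewrite exprSr map_mxM -mulmxA Cu -scalemxAr IH scalerA mulrC -exprSr.
have ui i : u i 0 = x ^+ i * u 0 0.
  rewrite (companion_entry (ratr : {rmorphism rat -> algC})) map_row -row_mul Cku.
  by rewrite !mxE.
have u00 : u 0 0 != 0.
  apply: contra v0 => /eqP u0; rewrite -[v]trmxK -/u.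
  apply/eqP/rowP => i; rewrite mxE ui u0 mulr0 mxE //.
apply: (mulIf u00).
have <- : (map_mx ratr (row 0 (C ^+ q)) *m u) 0 0 = x ^+ q * u 0 0.
  by rewrite map_row -row_mul Cku !mxE.
rewrite mxE mulr_suml; apply: eq_bigr => i _.
by rewrite [in LHS]ui mulrA [map_mx _ _ _ _]mxE.
Qed.

(** If |x| > 1, the previous expression gives |x|^q <= (r+1) G |x|^(r+1), hence |x|^(J (r+1) G) <=
    (r+1) G < 2^((r+1) G), which contradicts |x|^J > 2. *)
Lemma companion_eigenvalue_le (x : algC) J : eigenvalue (map_mx ratr C) x ->
  (0 < G)%N -> (0 < J)%N -> (r.+1 + J * (r.+1 * G) <= q)%N -> `|x| ^+ J <= 2.
Proof.
move=> Cx G0 J0 qJ; have Ex := companion_eigenvalue_pow Cx.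
have [x1|] := boolP (`|x| <= 1).
  by apply: (@le_trans _ _ 1); rewrite ?exprn_ile1 ?ler1n.
rewrite -real_ltNge ?normr_real ?real1 // => x1.
apply: contraT; rewrite -real_ltNge ?rpredX ?normr_real ?realn // => xJ.
have x0 : 0 < `|x| by apply: lt_trans x1; rewrite ltr01.
have h1 : `|x| ^+ q <= (r.+1 * G)%:R * `|x| ^+ r.+1.
  rewrite -normrX Ex; apply: le_trans (ler_norm_sum _ _ _) _.
  apply: (@le_trans _ _ (\sum_(i < r.+1) G%:R * `|x| ^+ r.+1)); last first.
    by rewrite sumr_const card_ord -[X in X <= _]mulr_natl mulrA natrM.
  apply: ler_sum => i _; rewrite normrM normrX ler_pM ?normr_ge0 ?exprn_ge0 //.
    rewrite -ratr_norm -[X in _ <= X]ratr_nat ler_rat; exact: gammaG.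
  by rewrite ler_weXn2l // 1?ltW // ltnW.
have h2 : `|x| ^+ (J * (r.+1 * G)) <= (r.+1 * G)%:R.
  rewrite -(ler_pM2r (exprn_gt0 r.+1 x0)) (le_trans _ h1) // -exprD.
  by rewrite ler_weXn2l // 1?ltW // addnC.
have h3 : (2 ^ (r.+1 * G))%:R <= `|x| ^+ (J * (r.+1 * G)).
  by rewrite exprM natrX lerXn2r ?nnegrE ?exprn_ge0 // 1?ltW.
have := le_trans h3 h2; rewrite ler_nat leqNgt ltn_expl //.
Qed.

(* On a Jordan block u, u' for the eigenvalue 1 the coordinates g_i of C^q satisfy
   q = sum_i i g_i, which bounds q. *)
Lemma companion_no_jordan b : C ^+ r.+1 * (C - 1) ^+ b = 0 ->
  (r.+1 * r.+1 * G < q)%N -> C ^+ r.+1 * (C - 1) = 0.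
Proof.
move=> Cb qG.
have [b0 hb bmin] := ex_minnP (ex_intro (fun b => C ^+ r.+1 * (C - 1) ^+ b == 0) b (introT eqP Cb)).
case: b0 hb bmin => [|[|b']] hb bmin.
- by move: hb; rewrite expr0 mulr1 => /eqP ->; rewrite mul0r.
- by move: hb; rewrite expr1 => /eqP.
(* The minimal exponent is b' + 2, so a suitable column of [P] is the top of a Jordan chain of
   length two for the eigenvalue 1. *)
pose P := C ^+ r.+1 * (C - 1) ^+ b'.
have CP : (C - 1) * P = P * (C - 1).
  apply: commrM; last exact: commrX.
  by apply/commrX/commr_sym; apply: commrB; last exact: commr1.
have P1 : (C - 1) * P != 0.
  rewrite CP /P -mulrA -exprSr; apply/negP => /bmin.
  by rewrite ltnn.
have P2 : (C - 1) * ((C - 1) * P) = 0.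
  by rewrite CP mulrA CP /P -[RHS](eqP hb) !exprSr !mulrA.
have [i [j Pij]] : exists i j, ((C - 1) * P) i j != 0.
  apply/matrix0Pn: P1.
pose u := col j P; pose u' := col j ((C - 1) * P).
have colM (M N : 'M[rat]_r.+1) : col j (M * N) = M *m col j N.
  by rewrite !colE mulmxA.
have Cu : C *m u = u + u'.
  by rewrite /u' colM mulmxBl mul1mx addrCA subrr addr0.
have Cu' : C *m u' = u'.
  have : (C - 1) *m u' = 0 by rewrite -colM P2 linear0.
  by rewrite mulmxBl mul1mx => /eqP; rewrite subr_eq0 => /eqP.
have Cku' k : C ^+ k *m u' = u'.
  elim: k => [|k IH]; first by rewrite expr0 mul1mx.
  by rewrite exprS -mulmxA IH.
have Cku k : C ^+ k *m u = u + u' *+ k.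
  elim: k => [|k IH]; first by rewrite expr0 mul1mx addr0.
  rewrite exprS -mulmxA IH mulmxDr Cu mulrSr -[u' *+ k]scaler_nat -scalemxAr Cu'.
  by rewrite scaler_nat -!addrA [u' + _]addrC.
have entry v k : (row 0 (C ^+ k) *m v) 0 0 = (C ^+ k *m v) 0 (0 : 'I_1).
  by rewrite -row_mul !mxE.
have entryI (v : 'cV[rat]_r.+1) (k : 'I_r.+1) : v k (0 : 'I_1) = (C ^+ k *m v) 0 0.
  by rewrite -entry row0_companion_exp -rowE mxE.
have ui' k : u' k 0 = u' 0 0 by rewrite entryI Cku'.
have ui k : u k 0 = u 0 0 + k%:R * u' 0 0.
  by rewrite entryI Cku [LHS]mxE mulmxnE mulr_natl.
have u0 : u' 0 0 != 0 by rewrite -(ui' i) /u' mxE.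
pose g i := (row 0 (C ^+ q)) 0 i.
have sumE (v : 'cV[rat]_r.+1) : (C ^+ q *m v) 0 (0 : 'I_1) = \sum_(i < r.+1) g i * v i 0.
  by rewrite -entry mxE.
have g1 : \sum_i g i = 1.
  apply: (mulIf u0); rewrite mul1r -{2}(Cku' q) sumE mulr_suml.
  by apply: eq_bigr => k _; rewrite ui'.
have gq : q%:R = \sum_(i < r.+1) i%:R * g i.
  apply: (mulIf u0); apply: (@addrI _ (u 0 0)).
  have -> : u 0 0 + q%:R * u' 0 0 = (C ^+ q *m u) 0 0.
    by rewrite Cku [RHS]mxE mulmxnE mulr_natl.
  rewrite sumE (eq_bigr (fun k : 'I_r.+1 => g k * u 0 0 + k%:R * g k * u' 0 0)).
    by rewrite big_split /= -!mulr_suml g1 mul1r.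
  by move=> k _; rewrite [u k 0]ui; ring.
have : (q%:R : rat) <= (r.+1 * r.+1 * G)%:R.
  rewrite gq; apply: le_trans (ler_norm _) _; apply: le_trans (ler_norm_sum _ _ _) _.
  apply: (@le_trans _ _ (\sum_(i < r.+1) (r.+1 * G)%:R)).
    apply: ler_sum => k _; rewrite normrM natrM ler_pM // normr_nat ler_nat.
    exact: ltnW.
  by rewrite sumr_const card_ord -[X in X <= _]mulr_natl -natrM mulnA.
by rewrite ler_nat leqNgt qG.
Qed.

End Companion.

Theorem matrix_orbit d (h e q : nat) (A N2 N3 : 'M[int]_d.+1) (z w : 'rV[int]_d.+1) :
  (forall i j, `|A i j| <= h%:Z) -> (forall i, `|z 0 i| <= h%:Z) ->
  (forall i, `|w 0 i| <= h%:Z) ->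
  (A * (A - 1)) ^+ e = N2 *+ 2 -> (A * (A - 1)) ^+ e = N3 *+ 3 ->
  z *m A ^+ q = w -> (orbit_bound d h <= q)%N -> w *m A = w.
Proof.
move=> Ah zh wh A2 A3 zw qB.
have [z0|z0] := eqVneq z 0; first by rewrite -zw z0 !mul0mx.
have h0 : (0 < h)%N.
  rewrite lt0n; apply: contra z0 => /eqP h0; apply/eqP/rowP => i.
  by have := zh i; rewrite h0 mxE normr_le0 => /eqP.
pose Aq := map_mx intr A : 'M[rat]_d.+1; pose zq := map_mx intr z : 'rV[rat]_d.+1.
have zq0 : zq != 0 by apply: contra_neq z0 => h0'; apply/rowP => i; apply: (@intr_inj rat);
    have /rowP/(_ i) := h0'; rewrite !mxE.
have [r [C [rd free AC]]] := krylov_basis Aq zq0.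
have zwq : zq *m Aq ^+ q = map_mx intr w.
  by rewrite -zw map_mxM rmorphXn.
set G := gamma_bound d h.
have G0 : (0 < G)%N by rewrite /G /gamma_bound !muln_gt0 h0 fact_gt0 expn_gt0 muln_gt0 expn_gt0 !muln_gt0 h0.
have Hk0 : (0 < (d.+1 * h))%N by rewrite muln_gt0.
have gG i : `|(row 0 (C ^+ q)) 0 i| <= G%:R.
  pose E : 'M[int]_(r.+1, d.+1) := \matrix_(i < r.+1) (z *m A ^+ i).
  have EE : map_mx intr E = krylov Aq zq r.+1.
    apply/row_matrixP => k; rewrite -map_row rowK row_krylov map_mxM rmorphXn //.
  have Efree : row_free (map_mx intr E : 'M[rat]_(r.+1, d.+1)) by rewrite EE.
  have Eh a b : `|E a b| <= (h * (d.+1 * h) ^ d)%N%:Z.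
    rewrite mxE; apply: le_trans (norm_krylov a Ah zh b) _.
    rewrite lez_nat leq_mul // leq_pexp2l //.
    by rewrite (leq_trans _ rd) // -ltnS.
  have := cramer_bound Efree Eh wh _ i.
  move=> /(_ (row 0 (C ^+ q))); rewrite EE krylov_companion // => /(_ zwq) hh.
  by apply: le_trans hh _; rewrite ler_nat gamma_bound_mono.
have mE : (map_mx ratr Aq : 'M[algC]_d.+1) = map_mx intr A.
  by apply/matrixP => i j; rewrite !mxE ratr_int.
have CA x : eigenvalue (map_mx ratr C : 'M[algC]_r.+1) x -> x \in Aint.
  by move/(companion_eigenvalue free AC); rewrite mE; apply: eigenvalue_int_Aint.
have leR : (r.+1 + (kron_bound r).+1 * (r.+1 * G) <= q)%N.
  apply: leq_trans qB; rewrite /orbit_bound -/G.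
  have := @kron_bound_mono r d rd => h1.
  have h2 : ((kron_bound r).+1 * (r.+1 * G) <= (kron_bound d).+1 * (d.+1 * G))%N.
    by rewrite leq_mul // leq_mul.
  lia.
have C2 x : eigenvalue (map_mx ratr C : 'M[algC]_r.+1) x -> `|x| ^+ (kron_bound r).+1 <= 2.
  by move=> Cx; apply: (companion_eigenvalue_le free AC gG Cx).
have C01 x : eigenvalue (map_mx ratr C : 'M[algC]_r.+1) x -> x = 0 \/ x = 1.
  move=> Cx; apply: (eigenvalue_01 A2 A3).
    by rewrite -mE; apply: (companion_eigenvalue free AC).
  exact: kronecker_eigenvalues CA C2 _ Cx.
have [b Cb] := charpoly01 C01.
have C1 : C ^+ r.+1 * (C - 1) = 0.
  apply: (companion_no_jordan free AC gG Cb); apply: leq_trans qB.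
  rewrite /orbit_bound -/G ltnS.
  have : (r.+1 * r.+1 * G <= d.+1 * d.+1 * G)%N by rewrite leq_mul // leq_mul.
  lia.
have rq : (r.+1 <= q)%N by apply: leq_trans leR; rewrite leq_addr.
(* The nilpotent part is dead after r + 1 steps, and on the rest [C] is the identity. *)
have CqC : C ^+ q.+1 = C ^+ q.
  apply/eqP; rewrite -subr_eq0 exprSr -[X in _ - X]mulr1 -mulrBr.
  by rewrite -(subnK rq) exprD -mulrA C1 mulr0.
have : map_mx intr (w *m A) = map_mx intr w :> 'rV[rat]_d.+1.
  rewrite map_mxM -zwq -mulmxA -[_ *m Aq]/(_ * Aq) -exprSr.
  by rewrite -!(krylov_companion AC) CqC.
move=> E; apply/rowP => i; apply: (@intr_inj rat).
by have /rowP/(_ i) := E; rewrite [LHS]mxE [RHS]mxE.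
Qed.

(** * Ideals and truncated polynomials *)

(** One notion of congruence serves for equality ([zero_ideal]), for residues of integers
    ([dvd_ideal]) and for truncation of polynomials ([trunc_ideal]). *)
Record ideal (K : comNzRingType) := Ideal {
  in_ideal :> K -> Prop;
  ideal0 : in_ideal 0;
  idealD : forall a b, in_ideal a -> in_ideal b -> in_ideal (a + b);
  idealMl : forall a b, in_ideal b -> in_ideal (a * b) }.

Definition zero_ideal (K : comNzRingType) : ideal K.
Proof.
exists (fun a => a = 0) => //; first by move=> a b -> ->; rewrite addr0.
by move=> a b ->; rewrite mulr0.
Defined.

Definition dvd_ideal (p : int) : ideal int.
Proof.
exists (fun a => (p %| a)%Z) => [|a b|a b]; first exact: dvdz0.
  exact: rpredD.
exact: dvdz_mull.
Defined.

Section Low.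
Variables (D : nat) (K : comNzRingType).
Implicit Types (I : ideal K) (p q : {mpoly K[D]}).

(* [low I j p]: p lies in the sum of I K[X] and of the j-th power of the
   ideal generated by the variables. *)
Definition low I j p := forall m, (mdeg m < j)%N -> I p@_m.

Definition low0 j p := low (zero_ideal K) j p.

Lemma low_ideal_sum I (T : Type) (r : seq T) (P : pred T) (F : T -> K) :
  (forall i, P i -> I (F i)) -> I (\sum_(i <- r | P i) F i).
Proof. by move=> h; apply: big_ind => //; [apply: ideal0|apply: idealD]. Qed.

Lemma ideal_opp I a : I a -> I (- a).
Proof. by rewrite -mulN1r; apply: idealMl. Qed.

Lemma lowD I j p q : low I j p -> low I j q -> low I j (p + q).
Proof. by move=> hp hq m mj; rewrite mcoeffD; apply: idealD; [apply: hp|apply: hq]. Qed.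

Lemma lowN I j p : low I j p -> low I j (- p).
Proof. by move=> hp m mj; rewrite mcoeffN; apply/ideal_opp/hp. Qed.

Lemma lowB I j p q : low I j p -> low I j q -> low I j (p - q).
Proof. by move=> hp /lowN; apply: lowD. Qed.

Lemma low_zero I j : low I j 0.
Proof. by move=> m _; rewrite mcoeff0; apply: ideal0. Qed.

Lemma low_0 I p : low I 0 p. Proof. by []. Qed.

Lemma low_sum I j (T : Type) (r : seq T) (P : pred T) (F : T -> {mpoly K[D]}) :
  (forall i, P i -> low I j (F i)) -> low I j (\sum_(i <- r | P i) F i).
Proof. by move=> h; apply: big_ind => //; [apply: low_zero|apply: lowD]. Qed.

Lemma low_leq I i j p : (i <= j)%N -> low I j p -> low I i p.
Proof. by move=> ij h m mi; apply: h; apply: leq_trans mi ij. Qed.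

Lemma lowM I a b p q : low I a p -> low0 b q -> low I (a + b) (p * q).
Proof.
move=> hp hq m mab; rewrite mcoeffM; apply: low_ideal_sum => -[k1 k2] /= /eqP E.
have := congr1 (fun m => mdeg m) E; rewrite mdegD => E'.
case: (ltnP (mdeg k1) a) => [k1a|ak1].
  by rewrite mulrC; apply/idealMl/hp.
rewrite (hq k2); last by lia.
by rewrite mulr0; apply: ideal0.
Qed.

Lemma lowMl I a p q : low I a q -> low I a (p * q).
Proof. by move=> hq; rewrite mulrC -[a]addn0; apply: lowM. Qed.

Lemma lowMr I a p q : low I a p -> low I a (p * q).
Proof. by move=> hq; rewrite -[a]addn0; apply: lowM. Qed.

Lemma lowX j p k : low0 j p -> low0 (j * k) (p ^+ k).
Proof.
move=> h; elim: k => [|k IH]; first by rewrite muln0.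
by rewrite mulnS exprS; apply: lowM.
Qed.

Lemma lowX1 p k : low0 1 p -> low0 k (p ^+ k).
Proof. by move/(@lowX 1 p k); rewrite mul1n. Qed.

Lemma low0_prod E (h : 'I_E -> {mpoly K[D]}) m :
  (forall i, low0 1 (h i)) -> low0 (mdeg m) (mmap1 h m).
Proof.
move=> h1; rewrite /mmap1 mdegE.
elim/big_rec2: _ => [|i p j _ IH]; first exact: low_0.
by apply: lowM => //; apply: lowX1.
Qed.

(** Exchange the factors one at a time: each exchange replaces a factor of order 1 by a difference
    of order 2 and so gains one degree. *)
Lemma prod_congr_low E I (h g : 'I_E -> {mpoly K[D]}) m :
  (forall i, low0 1 (h i)) -> (forall i, low0 1 (g i)) ->
  (forall i, low I 2 (h i - g i)) ->
  low I (mdeg m).+1 (mmap1 h m - mmap1 g m).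
Proof.
move=> h1 g1 hg; rewrite /mmap1 mdegE.
have key : forall r : seq 'I_E, low0 (\sum_(i <- r) m i) (\prod_(i <- r) g i ^+ m i) /\
    low I (\sum_(i <- r) m i).+1 (\prod_(i <- r) h i ^+ m i - \prod_(i <- r) g i ^+ m i).
  elim=> [|i r [IH1 IH2]]; first by rewrite !big_nil subrr; split=> //; apply: low_zero.
  rewrite !big_cons; split; first by apply: lowM => //; apply: lowX1.
  rewrite (_ : _ - _ = (h i ^+ m i - g i ^+ m i) * (\prod_(j <- r) g j ^+ m j) +
     h i ^+ m i * (\prod_(i <- r) h i ^+ m i - \prod_(i <- r) g i ^+ m i)); last by ring.
  apply: lowD.
    rewrite -addSn; apply: lowM => //.
    case: (m i) => [|k]; first by rewrite !expr0 subrr; apply: low_zero.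
    rewrite subrXX -addn2 addnC; apply: lowM => //.
    apply: low_sum => -[j jk] _ /=.
    have : low0 (k - j + j) (h i ^+ (k - j) * g i ^+ j) by apply: lowM; apply: lowX1.
    by rewrite subnK.
  rewrite addnC -addSn mulrC; apply: lowM => //; exact: lowX1.
by have [] := key (index_enum 'I_E).
Qed.

End Low.

Notation subst h := (mmap (intr : int -> _) h).

Section Subst.
Variables (D : nat).
Implicit Types (p q : {mpoly int[D]}).

Lemma substX (S : comNzRingType) (h : 'I_D -> S) i : subst h 'X_i = h i.
Proof. by rewrite mmapX mmap1U. Qed.

Lemma subst_comp D' (S : comNzRingType) (h : 'I_D -> {mpoly int[D']}) (g : 'I_D' -> S) p :
  subst g (subst h p) = subst (fun i => subst g (h i)) p.
Proof.
rewrite [subst h p]/mmap [RHS]/mmap rmorph_sum; apply: eq_bigr => m _.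
rewrite rmorphM rmorph_int; congr (_ * _).
rewrite /mmap1 rmorph_prod; apply: eq_bigr => i _; by rewrite rmorphXn.
Qed.

Lemma subst_low0 D' (K : comNzRingType) (h : 'I_D -> {mpoly K[D']}) j p :
  (forall i, low0 1 (h i)) -> low0 j p -> low0 j (subst h p).
Proof.
move=> h1 hp; rewrite /mmap; apply: low_sum => m _.
case: (ltnP (mdeg m) j) => mj; first by rewrite (hp m mj) mul0r; apply: low_zero.
by apply/lowMl/(low_leq mj)/low0_prod.
Qed.

(** Two substitutions with the same linear part modulo [d] differ by an operator that raises the
    order modulo [d]; on truncated polynomials it is therefore nilpotent modulo [d]. *)
Lemma subst_congr_low (d : int) (h g : 'I_D -> {mpoly int[D]}) j p :
  (forall i, low0 1 (h i)) -> (forall i, low0 1 (g i)) ->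
  (forall i, low (dvd_ideal d) 2 (h i - g i)) ->
  low (dvd_ideal d) j p -> low (dvd_ideal d) j.+1 (subst h p - subst g p).
Proof.
move=> h1 g1 hg hp; rewrite /mmap -sumrB; apply: low_sum => m _.
rewrite -mulrBr; case: (ltnP (mdeg m) j) => mj.
  move=> k _; rewrite mulrzl (raddfMz (mcoeff k)) /= mulrzz.
  by apply: dvdz_mull; apply: hp.
by apply/lowMl/(low_leq _ (prod_congr_low h1 g1 hg)).
Qed.

(** Without constant terms in [h], monomials of degree above [c] contribute nothing up to degree
    [c]; so the substitution acts linearly on truncations. *)
Lemma subst_bmon (c : nat) D' (K : comNzRingType) (h : 'I_D -> {mpoly K[D']}) p k :
  (forall i, low0 1 (h i)) -> (mdeg k <= c)%N ->
  (subst h p)@_k = \sum_(m : 'X_{1..D < c.+1}) (p@_m)%:~R * (subst h 'X_[m])@_k.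
Proof.
move=> h1 kc; pose b := maxn c.+1 (msize p).
have cb : (c.+1 <= b)%N := leq_maxl _ _.
rewrite (@mmapE _ _ _ _ _ p b) ?leq_maxr //.
rewrite raddf_sum /=.
have E (m : 'X_{1..D}) : ((p@_m)%:~R * mmap1 h m)@_k = (p@_m)%:~R * (subst h 'X_[m])@_k.
  by rewrite mmapX !mulrzl (raddfMz (mcoeff k)).
rewrite (eq_bigr (fun m : 'X_{1..D < b} => (p@_m)%:~R * (subst h 'X_[m])@_k)
  (fun m _ => E m)).
rewrite (bigID (fun m : 'X_{1..D < b} => (mdeg m < c.+1)%N)) /= [X in _ + X]big1 ?addr0.
  rewrite (reindex_onto (fun m : 'X_{1..D < c.+1} => (BMultinom (leq_trans (bmdeg m) cb)))
     (fun m => insubd (bm0 : 'X_{1..D < c.+1}) (bmnm m))) /=.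
    by apply: eq_bigl => m; rewrite bmdeg /= valKd eqxx.
  by move=> m mc; apply: val_inj; rewrite /= val_insubd mc.
move=> m; rewrite -leqNgt => mc.
have := low0_prod h1 (m := m); rewrite mmapX => /(_ k) ->; first by rewrite mulr0.
exact: leq_ltn_trans kc mc.
Qed.

End Subst.

Section Iterate.
Variables (D : nat) (h : 'I_D -> {mpoly int[D]}).
Hypothesis h1 : forall i, low0 1 (h i).

Definition subst_iter k (i : 'I_D) : {mpoly int[D]} := iter k (fun p => subst h p) 'X_i.

Lemma iter_subst k p : iter k (fun p => subst h p) p = subst (subst_iter k) p.
Proof.
elim: k => [|k IH] /=; last by rewrite IH subst_comp.
rewrite {1}[p]mpolyE /mmap; apply: eq_bigr => m _.
by rewrite mmap1_id -mul_mpolyC -[X in X%:MP]intz rmorph_int.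
Qed.

Lemma subst_iter_low k i : low0 1 (subst_iter k i).
Proof.
elim: k => [|k IH] /=; last exact: subst_low0.
move=> m; rewrite ltnS leqn0 mdeg_eq0 => /eqP->; rewrite mcoeffX.
by case: eqP => // /(congr1 (fun m => mdeg m)); rewrite mdeg0 mdeg1.
Qed.

Definition lin_mx (g : 'I_D -> {mpoly int[D]}) : 'M[int]_D := \matrix_(i, j) (g i)@_U_(j).

(** The chain rule at the origin, which [h] fixes. *)
Lemma lin_mx_iter k : lin_mx (subst_iter k.+1) = lin_mx (subst_iter k) *m lin_mx h.
Proof.
apply/matrixP => i j; rewrite !mxE /=.
set p := subst_iter k i.
pose l := \sum_u p@_U_(u) *: 'X_u : {mpoly int[D]}.
have lowpl : low0 2 (p - l).
  move=> m; rewrite ltnS leq_eqVlt ltnS leqn0 => /orP[/mdeg1P[u /eqP->]|].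
    rewrite mcoeffB /l raddf_sum /= (bigD1 u) //= mcoeffZ mcoeffXU eqxx mulr1.
    rewrite big1 ?addr0 ?subrr // => v /negbTE uv.
    by rewrite mcoeffZ mcoeffXU uv mulr0.
  rewrite mdeg_eq0 => /eqP->; rewrite mcoeffB (subst_iter_low k i) ?mdeg0 // sub0r.
  rewrite /l raddf_sum /= big1 ?oppr0 // => v _.
  rewrite mcoeffZ mcoeffX; case: eqP => [/(congr1 (fun m => mdeg m))|]; last by rewrite mulr0.
  by rewrite mdeg0 mdeg1.
have -> : subst h p = subst h (p - l) + subst h l by rewrite -rmorphD subrK.
rewrite mcoeffD (subst_low0 h1 lowpl) ?mdeg1 // add0r /l rmorph_sum raddf_sum /=.
apply: eq_bigr => u _; rewrite !mxE mmapZ mmapX mmap1U.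
by rewrite mulrzl (raddfMz (mcoeff _)) /= mulrzz mulrC.
Qed.

End Iterate.

(* Raising to this power makes every matrix idempotent modulo 2 and 3. *)
Definition idem_exp (D : nat) := (#|{: 'M['F_2]_D}|`! * #|{: 'M['F_3]_D}|`!)%N.

(** The orbit enters a cycle after at most [#|T|] steps and the period is at most [#|T|]; so [M] is
    past the entrance and a multiple of the period. *)
Lemma iter_idem (T : finType) (F : T -> T) (x : T) M : (#|T|`! %| M)%N -> (0 < M)%N ->
  iter (M + M) F x = iter M F x.
Proof.
move=> dM M0.
have [i [j [ij jT Eij]]] : exists i j, [/\ (i < j)%N, (j <= #|T|)%N & iter i F x = iter j F x].
  have nu : ~~ uniq (traject F x #|T|.+1).
    apply/negP => /card_uniqP; rewrite size_traject => E.
    by have := max_card (mem (traject F x #|T|.+1)); rewrite E ltnn.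
  have /(uniqPn x)[i [j [ij jl]]] := nu; rewrite size_traject in jl.
  rewrite !nth_traject ?(ltn_trans ij) // => E.
  by exists i, j; split.
have step t k : (i <= k)%N -> iter (t * (j - i) + k) F x = iter k F x.
  move=> ik; elim: t => [|t IH] //.
  rewrite -{}IH; set u := (t * _)%N.
  have -> : (t.+1 * (j - i) + k = (u + k - i) + j)%N by rewrite /u; nia.
  by rewrite iterD -Eij -iterD; congr (iter _ _ _); lia.
have /dvdnP[t Mt] : (j - i %| M)%N.
  by apply: dvdn_trans dM; apply: dvdn_fact; lia.
have iM : (i <= M)%N.
  apply: leq_trans (_ : #|T| <= _)%N; first by lia.
  by apply: leq_trans (fact_geq _) _; apply: dvdn_leq.
by rewrite {1}Mt step.
Qed.

Lemma idem_exp_gt0 D : (0 < idem_exp D)%N.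
Proof. by rewrite muln_gt0 !fact_gt0. Qed.

Lemma lin_mx_idem D (h : 'I_D -> {mpoly int[D]}) (p : nat) : (forall i, low0 1 (h i)) ->
  prime p -> (#|{: 'M['F_p]_D}|`! %| idem_exp D)%N ->
  forall i j, (p%:Z %| lin_mx (subst_iter h (idem_exp D + idem_exp D)) i j
     - lin_mx (subst_iter h (idem_exp D)) i j)%Z.
Proof.
move=> h1 prp dM i j; set M := idem_exp D.
pose L : 'M['F_p]_D := map_mx intr (lin_mx h).
have E k : map_mx intr (lin_mx (subst_iter h k)) = iter k (fun X => X *m L) 1%:M.
  elim: k => [|k IH].
    apply/matrixP => a b; rewrite !mxE /= mcoeffXU.
    by case: (a == b); rewrite ?rmorph1 ?rmorph0.
  by rewrite lin_mx_iter // map_mxM IH.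
have := iter_idem (fun X => X *m L) 1%:M dM (idem_exp_gt0 D).
rewrite -!E => /matrixP/(_ i j); rewrite !mxE => EE.
by rewrite (dvdz_pcharf (pchar_Fp prp)) rmorphB /= EE subrr.
Qed.

(** * Heights of integer polynomials *)

Section Height.
Variable D : nat.
Implicit Types (p q : {mpoly int[D]}) (a b : nat).

(* The witness P dominates p coefficientwise, so that P(1,...,1) bounds the l1-norm of p. *)
Definition hgt b p := exists P : {mpoly int[D]},
  (forall m, `|p@_m| <= P@_m) /\ P.@[fun=> 1] <= b%:Z.

Lemma hgt_mono a b p : (a <= b)%N -> hgt a p -> hgt b p.
Proof.
by move=> ab [P [h1 h2]]; exists P; split=> //; apply: le_trans h2 _; rewrite lez_nat.
Qed.

Lemma hgt_coef b p m : hgt b p -> `|p@_m| <= b%:Z.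
Proof.
move=> [P [h1 h2]]; apply: le_trans (h1 m) (le_trans _ h2).
have P0 k : 0 <= P@_k by apply: le_trans (h1 k).
have E : P.@[fun=> 1] = \sum_(k <- msupp P) P@_k.
  rewrite mevalE; apply: eq_bigr => k _.
  by rewrite big1 ?mulr1 // => i _; rewrite expr1n.
rewrite E; have [mP|/memN_msupp_eq0 ->] := boolP (m \in msupp P); last exact: sumr_ge0.
by rewrite (bigD1_seq m) ?msupp_uniq //= lerDl sumr_ge0.
Qed.

Lemma hgt0 b : hgt b 0.
Proof. by exists 0; split=> [m|]; rewrite ?mcoeff0 ?normr0 // meval0. Qed.

Lemma hgtN b p : hgt b p -> hgt b (- p).
Proof. by move=> [P [h1 h2]]; exists P; split=> // m; rewrite mcoeffN normrN. Qed.

Lemma hgtD a b p q : hgt a p -> hgt b q -> hgt (a + b) (p + q).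
Proof.
move=> [P [p1 p2]] [Q [q1 q2]]; exists (P + Q); split=> [m|].
  by rewrite !mcoeffD; apply: le_trans (ler_normD _ _) _; apply: lerD.
by rewrite mevalD PoszD lerD.
Qed.

Lemma hgtB a b p q : hgt a p -> hgt b q -> hgt (a + b) (p - q).
Proof. by move=> hp /hgtN; apply: hgtD. Qed.

Lemma hgtM a b p q : hgt a p -> hgt b q -> hgt (a * b) (p * q).
Proof.
move=> [P [p1 p2]] [Q [q1 q2]]; exists (P * Q).
have P0 : 0 <= P.@[fun=> 1].
  rewrite mevalE sumr_ge0 // => m _; rewrite mulr_ge0 ?prodr_ge0 //.
    by apply: le_trans (p1 m).
  by move=> i _; rewrite expr1n.
have Q0 : 0 <= Q.@[fun=> 1].
  rewrite mevalE sumr_ge0 // => m _; rewrite mulr_ge0 ?prodr_ge0 //.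
    by apply: le_trans (q1 m).
  by move=> i _; rewrite expr1n.
split=> [m|]; last by rewrite mevalM PoszM ler_pM.
rewrite !mcoeffM; apply: le_trans (ler_norm_sum _ _ _) _.
by apply: ler_sum => k _; rewrite normrM ler_pM.
Qed.

Lemma hgtC (c : int) : hgt `|c|%N c%:MP.
Proof.
exists (`|c|%N%:Z%:MP); rewrite mevalC; split=> // m.
by rewrite !mcoeffC normrM abszE; case: eqP; rewrite ?normr1 ?normr0 ?mulr0 ?mulr1.
Qed.

Lemma hgt1 : hgt 1 1.
Proof. by have := hgtC 1; rewrite mpolyC1. Qed.

Lemma hgtXU i : hgt 1 'X_i.
Proof.
exists 'X_i; rewrite mevalXU; split=> // m.
by rewrite mcoeffX; case: eqP.
Qed.

Lemma hgtX b p k : hgt b p -> hgt (b ^ k) (p ^+ k).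
Proof.
move=> hp; elim: k => [|k IH]; first by rewrite expr0; exact: hgt1.
by rewrite expnS exprS; apply: hgtM.
Qed.

Lemma hgt_sum (T : finType) (P : pred T) (F : T -> {mpoly int[D]}) b :
  (forall i, P i -> hgt b (F i)) -> hgt (#|P| * b) (\sum_(i | P i) F i).
Proof.
move=> h; rewrite -sum_nat_const; apply: (big_ind2 (fun a p => hgt a p)) => //.
  exact: hgt0.
by move=> a p c q; apply: hgtD.
Qed.

Lemma hgt_mmap1 E b (h : 'I_E -> {mpoly int[D]}) m :
  (forall i, hgt b (h i)) -> hgt (b ^ mdeg m) (mmap1 h m).
Proof.
move=> hb; rewrite /mmap1 mdegE expn_sum.
elim/big_rec2: _ => [|i p a _ IH]; first exact: hgt1.
by apply: hgtM => //; apply: hgtX.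
Qed.

End Height.

(** One less than the number of monomials, so that matrices of size [(nmon D c).+1] form a ring by
    their type. *)
Definition nmon (D c : nat) := #|{: 'X_{1..D < c.+1}}|.-1.

Lemma nmonE D c : #|{: 'X_{1..D < c.+1}}| = (nmon D c).+1.
Proof. by rewrite /nmon prednK //; apply/card_gt0P; exists bm0. Qed.

Definition bmon D c (i : 'I_((nmon D c).+1)) : 'X_{1..D} :=
  @enum_val 'X_{1..D < c.+1} predT (cast_ord (esym (nmonE D c)) i).

Lemma bmon_lt D c (i : 'I_((nmon D c).+1)) : (mdeg (bmon i) < c.+1)%N.
Proof. exact: bmdeg. Qed.

Lemma bmon_surj D c (m : 'X_{1..D}) : (mdeg m < c.+1)%N ->
  exists i : 'I_((nmon D c).+1), bmon i = m.
Proof.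
move=> mc; exists (cast_ord (nmonE D c) (enum_rank (BMultinom mc))).
by rewrite /bmon cast_ordK enum_rankK.
Qed.

(** A closed form for the cardinal, needed for the dimension count in [algebraic_dependence] and for
    the growth of the final bound. *)
Lemma nmon_le D c : ((nmon D c).+1 <= c.+1 ^ D)%N.
Proof.
rewrite -nmonE; pose f (m : 'X_{1..D < c.+1}) : {ffun 'I_D -> 'I_c.+1} :=
  [ffun i => inord ((bmnm m) i)].
have fi : injective f.
  move=> m m' /ffunP E; apply/val_inj/mnmP => i.
  have b (x : 'X_{1..D < c.+1}) : (bmnm x i < c.+1)%N.
    by apply: leq_ltn_trans (bmdeg x); rewrite mdegE (bigD1 i) //= leq_addr.
  by have := congr1 val (E i); rewrite !ffunE /= !inordK.
by have := leq_card f fi; rewrite card_ffun !card_ord.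
Qed.

(** * Substitutions as integer matrices *)

Section Truncation.
Variables (D c : nat) (h : 'I_D -> {mpoly int[D]}).
Hypothesis h1 : forall i, low0 1 (h i).

Definition coefs (p : {mpoly int[D]}) : 'rV[int]_((nmon D c).+1) := \row_i p@_(bmon i).

Definition subst_mx : 'M[int]_((nmon D c).+1) :=
  \matrix_(i, j) (subst h 'X_[bmon i])@_(bmon j).

Lemma coefs_eq0 p : coefs p = 0 <-> low0 c.+1 p.
Proof.
split=> [E m /bmon_surj[i <-]|hp].
  by have /rowP/(_ i) := E; rewrite !mxE.
by apply/rowP => i; rewrite !mxE; apply: hp; apply: bmon_lt.
Qed.

Lemma coefsB p q : coefs (p - q) = coefs p - coefs q.
Proof. by apply/rowP => i; rewrite !mxE mcoeffB. Qed.

Lemma coefs_subst p : coefs (subst h p) = coefs p *m subst_mx.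
Proof.
apply/rowP => j; rewrite !mxE (@subst_bmon _ c) //; last by rewrite -ltnS bmon_lt.
rewrite (reindex (fun i : 'I_((nmon D c).+1) => @enum_val 'X_{1..D < c.+1} predT
   (cast_ord (esym (nmonE D c)) i))) /=.
  by apply: eq_bigr => i _; rewrite !mxE intz.
apply: onW_bij; apply: (@Bijective _ _ _ (fun m => cast_ord (nmonE D c) (enum_rank m))).
  by move=> i; rewrite enum_valK cast_ordKV.
by move=> i; rewrite cast_ordK enum_rankK.
Qed.

Lemma coefs_iter k p : coefs (iter k (fun p => subst h p) p) = coefs p *m subst_mx ^+ k.
Proof.
elim: k => [|k IH] /=; first by rewrite expr0 mulmx1.
by rewrite coefs_subst IH exprSr mulmxA.
Qed.

Lemma subst_mx_bound H : (0 < H)%N -> (forall i, hgt H (h i)) ->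
  forall i j, `|subst_mx i j| <= (H ^ c)%N%:Z.
Proof.
move=> H0 hH i j; rewrite mxE mmapX; apply: hgt_coef.
apply: hgt_mono (hgt_mmap1 (bmon i) hH).
by rewrite leq_pexp2l // -ltnS bmon_lt.
Qed.

Lemma mx_exp_bound d (A : 'M[int]_d.+1) a k :
  (forall i j, `|A i j| <= a%:Z) -> forall i j, `|(A ^+ k) i j| <= ((d.+1 * a) ^ k)%N%:Z.
Proof.
move=> Aa; elim: k => [|k IH] i j.
  by rewrite expr0 mxE; case: (i == j).
rewrite exprSr mxE; apply: le_trans (ler_norm_sum _ _ _) _.
apply: (@le_trans _ _ (\sum_(j < d.+1) ((d.+1 * a) ^ k * a)%N%:Z)).
  by apply: ler_sum => l _; rewrite normrM PoszM ler_pM.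
rewrite sumr_const card_ord -mulr_natl natz -PoszM lez_nat expnS; lia.
Qed.

Let M := idem_exp D.

(** For [A = subst_mx ^+ M] the matrix [A * (A - 1)] is the difference of the substitutions iterated
    2M and M times. Their linear parts agree modulo p, so it raises the order modulo p, and c + 1
    applications exceed degree [c]. *)
Lemma subst_mx_mod (p : nat) : prime p -> (#|{: 'M['F_p]_D}|`! %| M)%N ->
  exists N, (subst_mx ^+ M * (subst_mx ^+ M - 1)) ^+ c.+1 = N *+ p.
Proof.
move=> prp dM; set A := subst_mx ^+ M.
pose delta q : {mpoly int[D]} := subst (subst_iter h (M + M)) q - subst (subst_iter h M) q.
have dE q : coefs (delta q) = coefs q *m (A * (A - 1)).
  rewrite /delta -!iter_subst coefsB !coefs_iter -mulmxBr exprD -/A mulrBr mulr1.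
  by [].
have dEi k q : coefs (iter k delta q) = coefs q *m (A * (A - 1)) ^+ k.
  elim: k => [|k IH] /=; first by rewrite expr0 mulmx1.
  by rewrite dE IH exprSr -mulmxA.
have dlow k q : low (dvd_ideal p) k (iter k delta q).
  elim: k => [|k IH] //=; apply: subst_congr_low IH => i; try exact: subst_iter_low.
  move=> m; rewrite ltnS leq_eqVlt ltnS leqn0 => /orP[/mdeg1P[u /eqP->]|].
    have := lin_mx_idem h1 prp dM i u; rewrite !mxE -/M mcoeffB; exact.
  rewrite mdeg_eq0 => /eqP->; rewrite mcoeffB !subst_iter_low ?mdeg0 // subrr.
  exact: dvdz0.
exists (\matrix_(i, j) (((A * (A - 1)) ^+ c.+1) i j %/ p)%Z).
apply/matrixP => i j; rewrite mulmxnE mxE -mulr_natr natz divzK //.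
have := dEi c.+1 'X_[bmon i]; move=> /rowP/(_ j); rewrite mxE.
have -> : coefs 'X_[bmon i] = delta_mx 0 i.
  apply/rowP => k; rewrite !mxE mcoeffX eqxx /= /bmon.
  rewrite (inj_eq val_inj) (inj_eq enum_val_inj) (inj_eq (@cast_ord_inj _ _ _)).
  by rewrite eq_sym.
rewrite -rowE mxE => <-; apply: dlow; exact: bmon_lt.
Qed.

(** [matrix_orbit] takes a single height: the first summand bounds the entries of the M-th power of
    the matrix, the second those of the two vectors. *)
Definition poly_orbit_bound H :=
  orbit_bound (nmon D c) (((nmon D c).+1 * H ^ c) ^ M + H).

Theorem poly_orbit H q p0 p1 : (0 < H)%N -> (forall i, hgt H (h i)) ->
  (forall m, `|p0@_m| <= H%:Z) -> (forall m, `|p1@_m| <= H%:Z) ->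
  low0 c.+1 (iter (M * q) (fun p => subst h p) p0 - p1) ->
  (poly_orbit_bound H <= q)%N ->
  low0 c.+1 (iter M (fun p => subst h p) p1 - p1).
Proof.
move=> H0 hH hp0 hp1 /coefs_eq0; rewrite coefsB => /eqP; rewrite subr_eq0 => /eqP E qB.
apply/coefs_eq0/eqP; rewrite coefsB subr_eq0 coefs_iter; apply/eqP.
move: E; rewrite coefs_iter exprM => E.
have [N2 A2] := @subst_mx_mod 2 isT (dvdn_mulr _ (dvdnn _)).
have [N3 A3] := @subst_mx_mod 3 isT (dvdn_mull _ (dvdnn _)).
apply: (matrix_orbit _ _ _ A2 A3 E qB).
- move=> i j; apply: le_trans (mx_exp_bound _ (subst_mx_bound H0 hH) i j) _.
  by rewrite lez_nat leq_addr.
- by move=> i; rewrite mxE; apply: le_trans (hp0 _) _; rewrite lez_nat leq_addl.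
- by move=> i; rewrite mxE; apply: le_trans (hp1 _) _; rewrite lez_nat leq_addl.
Qed.

End Truncation.

(** * Stabilisation of polynomial orbits *)

(* Polynomials in k variables over rat, as nested lists of coefficients; the
   outermost list is in the powers of the first variable. *)
Fixpoint npoly k : Type := if k is k'.+1 then seq (npoly k') else rat.

Fixpoint npoly_nz k : npoly k -> bool :=
  if k is k'.+1 return npoly k -> bool then fun p => has (@npoly_nz k') p
  else fun c => c != 0.

Section Eval.
Variable R : comNzRingType.
Variable inR : {rmorphism rat -> R}.

Fixpoint npoly_eval k : npoly k -> (nat -> R) -> R :=
  if k is k'.+1 return npoly k -> (nat -> R) -> R then
    fun p x => foldr (fun a r => @npoly_eval k' a (fun i => x i.+1) + x 0%N * r) 0 p
  else fun c _ => inR c.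

Lemma npoly_eval0 k (p : npoly k) x : ~~ npoly_nz p -> npoly_eval p x = 0.
Proof.
elim: k p x => [c x|k IH p x] /=; first by rewrite negbK => /eqP->; rewrite rmorph0.
elim: p => [|a p IHp] //=; rewrite negb_or => /andP[na np].
by rewrite IH // IHp // mulr0 addr0.
Qed.

Lemma npoly_eval_ext k (p : npoly k) x y : (forall i, (i < k)%N -> x i = y i) ->
  npoly_eval p x = npoly_eval p y.
Proof.
elim: k p x y => [//|k IH] p x y xy /=; elim: p => //= a p ->.
by rewrite (IH _ _ (fun i => y i.+1)) ?xy // => i ik; rewrite xy.
Qed.

Fixpoint exps k N : seq (seq nat) :=
  if k is k'.+1 then [seq i :: s | i <- iota 0 N, s <- exps k' N] else [:: [::]].

Fixpoint mon_eval (s : seq nat) (x : nat -> R) : R :=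
  if s is e :: s' then x 0%N ^+ e * mon_eval s' (fun i => x i.+1) else 1.

(** Linear algebra yields a relation as a flat family of coefficients, while the elimination of one
    variable at a time uses nested lists. *)
Fixpoint nest k N (c : seq nat -> rat) : npoly k :=
  if k is k'.+1 return npoly k then mkseq (fun i => @nest k' N (fun s => c (i :: s))) N
  else c [::].

Lemma npoly_eval_mkseq k (p : nat -> npoly k) N x :
  npoly_eval (mkseq p N : npoly k.+1) x =
  \sum_(i <- iota 0 N) x 0%N ^+ i * npoly_eval (p i) (fun i => x i.+1).
Proof.
rewrite /mkseq; suff E a : foldr (fun a r => npoly_eval a (fun i => x i.+1) + x 0%N * r) 0
     (map p (iota a N)) * x 0%N ^+ a =
   \sum_(i <- iota a N) x 0%N ^+ i * npoly_eval (p i) (fun i => x i.+1).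
  by have := E 0%N; rewrite expr0 mulr1.
elim: N a => [|N IH] a /=; first by rewrite big_nil mul0r.
by rewrite big_cons -IH exprS; ring.
Qed.

Lemma eval_nest k N c x :
  npoly_eval (nest k N c) x = \sum_(s <- exps k N) inR (c s) * mon_eval s x.
Proof.
elim: k c x => [|k IH] c x; first by rewrite /= big_seq1 mulr1.
rewrite npoly_eval_mkseq big_allpairs_dep; apply: eq_bigr => i _.
rewrite IH mulr_sumr; apply: eq_bigr => s _ /=; ring.
Qed.

End Eval.

Lemma nest_nz k N c s : s \in exps k N -> c s != 0 -> npoly_nz (nest k N c).
Proof.
elim: k c s => [|k IH] c s; first by rewrite inE => /eqP->.
case/allpairsP => -[i t] /= [iN tk ->] ct; rewrite /= /mkseq has_map.
by apply/hasP; exists i => //=; apply: IH tk ct.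
Qed.

Lemma size_exps k N : size (exps k N) = (N ^ k)%N.
Proof. by elim: k => [|k IH] //=; rewrite size_allpairs size_iota IH expnS. Qed.

Lemma size_mem_exps k N s : s \in exps k N -> size s = k /\ all (fun e => e <= N)%N s.
Proof.
elim: k s => [|k IH] s /=; first by rewrite inE => /eqP->.
case/allpairsP => -[i t] /= [iN tk ->] /=; have [-> ->] := IH _ tk.
by rewrite andbT; split=> //; move: iN; rewrite mem_iota; lia.
Qed.

Section Degree.
Variables (D : nat) (K : comNzRingType).

Definition degle k (p : {mpoly K[D]}) := forall m, (k < mdeg m)%N -> p@_m = 0.

Lemma degle_mono j k p : (j <= k)%N -> degle j p -> degle k p.
Proof. by move=> jk h m km; apply: h; apply: leq_ltn_trans km. Qed.

Lemma degleD k p q : degle k p -> degle k q -> degle k (p + q).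
Proof. by move=> hp hq m km; rewrite mcoeffD hp ?hq ?addr0. Qed.

Lemma degleN k p : degle k p -> degle k (- p).
Proof. by move=> hp m km; rewrite mcoeffN hp ?oppr0. Qed.

Lemma degleM j k p q : degle j p -> degle k q -> degle (j + k) (p * q).
Proof.
move=> hp hq m jkm; rewrite mcoeffM big1 // => -[k1 k2] /= /eqP E.
have := congr1 (fun m => mdeg m) E; rewrite mdegD => E'.
case: (ltnP j (mdeg k1)) => [h|h]; first by rewrite hp ?mul0r.
by rewrite (hq k2) ?mulr0 //; lia.
Qed.

Lemma degle1 : degle 0 1.
Proof.
by move=> m m0; rewrite mcoeff1; case: eqP m0 => // ->; rewrite mdeg0.
Qed.

Lemma degle0 k : degle k 0.
Proof. by move=> m _; rewrite mcoeff0. Qed.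

Lemma degleXU i : degle 1 'X_i.
Proof.
by move=> m m0; rewrite mcoeffX; case: eqP m0 => // <-; rewrite mdeg1.
Qed.

Lemma degleX k p e : degle k p -> degle (k * e) (p ^+ e).
Proof.
move=> hp; elim: e => [|e IH]; first by rewrite muln0; apply: degle1.
by rewrite mulnS exprS; apply: degleM.
Qed.

Lemma degle_sum k (J : Type) (r : seq J) (P : pred J) (F : J -> {mpoly K[D]}) :
  (forall i, P i -> degle k (F i)) -> degle k (\sum_(i <- r | P i) F i).
Proof. by move=> h; apply: big_ind => //; [apply: degle0|apply: degleD]. Qed.

Lemma degle_msize p : degle (msize p) p.
Proof.
by move=> m h; apply/memN_msupp_eq0/msize_mdeg_ge; apply: ltnW.
Qed.

Lemma degle_low_eq0 c p : degle c p -> low0 c.+1 p -> p = 0.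
Proof.
move=> h1 h2; apply/mpolyP => m; rewrite mcoeff0.
by case: (ltnP c (mdeg m)) => mc; [apply: h1|apply: h2].
Qed.

Lemma degle_mon_eval d N (s : seq nat) (x : nat -> {mpoly K[D]}) :
  all (fun e => e <= N)%N s -> (forall i, degle d (x i)) ->
  degle (size s * (d * N)) (mon_eval s x).
Proof.
elim: s x => [|e s IH] x /=; first by move=> _ _; apply: degle1.
move=> /andP[eN sN] hx; rewrite mulSn; apply: degleM; last exact: IH.
by apply: (degle_mono (j := d * e)); [rewrite leq_mul2l eN orbT|apply: degleX].
Qed.

End Degree.

(** A dimension count: the products with exponents below [N] outnumber the monomials of degree at
    most [E] in [D] variables. *)
Lemma algebraic_dependence D (x : nat -> {mpoly rat[D]}) :
  exists p : npoly D.+1, npoly_nz p /\ npoly_eval (@mpolyC D rat) p x = 0.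
Proof.
have [d hd] : exists d, forall i, (i < D.+1)%N -> degle d (x i).
  exists (\max_(i < D.+1) msize (x i)) => i iD.
  apply: (degle_mono _ (degle_msize (p := x i))).
  exact: (@leq_bigmax _ (fun i : 'I_D.+1 => msize (x i)) (Ordinal iD)).
(* The value 0 makes the degree bound hold at every index; only the first D + 1 entries are
   evaluated. *)
pose y i := if (i < D.+1)%N then x i else 0.
have hy i : degle d (y i).
  by rewrite /y; case: ifP => h; [apply: hd|apply: degle0].
(* Chosen so that (E+1)^D <= N^D ((D+1) d + 1)^D = N^D (N - 1) < N^(D+1). *)
pose N := ((D.+1 * d).+1 ^ D).+1.
pose E := (D.+1 * (d * N))%N.
pose A : 'M[rat]_(size (exps D.+1 N), (nmon D E).+1) :=
  \matrix_(i, j) (mon_eval (nth [::] (exps D.+1 N) i) y)@_(bmon j).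
have rA : (\rank A < size (exps D.+1 N))%N.
  apply: leq_ltn_trans (rank_leq_col A) _; rewrite size_exps.
  apply: leq_ltn_trans (nmon_le D E) _.
  have -> : (N ^ D.+1 = N ^ D * N)%N by rewrite expnSr.
  apply: (@leq_ltn_trans (N ^ D * (D.+1 * d).+1 ^ D)%N).
    have mono a b e : (a <= b -> a ^ e <= b ^ e)%N.
      by move=> ab; case: e => // e; rewrite leq_exp2r.
    rewrite -expnMn; apply: mono; rewrite /E; move: (N) (isT : 0 < N)%N => M M0; nia.
  by rewrite ltn_pmul2l ?expn_gt0.
have : kermx A != 0 by rewrite kermx_eq0 /row_free neq_ltn rA.
case/rowV0Pn => v /sub_kermxP vA v0.
have [i vi] : exists i, v 0 i != 0 by apply/rV0Pn.
pose c (s : seq nat) := if insub (index s (exps D.+1 N)) is Some j then v 0 j else 0.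
have uexps k M : uniq (exps k M).
  elim: k => [|k IH] //=; apply: allpairs_uniq => //; first exact: iota_uniq.
  by move=> [a b] [a' b'] _ _ /= [-> ->].
have cE (j : 'I_(size (exps D.+1 N))) : c (nth [::] (exps D.+1 N) j) = v 0 j.
  by rewrite /c index_uniq // insubT //= => h; congr (v 0 _); apply: val_inj.
exists (nest D.+1 N c); split.
  apply: (@nest_nz _ _ _ (nth [::] (exps D.+1 N) i)); first exact: mem_nth.
  by rewrite cE.
have -> : npoly_eval (@mpolyC D rat) (nest D.+1 N c) x =
          npoly_eval (@mpolyC D rat) (nest D.+1 N c) y.
  by apply: npoly_eval_ext => j jD; rewrite /y jD.
apply: (@degle_low_eq0 _ _ E).
  rewrite eval_nest big_seq; apply: degle_sum => s /size_mem_exps[ss sN].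
  rewrite -[E]add0n; apply: degleM; last by rewrite /E -ss; apply: degle_mon_eval.
  by move=> m m0; rewrite mcoeffC; case: eqP m0 => [->|]; rewrite ?mdeg0 ?mulr0.
move=> m /bmon_surj[j <-]; rewrite eval_nest (big_nth [::]) big_mkord raddf_sum /=.
transitivity ((v *m A) 0 j); last by rewrite vA mxE.
rewrite mxE; apply: eq_bigr => k _.
by rewrite cE mcoeffCM mxE.
Qed.

Lemma base_inj b k (m m' : nat -> nat) :
  (forall i, (i < k)%N -> (m i < b)%N) -> (forall i, (i < k)%N -> (m' i < b)%N) ->
  (\sum_(i < k) m i * b ^ i = \sum_(i < k) m' i * b ^ i)%N ->
  forall i, (i < k)%N -> m i = m' i.
Proof.
elim: k m m' => [//|k IH] m m' mb mb'.
rewrite !big_ord_recl !expn0 !muln1.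
have shift (u : nat -> nat) : (\sum_(i < k) u (lift ord0 i) * b ^ (lift ord0 i) =
    (\sum_(i < k) u i.+1 * b ^ i) * b)%N.
  by rewrite big_distrl; apply: eq_bigr => i _; rewrite lift0 expnSr mulnA.
rewrite !shift => E.
have b0 : (0 < b)%N by apply: leq_ltn_trans (mb 0%N _).
have E0 : m 0%N = m' 0%N.
  by have := congr1 (modn^~ b) E; rewrite /= ![(m _ + _)%N]addnC ![(m' _ + _)%N]addnC !modnMDl !modn_small ?mb ?mb'.
move: E; rewrite E0 => /addnI/eqP; rewrite eqn_pmul2r // => /eqP E [|i] //.
by rewrite ltnS; apply: (IH (fun i => m i.+1) (fun i => m' i.+1)) => // j jk; [apply: mb|apply: mb'].
Qed.

(* Kronecker substitution 'X_i := t ^+ (b ^ i) reduces to one variable. *)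
Lemma mpoly_fun_eq0 k (p : {mpoly rat[k]}) : (forall v, p.@[v] = 0) -> p = 0.
Proof.
move=> p0; pose b := (msize p).+1.
pose e (m : 'X_{1..k}) := (\sum_(i < k) m i * b ^ i)%N.
pose q : {poly rat} := \sum_(m <- msupp p) p@_m *: 'X^(e m).
have qt t : q.[t] = 0.
  rewrite -[RHS](p0 (fun i => t ^+ (b ^ i))) mevalE /q horner_sum.
  apply: eq_bigr => m _; rewrite hornerZ hornerXn; congr (_ * _).
  rewrite /e; elim/big_rec2: _ => [|i x y _ <-]; first by rewrite expr0.
  by rewrite -exprM mulnC exprD.
have q0 : q = 0.
  apply/eqP; apply: contraT => qn0.
  have := @max_poly_roots _ q [seq (i%:R : rat) | i <- iota 0 (size q)] qn0.
  rewrite size_map size_iota ltnn; apply.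
    by apply/allP => x /mapP[i _ ->]; apply/rootP.
  by rewrite map_inj_uniq ?iota_uniq // => i j /eqP; rewrite eqr_nat => /eqP.
apply/mpolyP => m; rewrite mcoeff0.
have [mp|/memN_msupp_eq0 //] := boolP (m \in msupp p).
have := congr1 (fun q : {poly rat} => q`_(e m)) q0; rewrite coef0 /q coef_sum.
rewrite (bigD1_seq m) ?msupp_uniq //= coefZ coefXn eqxx mulr1 big1_seq ?addr0 //.
move=> m' /andP[mm' m'p]; rewrite coefZ coefXn; case: eqP => [E|]; last by rewrite mulr0.
case/eqP: mm'; apply/mnmP => i.
have bd (u : 'X_{1..k}) : u \in msupp p -> forall j, (u j < b)%N.
  move=> /msize_mdeg_lt h j; apply: leq_ltn_trans (_ : mdeg u < b)%N; last by rewrite /b ltnS ltnW.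
  by rewrite mdegE (bigD1 j) //= leq_addr.
pose g (u : 'X_{1..k}) j := if insub j is Some l then u l else 0%N.
have gE (u : 'X_{1..k}) (l : 'I_k) : g u l = u l by rewrite /g valK.
rewrite -!gE; apply: (@base_inj b k) => // [j jk|j jk|].
- by rewrite /g insubT bd.
- by rewrite /g insubT bd.
- by under eq_bigr do rewrite gE; under [RHS]eq_bigr do rewrite gE.
Qed.

Section Stabilisation.
Variables (D : nat) (X : Type) (good : X -> Prop) (pr : ('I_D -> rat) -> X) (s : X -> X).
Variables (f : nat -> X -> rat) (F : nat -> {mpoly rat[D]}).
Hypothesis good_pr : forall v, good (pr v).
Hypothesis good_s : forall x, good x -> good (s x).
Hypothesis pr_surj : forall x, good x -> exists v, forall j, f j x = f j (pr v).
Hypothesis Ff : forall j v, (F j).@[v] = f j (pr v).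
Hypothesis fS : forall j x, good x -> f j.+1 x = f j (s x).

(** [F j = 0] means that [f j] vanishes at all good points, a set that [s] preserves. The map [s] is
    lifted to the parameters only pointwise, through [pr_surj]. *)
Lemma stable_zero j : F j = 0 -> F j.+1 = 0.
Proof.
move=> Fj; apply: mpoly_fun_eq0 => v; rewrite Ff fS //.
have [w ->] := pr_surj (good_s (good_pr v)).
by rewrite -Ff Fj meval0.
Qed.

Lemma stable_zero_leq i j : (i <= j)%N -> F i = 0 -> F j = 0.
Proof.
by move=> /subnK <- Fi; elim: (j - i)%N => [//|k IH]; rewrite addSn; apply: stable_zero.
Qed.

Lemma meval_npoly k (p : npoly k) (x : nat -> {mpoly rat[D]}) v :
  (npoly_eval (@mpolyC D rat) p x).@[v] = npoly_eval idfun p (fun i => (x i).@[v]).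
Proof.
elim: k p x => [c x|k IH p x]; first by rewrite /= mevalC.
elim: p => [|a p IHp] /=; first by rewrite meval0.
by rewrite mevalD mevalM IH; congr (_ + _ * _).
Qed.

(* Applying s to a relation between F_(q-k), ..., F_(q-1) and using F_q = 0 kills
   the last variable. *)
Lemma iterates_independent q k (p : npoly k) : F q = 0 -> F q.-1 != 0 -> (k <= q)%N ->
  npoly_nz p -> npoly_eval (@mpolyC D rat) p (fun i => F (q.-1 - i)%N) != 0.
Proof.
move=> Fq Fq1; elim: k p => [c _|k IH p kq].
  by rewrite /= mpolyC_eq0.
have q0 : (0 < q)%N by apply: leq_ltn_trans kq.
elim: p => [//|a p IHp] /=.
have [na _|na /= np] := boolP (npoly_nz a); last first.
  (* If the part free of the first variable is zero, [F q.-1], which is not zero, can be divided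
     out. *)
  by rewrite npoly_eval0 // add0r mulf_neq0 ?IHp // subn0.
rewrite subn0; set r := foldr _ _ _; apply/negP => /eqP E0.
have := IH a (ltnW kq) na; apply/negP; rewrite negbK; apply/eqP.
apply: mpoly_fun_eq0 => v; rewrite meval_npoly.
have [w hw] := pr_surj (good_s (good_pr v)).
have sw j : (F j).@[w] = (F j.+1).@[v] by rewrite !Ff fS // hw.
(* At [w] every index goes up by one: the first variable becomes [F q = 0], and what is left is [a]
   at the original polynomials with one variable fewer. *)
have := congr1 (fun P : {mpoly rat[D]} => P.@[w]) E0.
rewrite meval0 mevalD mevalM meval_npoly sw prednK // Fq meval0 mul0r addr0 => E.
rewrite -[RHS]E; apply: npoly_eval_ext => j jk; rewrite sw.
by congr (F _).@[v]; lia.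
Qed.

(** If the least zero [q0] exceeded [D], the D + 1 polynomials before it would be independent in [D]
    variables. *)
Theorem stabilisation q : F q = 0 -> F D = 0.
Proof.
move=> Fq; have ex : exists q, F q == 0 by exists q; rewrite Fq.
have [q0 /eqP Fq0 qmin] := ex_minnP ex.
have [qD|Dq] := leqP q0 D; first exact: stable_zero_leq qD Fq0.
have [p [pnz pe]] := algebraic_dependence (fun i => F (q0.-1 - i)%N).
have Fq1 : F q0.-1 != 0.
  by apply/negP => /qmin; rewrite leqNgt; case: (q0) Dq => // k _; rewrite ltnSn.
by have := iterates_independent Fq0 Fq1 Dq pnz; rewrite pe eqxx.
Qed.

End Stabilisation.

(** * Words and matrix representations *)

Section WordSubst.
Variables (T T' : Type).

Definition wlet (f : T -> word T') (a : T * bool) : word T' :=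
  if a.2 then winv (f a.1) else f a.1.

Definition wsub (f : T -> word T') (w : word T) : word T' :=
  flatten [seq wlet f a | a <- w].

Lemma wsub_cat f u v : wsub f (u ++ v) = wsub f u ++ wsub f v.
Proof. by rewrite /wsub map_cat flatten_cat. Qed.

Lemma wsub_cons f a w : wsub f (a :: w) = wlet f a ++ wsub f w.
Proof. by []. Qed.

Lemma size_winv (w : word T) : size (winv w) = size w.
Proof. by rewrite size_rev size_map. Qed.

Lemma winv_cons (a : T * bool) v : winv (a :: v) = rcons (winv v) (linv a).
Proof. by rewrite /winv map_cons rev_cons. Qed.

End WordSubst.

Lemma wsub_id (T : Type) (w : word T) : wsub (fun i => [:: (i, false)]) w = w.
Proof. by elim: w => //= -[i []] w IH; rewrite wsub_cons IH. Qed.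

Section MatrixCongruence.
Variables (R : comNzRingType) (I : ideal R).

Definition rcong (a b : R) : Prop := I (a - b).

Definition mcong (A B : 'M[R]_2) : Prop := forall i j, rcong (A i j) (B i j).

Lemma rcong_refl a : rcong a a.
Proof. by rewrite /rcong subrr; apply: ideal0. Qed.

Lemma rcong_sym a b : rcong a b -> rcong b a.
Proof. by rewrite /rcong => h; rewrite -opprB; apply: ideal_opp. Qed.

Lemma rcong_trans b a c : rcong a b -> rcong b c -> rcong a c.
Proof. by rewrite /rcong => h1 h2; rewrite -(subrK b a) -addrA; apply: idealD. Qed.

Lemma rcongM a b c d : rcong a b -> rcong c d -> rcong (a * c) (b * d).
Proof.
rewrite /rcong => h1 h2.
have -> : a * c - b * d = c * (a - b) + b * (c - d) by ring.
by apply: idealD; apply: idealMl.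
Qed.

Lemma rcong_sum (J : Type) (r : seq J) (P : pred J) (F G : J -> R) :
  (forall i, P i -> rcong (F i) (G i)) ->
  rcong (\sum_(i <- r | P i) F i) (\sum_(i <- r | P i) G i).
Proof.
move=> h; rewrite /rcong -sumrB; apply: big_ind => //; first exact: ideal0.
exact: idealD.
Qed.

Lemma mcong_refl A : mcong A A.
Proof. by move=> i j; apply: rcong_refl. Qed.

Lemma mcong_eq A B : A = B -> mcong A B.
Proof. by move->; apply: mcong_refl. Qed.

Lemma mcong_sym A B : mcong A B -> mcong B A.
Proof. by move=> h i j; apply/rcong_sym/h. Qed.

Lemma mcong_trans B A C : mcong A B -> mcong B C -> mcong A C.
Proof. by move=> h1 h2 i j; apply: rcong_trans (h1 i j) (h2 i j). Qed.

Lemma mcongM A B C D : mcong A B -> mcong C D -> mcong (A * C) (B * D).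
Proof.
by move=> h1 h2 i j; rewrite !mxE; apply: rcong_sum => k _; apply: rcongM.
Qed.

Lemma mcong_trace A B : mcong A B -> rcong (\tr A) (\tr B).
Proof. by move=> h; apply: rcong_sum. Qed.

Lemma mcong_inv_uniq A B C : mcong (B * A) 1 -> mcong (A * C) 1 -> mcong B C.
Proof.
move=> BA AC; apply: (@mcong_trans (B * (A * C))).
  by rewrite -{1}[B]mulr1; apply: mcongM; [apply: mcong_refl|apply: mcong_sym].
by rewrite mulrA -{2}[C]mul1r; apply: mcongM; last apply: mcong_refl.
Qed.

End MatrixCongruence.

Lemma mcong_zero (R : comNzRingType) (A B : 'M[R]_2) :
  mcong (zero_ideal R) A B <-> A = B.
Proof.
split=> [h|->]; last exact: mcong_refl.
by apply/matrixP => i j; apply/eqP; rewrite -subr_eq0; apply/eqP/h.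
Qed.

Section Rep.
Variables (R : comNzRingType) (I : ideal R) (T : choiceType).
Variables (L : T * bool -> 'M[R]_2).

(** The letters of [L] are inverted only modulo [I]: the generic matrices have truncated inverses,
    while with the zero ideal these are genuine representations. *)
Definition rep (w : word T) : 'M[R]_2 := \prod_(a <- w) L a.

Lemma rep_cat u v : rep (u ++ v) = rep u * rep v.
Proof. by rewrite /rep big_cat. Qed.

Lemma rep_cons a v : rep (a :: v) = L a * rep v.
Proof. by rewrite /rep big_cons. Qed.

Lemma rep1 a : rep [:: a] = L a.
Proof. by rewrite /rep big_seq1. Qed.

Hypothesis LI : forall a, mcong I (L a * L (linv a)) 1.

Lemma rep_push a w : mcong I (rep (push a w)) (L a * rep w).
Proof.
case: w => [|b w] /=; first by rewrite rep1 /rep big_nil mulr1; apply: mcong_refl.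
case: eqP => [->|_]; last by rewrite rep_cons; apply: mcong_refl.
rewrite rep_cons mulrA -{1}[rep w]mul1r; apply: mcongM; last exact: mcong_refl.
exact/mcong_sym/LI.
Qed.

Lemma rep_reduce w : mcong I (rep (reduce w)) (rep w).
Proof.
elim: w => [|a w IH]; first exact: mcong_refl.
rewrite rep_cons; apply: mcong_trans (rep_push a (reduce w)) _.
by apply: mcongM => //; apply: mcong_refl.
Qed.

Lemma rep_winv w : mcong I (rep w * rep (winv w)) 1.
Proof.
elim: w => [|a w IH].
  by rewrite /rep !big_nil mulr1; apply: mcong_refl.
rewrite winv_cons -cats1 rep_cat rep_cons rep1 mulrA -[L a * _ * _]mulrA.
apply: mcong_trans (LI a); apply: mcongM; last exact: mcong_refl.
rewrite -{2}[L a]mulr1; apply: mcongM => //; exact: mcong_refl.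
Qed.

Lemma rep_winvl w : mcong I (rep (winv w) * rep w) 1.
Proof. by have := rep_winv (winv w); rewrite winvK. Qed.

Lemma rep_eq u v : reduce u = reduce v -> mcong I (rep u) (rep v).
Proof.
move=> E; apply: mcong_trans (rep_reduce v); rewrite -E.
exact/mcong_sym/rep_reduce.
Qed.

Lemma rep_conj_trace u v g : reduce (u ++ g) = reduce (g ++ v) ->
  rcong I (\tr (rep u)) (\tr (rep v)).
Proof.
move=> /rep_eq; rewrite !rep_cat => E.
apply: (@rcong_trans _ _ (\tr (rep u * (rep g * rep (winv g))))).
  apply: mcong_trace; rewrite -{1}[rep u]mulr1; apply: mcongM; first exact: mcong_refl.
  exact/mcong_sym/rep_winv.
apply: (@rcong_trans _ _ (\tr (rep g * rep v * rep (winv g)))).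
  by rewrite mulrA; apply: mcong_trace; apply: mcongM => //; apply: mcong_refl.
rewrite -[_ * rep (winv g)]/(_ *m _) mxtrace_mulC -[_ *m _]/(_ * _) mulrA.
apply: mcong_trace; rewrite -{2}[rep v]mul1r; apply: mcongM; last exact: mcong_refl.
exact: rep_winvl.
Qed.

End Rep.

Section RepMorph.
Variables (R R' : comNzRingType) (I : ideal R) (I' : ideal R').
Variables (T T' : choiceType) (L : T * bool -> 'M[R]_2) (L' : T' * bool -> 'M[R']_2).
Hypothesis LI : forall a, mcong I (L a * L (linv a)) 1.
Hypothesis LI' : forall a, mcong I' (L' a * L' (linv a)) 1.
Variables (th : {rmorphism R -> R'}) (f : T -> word T').
Hypothesis thI : forall a, I a -> I' (th a).
Hypothesis thL : forall i, mcong I' (map_mx th (L (i, false))) (rep L' (f i)).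

Lemma mcong_map A B : mcong I A B -> mcong I' (map_mx th A) (map_mx th B).
Proof. by move=> h i j; rewrite !mxE /rcong -rmorphB; apply/thI/h. Qed.

Lemma thL_inv i : mcong I' (map_mx th (L (i, true))) (rep L' (winv (f i))).
Proof.
apply: (@mcong_inv_uniq _ _ (map_mx th (L (i, false)))).
  rewrite -rmorphM -(rmorph1 (map_mx th)); apply/mcong_map; exact: (LI (i, true)).
apply: mcong_trans (rep_winv LI' (f i)).
by apply: mcongM; [apply: thL|apply: mcong_refl].
Qed.

(** Used with three kinds of [th]: the substitution induced by an endomorphism, the passage from
    generic matrices to SL_2, and evaluation at a point; in the last two [f] is the identity on
    words. *)
Lemma rep_morph w : mcong I' (map_mx th (rep L w)) (rep L' (wsub f w)).
Proof.
elim: w => [|[i b] w IH].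
  by rewrite /rep !big_nil rmorph1; apply: mcong_refl.
rewrite wsub_cons rep_cat rep_cons rmorphM; apply: mcongM => //.
by case: b; [apply: thL_inv|apply: thL].
Qed.

Lemma trace_rep_morph w : rcong I' (th (\tr (rep L w))) (\tr (rep L' (wsub f w))).
Proof.
by rewrite -trace_map_mx; apply/mcong_trace/rep_morph.
Qed.

End RepMorph.

Definition trunc_ideal D (K : comNzRingType) (c : nat) : ideal {mpoly K[D]}.
Proof.
exists (fun p => low0 c p); [exact: low_zero|exact: lowD|exact: lowMl].
Defined.

Section Projections.
Variables n m : nat.
Let gen := ('I_n + 'I_m)%type.
Implicit Types (w : FxZ_word n m) (f : gen -> FxZ_word n m).

Definition projF w : word 'I_n :=
  pmap (fun a => if a.1 is inl i then Some (i, a.2) else None) w.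

Definition expo (v : gen) w : int :=
  \sum_(a <- w) (if a.1 == v then (if a.2 then -1 else 1) else 0).

Lemma projF_cat u w : projF (u ++ w) = projF u ++ projF w.
Proof. exact: pmap_cat. Qed.

Lemma projF_winv w : projF (winv w) = winv (projF w).
Proof.
elim: w => [//|[[i|j] b] w IH]; rewrite winv_cons -cats1 projF_cat IH /=.
  by rewrite winv_cons cats1.
by rewrite cats0.
Qed.

Lemma size_projF w : (size (projF w) <= size w)%N.
Proof. by rewrite size_pmap; apply: count_size. Qed.

Lemma expo_cat v u w : expo v (u ++ w) = expo v u + expo v w.
Proof. by rewrite /expo big_cat. Qed.

Lemma expo_nil v : expo v [::] = 0.
Proof. by rewrite /expo big_nil. Qed.

Lemma expo_cons v a w :
  expo v (a :: w) = (if a.1 == v then (if a.2 then -1 else 1) else 0) + expo v w.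
Proof. by rewrite /expo big_cons. Qed.

Lemma expo_winv v w : expo v (winv w) = - expo v w.
Proof.
elim: w => [|a w IH]; first by rewrite expo_nil oppr0.
rewrite winv_cons -cats1 expo_cat IH !expo_cons expo_nil addr0 opprD addrC.
by congr (_ + _); rewrite /linv /=; case: ifP; case: a.2; rewrite ?oppr0 ?opprK.
Qed.

Lemma norm_expo v w : `|expo v w| <= (size w)%:Z.
Proof.
elim: w => [|a w IH]; first by rewrite /expo big_nil.
rewrite expo_cons; apply: le_trans (ler_normD _ _) _.
rewrite /= -add1n PoszD lerD //; case: ifP => _; rewrite ?normr0 //; by case: a.2.
Qed.

Lemma expo_wsub f u w : expo u (wsub f w) = \sum_v expo v w * expo u (f v).
Proof.
elim: w => [|a w IH].
  rewrite /wsub /= {1}/expo big_nil big1 // => v _; by rewrite /expo big_nil mul0r.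
rewrite wsub_cons expo_cat IH.
under [RHS]eq_bigr do rewrite expo_cons mulrDl.
rewrite big_split /=; congr (_ + _).
rewrite (bigD1 a.1) //= eqxx big1 ?addr0.
  by rewrite /wlet; case: a.2; rewrite ?expo_winv ?mulN1r ?mul1r.
by move=> v /negbTE; rewrite eq_sym => ->; rewrite mul0r.
Qed.

(* The t_j are mapped into the centre. *)
Definition central f := forall j, reduce (projF (f (inr j))) = [::].

Definition subF f (i : 'I_n) : word 'I_n := projF (f (inl i)).

Lemma reduce_winv_nil (T : choiceType) (w : word T) : reduce w = [::] -> reduce (winv w) = [::].
Proof.
move=> E; have := reduce_winv (winv w); rewrite winvK -reduce_catl E cat0s.
by [].
Qed.

(** Letters t_j disappear from the free part of the image, so the free part evolves by [subF f]
    alone. *)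
Lemma projF_wsub f w : central f ->
  reduce (projF (wsub f w)) = reduce (wsub (subF f) (projF w)).
Proof.
move=> cf; elim: w => [//|[[i|j] b] w IH]; rewrite wsub_cons projF_cat.
  rewrite /= wsub_cons -reduce_catr IH reduce_catr; congr (reduce (_ ++ _)).
  by rewrite /wlet /=; case: b; rewrite ?projF_winv.
rewrite -reduce_catl /wlet /= (_ : reduce (projF _) = [::]) //.
by case: b; rewrite ?projF_winv ?reduce_winv_nil.
Qed.

End Projections.

Section Coordinates.
Variables n m : nat.
Let gen := ('I_n + 'I_m)%type.

(* Coordinates: four for the image of each x_i in a group of 2x2 matrices, and one
   linear coordinate for each generator. *)
Definition coord := ('I_n * ('I_2 * 'I_2) + gen)%type.
Definition ncoord := #|{: coord}|.
Definition cvar (v : coord) : 'I_ncoord := enum_rank v.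

Section Lin.
Variable K : comNzRingType.
(** Its variables are distinct from the matrix entries, so that the sum with a trace keeps both the
    trace and the exponents. *)
Definition lin (w : FxZ_word n m) : {mpoly K[ncoord]} :=
  \sum_(v : gen) (expo v w)%:~R * 'X_(cvar (inr v)).
End Lin.

Section Generic.
Variable c : nat.
Local Notation R := {mpoly int[ncoord]}.

Definition Xmx (i : 'I_n) : 'M[R]_2 := \matrix_(a, b) 'X_(cvar (inl (i, (a, b)))).

(* The series of (1 + X)^-1 is cut at degree c, so that inverses hold modulo [Ic]. *)
Definition Lgen (a : 'I_n * bool) : 'M[R]_2 :=
  if a.2 then \sum_(j < c.+1) (- Xmx a.1) ^+ j else 1 + Xmx a.1.

Definition Ic := trunc_ideal ncoord int c.+1.

Lemma Xmx_exp_low i k a b : low0 k ((Xmx i ^+ k) a b).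
Proof.
elim: k a b => [|k IH] a b; first exact: low_0.
rewrite exprSr mxE; apply: low_sum => l _; rewrite -addn1; apply: lowM; first exact: IH.
rewrite mxE => u; rewrite ltnS leqn0 mdeg_eq0 => /eqP->.
by rewrite mcoeffX; case: eqP => // /(congr1 (fun m => mdeg m)); rewrite mdeg0 mdeg1.
Qed.

Lemma Lgen_inv a : mcong Ic (Lgen a * Lgen (linv a)) 1.
Proof.
have geo i : (1 + Xmx i) * \sum_(j < c.+1) (- Xmx i) ^+ j = 1 - (- Xmx i) ^+ c.+1.
  rewrite -opprB subrX1 -mulNr opprB; congr (_ * _).
  by rewrite opprK.
have low1 i : mcong Ic (1 - (- Xmx i) ^+ c.+1) 1.
  move=> k l; rewrite /rcong !mxE addrAC subrr add0r exprNn.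
  rewrite mxE; apply: lowN; apply: low_sum => j _; apply: lowMl; exact: Xmx_exp_low.
case: a => i [] /=; rewrite /Lgen /=; last by rewrite geo.
have -> : (\sum_(j < c.+1) (- Xmx i) ^+ j) * (1 + Xmx i) =
          (1 + Xmx i) * \sum_(j < c.+1) (- Xmx i) ^+ j.
  apply: esym; apply: commr_sum => j _; apply: commrX; apply: commrN.
  by apply/commr_sym; apply: commrD; first exact: commr1.
by rewrite geo.
Qed.

Variable (tr : bool).

(* With tr = false only the linear coordinates are used. *)
Definition tracef (w : FxZ_word n m) : R :=
  (if tr then \tr (rep Lgen (projF w)) else 0) + lin int w.

Variable f : gen -> FxZ_word n m.

(* The substitution on the coordinates that f induces. *)
Definition hsub (k : 'I_ncoord) : R :=
  match enum_val k : coord with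
  | inl (i, (a, b)) => if tr then (rep Lgen (subF f i) - 1) a b else 0
  | inr v => lin int (f v)
  end.

Lemma lin_low w : low0 1 (lin int w).
Proof.
apply: low_sum => v _; apply: lowMl => u; rewrite ltnS leqn0 mdeg_eq0 => /eqP->.
by rewrite mcoeffX; case: eqP => // /(congr1 (fun m => mdeg m)); rewrite mdeg0 mdeg1.
Qed.

Lemma Lgen_low a i j : low0 1 ((Lgen a - 1) i j).
Proof.
rewrite /Lgen; case: a.2; last first.
  rewrite addrAC subrr add0r -[Xmx _]expr1; exact: Xmx_exp_low.
rewrite big_ord_recl expr0 addrAC subrr add0r summxE; apply: low_sum => k _.
rewrite exprNn mxE; apply: low_sum => l _; apply: lowMl.
by apply: (low_leq _ (@Xmx_exp_low _ _ _ _)); rewrite lift0.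
Qed.

Lemma rep_Lgen_low w i j : low0 1 ((rep Lgen w - 1) i j).
Proof.
elim: w i j => [|a w IH] i j.
  by rewrite /rep big_nil subrr mxE; apply: low_zero.
rewrite rep_cons.
have -> : Lgen a * rep Lgen w - 1 = (Lgen a - 1) * rep Lgen w + (rep Lgen w - 1).
  by rewrite mulrBl mul1r addrA subrK.
rewrite mxE; apply: lowD; last exact: IH.
by rewrite mxE; apply: low_sum => l _; apply: lowMr; apply: Lgen_low.
Qed.

Lemma hsub_low k : low0 1 (hsub k).
Proof.
rewrite /hsub; case: (enum_val k : coord) => [[i [a b]]|v]; last exact: lin_low.
by case: tr; [apply: rep_Lgen_low|apply: low_zero].
Qed.

Hypothesis cf : tr -> central f.

Lemma subst_lin w : subst hsub (lin int w) = lin int (wsub f w).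
Proof.
rewrite /lin rmorph_sum /=.
under eq_bigr do rewrite rmorphM rmorph_int /= substX /hsub enum_rankK /lin mulr_sumr.
rewrite exchange_big /=; apply: eq_bigr => u _.
rewrite expo_wsub rmorph_sum mulr_suml; apply: eq_bigr => v _.
by rewrite rmorphM /= mulrA.
Qed.

(** [hsub] sends [1 + Xmx i] to the matrix of the image of x_i; [trace_rep_morph] extends this to
    words, up to the order at which inverses exist. *)
Lemma subst_tracef w : low0 c.+1 (subst hsub (tracef w) - tracef (wsub f w)).
Proof.
rewrite /tracef rmorphD /= subst_lin opprD addrACA subrr addr0.
case E: tr; last by rewrite rmorph0 subrr; apply: low_zero.
apply: (@rcong_trans _ Ic (\tr (rep Lgen (wsub (subF f) (projF w))))).
  apply: (trace_rep_morph Lgen_inv Lgen_inv (th := mmap intr hsub)) => [p|i].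
    exact: subst_low0 hsub_low.
  rewrite (_ : map_mx _ _ = rep Lgen (subF f i)); first exact: mcong_refl.
  apply/matrixP => a b; rewrite [Lgen (i, false)]/Lgen /= !mxE rmorphD rmorph_nat /=.
  by rewrite substX /hsub enum_rankK E !mxE addrCA subrr addr0.
apply/mcong_trace/(rep_eq Lgen_inv); by rewrite (projF_wsub _ (cf E)).
Qed.

Lemma tracef_conj u w g : reduce (projF u ++ g) = reduce (g ++ projF w) ->
  (forall v, expo v u = expo v w) -> low0 c.+1 (tracef u - tracef w).
Proof.
move=> E1 E2; rewrite /tracef.
have -> : lin int u = lin int w by apply: eq_bigr => v _; rewrite E2.
rewrite opprD addrACA subrr addr0.
case: tr; last by rewrite subrr; apply: low_zero.
exact: rep_conj_trace Lgen_inv _ _ _ E1.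
Qed.

End Generic.
End Coordinates.

Section MatrixHeight.
Variable D : nat.
Implicit Types (A B : 'M[{mpoly int[D]}]_2).

Definition mhgt b A := forall i j, hgt b (A i j).

Lemma mhgt_mono a b A : (a <= b)%N -> mhgt a A -> mhgt b A.
Proof. by move=> ab h i j; apply: hgt_mono ab (h i j). Qed.

Lemma mhgt1 : mhgt 1 1.
Proof. by move=> i j; rewrite mxE; case: (i == j); [apply: hgt1|apply: hgt0]. Qed.

Lemma mhgtD a b A B : mhgt a A -> mhgt b B -> mhgt (a + b) (A + B).
Proof. by move=> hA hB i j; rewrite mxE; apply: hgtD. Qed.

Lemma mhgtN a A : mhgt a A -> mhgt a (- A).
Proof. by move=> hA i j; rewrite mxE; apply: hgtN. Qed.

Lemma mhgtM a b A B : mhgt a A -> mhgt b B -> mhgt (2 * (a * b)) (A * B).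
Proof.
move=> hA hB i j; rewrite mxE -[X in (X * _)%N](card_ord 2).
by apply: hgt_sum => k _; apply: hgtM.
Qed.

Lemma mhgtX A k : mhgt 1 A -> mhgt (2 ^ k) (A ^+ k).
Proof.
move=> hA; elim: k => [|k IH]; first exact: mhgt1.
by rewrite exprS expnS -[X in (2 * X)%N]mul1n; apply: mhgtM.
Qed.

End MatrixHeight.

Section Heights.
Variables n m c : nat.
Let gen := ('I_n + 'I_m)%type.

(** The first summand covers the c + 1 powers in a truncated inverse, each of height at most 2^c
    since a 2x2 product doubles; the second covers [1 + Xmx i]. *)
Definition letter_height := (c.+1 * 2 ^ c + 2)%N.

Lemma Lgen_height a : mhgt letter_height (@Lgen n m c a).
Proof.
have hX i : mhgt 1 (@Xmx n m i) by move=> k l; rewrite mxE; apply: hgtXU.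
rewrite /Lgen; case: a.2; last first.
  apply: (@mhgt_mono _ 2); first by rewrite leq_addl.
  by apply: (@mhgtD _ 1 1); [apply: mhgt1|apply: hX].
apply: (@mhgt_mono _ (c.+1 * 2 ^ c)); first by rewrite leq_addr.
move=> i j; rewrite summxE -[X in (X * _)%N](card_ord c.+1).
apply: hgt_sum => k _; apply: (hgt_mono _ (@mhgtX _ _ k (mhgtN (hX a.1)) i j)).
by rewrite leq_pexp2l // -ltnS.
Qed.

Lemma rep_height (w : word 'I_n) : mhgt ((2 * letter_height) ^ size w) (rep (@Lgen n m c) w).
Proof.
elim: w => [|a w IH]; first by rewrite /rep big_nil; apply: mhgt1.
rewrite rep_cons /= expnS -mulnA; apply: mhgtM => //; exact: Lgen_height.
Qed.

Definition trace_height s := (2 * (2 * letter_height) ^ s + (n + m) * s)%N.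

Lemma letter_height_gt0 : (0 < 2 * letter_height)%N.
Proof. by rewrite /letter_height muln_gt0 addn_gt0 orbT. Qed.

Lemma trace_height_gt0 s : (0 < trace_height s)%N.
Proof.
by rewrite addn_gt0 muln_gt0 /= expn_gt0 letter_height_gt0.
Qed.

Lemma lin_height (w : FxZ_word n m) : hgt ((n + m) * size w) (lin int w).
Proof.
have -> : (n + m = #|{: gen}|)%N by rewrite card_sum !card_ord.
apply: hgt_sum => v _; rewrite -[size w]muln1; apply: hgtM; last exact: hgtXU.
rewrite -(rmorph_int (@mpolyC _ int)) intz; apply: hgt_mono (hgtC _ _).
by have := norm_expo v w; lia.
Qed.

Lemma tracef_height tr (w : FxZ_word n m) s : (size w <= s)%N ->
  hgt (trace_height s) (tracef c tr w).
Proof.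
move=> ws; apply: hgtD; last first.
  by apply: hgt_mono (lin_height w); rewrite leq_mul.
case: tr; last exact: hgt0.
rewrite -[X in (X * _)%N](card_ord 2); apply: hgt_sum => i _.
apply: hgt_mono (rep_height _ _ _).
by rewrite leq_pexp2l ?letter_height_gt0 // (leq_trans (size_projF _)).
Qed.

Variables (tr : bool) (f : gen -> FxZ_word n m).
Hypothesis cf : tr -> central f.

Lemma hsub_height s k : (forall v, size (f v) <= s)%N -> hgt (trace_height s) (hsub c tr f k).
Proof.
move=> fs; rewrite /hsub; case: (enum_val k : coord n m) => [[i [a b]]|v].
  case: tr; last exact: hgt0.
  rewrite mxE [X in _ + X]mxE.
  apply: (@hgt_mono _ ((2 * letter_height) ^ s + 1)).
    apply: leq_trans (leq_addr _ _).
    have : (0 < (2 * letter_height) ^ s)%N by rewrite expn_gt0 letter_height_gt0.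
    by move: (_ ^ s)%N => e; lia.
  apply: hgtB; last exact: mhgt1.
  apply: hgt_mono (rep_height _ _ _).
  by rewrite leq_pexp2l ?letter_height_gt0 // (leq_trans (size_projF _)).
by apply: hgt_mono (lin_height _); rewrite (leq_trans _ (leq_addl _ _)) // leq_mul.
Qed.

Lemma iter_tracef k w :
  low0 c.+1 (iter k (fun p => subst (hsub c tr f) p) (tracef c tr w) -
             tracef c tr (iter k (wsub f) w)).
Proof.
elim: k => [|k IH]; first by rewrite subrr; apply: low_zero.
rewrite !iterS; set p := iter k _ _ in IH *; set u := iter k _ w in IH *.
rewrite -(subrK (subst (hsub c tr f) (tracef c tr u)) (subst _ p)) -addrA.
apply: lowD; last exact: subst_tracef.
by rewrite -rmorphB; apply: subst_low0 => //; apply: hsub_low.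
Qed.

Definition trace_orbit_bound s := @poly_orbit_bound (ncoord n m) c (trace_height s).

(** [poly_orbit] for trace polynomials. The hypothesis involves a long word, but the conclusion only
    [y] and its M-th image, both of bounded length. *)
Theorem tracef_fixed s q x y g :
  (forall v, size (f v) <= s)%N -> (size x <= s)%N -> (size y <= s)%N ->
  (trace_orbit_bound s <= q)%N ->
  reduce (projF (iter (idem_exp (ncoord n m) * q) (wsub f) x) ++ g) = reduce (g ++ projF y) ->
  (forall v, expo v (iter (idem_exp (ncoord n m) * q) (wsub f) x) = expo v y) ->
  low0 c.+1 (tracef c tr (iter (idem_exp (ncoord n m)) (wsub f) y) - tracef c tr y).
Proof.
move=> fs xs ys qB E1 E2; set M := idem_exp _ in E1 E2 *.
have E : low0 c.+1 (iter (M * q) (fun p => subst (hsub c tr f) p) (tracef c tr x) - tracef c tr y).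
  rewrite -(subrK (tracef c tr (iter (M * q) (wsub f) x)) (iter _ _ (tracef c tr x))) -addrA.
  apply: lowD; first exact: iter_tracef.
  exact: tracef_conj E1 E2.
have H := poly_orbit (@hsub_low n m c tr f) (trace_height_gt0 s) _ _ _ E qB.
rewrite -(subrK (iter M (fun p => subst (hsub c tr f) p) (tracef c tr y)) (tracef c tr (iter _ _ y))).
rewrite -addrA; apply: lowD.
  by rewrite -opprB; apply: lowN; apply: iter_tracef.
apply: H => [i|u|u]; first exact: hsub_height.
  by apply: hgt_coef; apply: tracef_height.
by apply: hgt_coef; apply: tracef_height.
Qed.

End Heights.

(** * Matrices of determinant 1 and their polynomial parametrisation *)

Section TwoByTwo.
Variable K : comNzRingType.

Definition upper (a : K) : 'M[K]_2 := 1 + a *: delta_mx 0 1.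
Definition lower (a : K) : 'M[K]_2 := 1 + a *: delta_mx 1 0.

(** Stabilisation is about polynomials on an affine space, whereas SL_2 is a hypersurface; these
    four free parameters map polynomially onto its rational points. *)
Definition elem (x : 'I_2 -> 'I_2 -> K) : 'M[K]_2 :=
  upper (x 0 0) * lower (x 0 1) * upper (x 1 0) * lower (x 1 1).

Lemma det2 (A : 'M[K]_2) : \det A = A 0 0 * A 1 1 - A 0 1 * A 1 0.
Proof.
rewrite (expand_det_row A 0) !big_ord_recl big_ord0 /cofactor !det_mx11 !mxE /=.
rewrite addr0 expr0 mul1r expr1 mulN1r mulrN.
congr (A _ _ * A _ _ - A _ _ * A _ _); exact: val_inj.
Qed.

Lemma ord2P (i : 'I_2) : i = 0 \/ i = 1.
Proof. by case: i => [[|[|//]] h]; [left|right]; apply: val_inj. Qed.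

Lemma mx2P (A B : 'M[K]_2) : A 0 0 = B 0 0 -> A 0 1 = B 0 1 -> A 1 0 = B 1 0 ->
  A 1 1 = B 1 1 -> A = B.
Proof. by move=> *; apply/matrixP => i j; case: (ord2P i) => ->; case: (ord2P j) => ->. Qed.

Lemma mul2E (A B : 'M[K]_2) i j : (A * B) i j = A i 0 * B 0 j + A i 1 * B 1 j.
Proof.
rewrite mxE !big_ord_recl big_ord0 addr0.
by congr (_ + A _ _ * B _ _); apply: val_inj.
Qed.

Lemma det_upper a : \det (upper a) = 1.
Proof. by rewrite det2 !mxE /=; ring. Qed.

Lemma det_lower a : \det (lower a) = 1.
Proof. by rewrite det2 !mxE /=; ring. Qed.

Lemma det_elem x : \det (elem x) = 1.
Proof.
by rewrite /elem -![_ * _]/(_ *m _) !det_mulmx !det_upper !det_lower !mul1r.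
Qed.

(** In determinant 1 the adjugate is the inverse, and it keeps the degree of polynomial entries. *)
Definition LSL (T : Type) (B : T -> 'M[K]_2) (a : T * bool) : 'M[K]_2 :=
  if a.2 then \adj (B a.1) else B a.1.

Lemma LSL_inv (T : Type) (B : T -> 'M[K]_2) : (forall i, \det (B i) = 1) ->
  forall a, mcong (zero_ideal K) (LSL B a * LSL B (linv a)) 1.
Proof.
move=> dB [i b]; apply/mcong_zero; rewrite /LSL /linv /=.
by case: b => /=; rewrite -[_ * _]/(_ *m _) ?mul_mx_adj ?mul_adj_mx dB.
Qed.

Lemma det_rep (T : choiceType) (B : T -> 'M[K]_2) w : (forall i, \det (B i) = 1) ->
  \det (rep (LSL B) w) = 1.
Proof.
move=> dB; elim: w => [|[i b] w IH]; first by rewrite /rep big_nil det1.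
rewrite rep_cons -[_ * _]/(_ *m _) det_mulmx IH mulr1 /LSL /=; case: b => //.
have := congr1 (fun A => \det A) (mul_mx_adj (B i)).
by rewrite det_mulmx dB mul1r det_scalar expr1n.
Qed.

End TwoByTwo.

Lemma map_elem (K K' : comNzRingType) (th : {rmorphism K -> K'}) x :
  map_mx th (elem x) = elem (fun a b => th (x a b)).
Proof.
have up a : map_mx th (upper a) = upper (th a).
  by rewrite /upper map_mxD map_mx1 map_mxZ map_delta_mx.
have lo a : map_mx th (lower a) = lower (th a).
  by rewrite /lower map_mxD map_mx1 map_mxZ map_delta_mx.
by rewrite /elem !rmorphM /= !up !lo.
Qed.

(* Four elementary factors suffice to write every matrix of determinant 1. *)
Lemma elem_surj (A : 'M[rat]_2) : \det A = 1 -> exists x, elem x = A.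
Proof.
rewrite det2 => dA.
pose e p q r s : 'I_2 -> 'I_2 -> rat := fun a b =>
  if a == 0 then (if b == 0 then p else q) else (if b == 0 then r else s).
have [c0|c0] := eqVneq (A 1 0) 0; last first.
  exists (e ((A 0 0 - 1) / A 1 0) (A 1 0) ((A 1 1 - 1) / A 1 0) 0).
  have dA' : A 0 1 = (A 0 0 * A 1 1 - 1) / A 1 0.
    by apply: (mulIf c0); rewrite divfK //; lra.
  by apply: mx2P; rewrite /elem !mul2E !mxE /= /e /= ?dA'; field.
have d0 : A 1 1 != 0.
  by apply: contraTneq isT => d0; move: dA; rewrite c0 d0 !mulr0 subrr => /eqP.
have dA' : A 0 0 = (A 1 1)^-1.
  by apply: (mulIf d0); rewrite mulVf //; move: dA; rewrite c0; lra.
(* Multiplication by [lower (-1)] on the right creates the non-zero lower left entry [- A 1 1] and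
   leads back to the first case. *)
exists (e (((A 0 0 - A 0 1) - 1) / (- A 1 1)) (- A 1 1) ((A 1 1 - 1) / (- A 1 1)) 1).
by apply: mx2P; rewrite /elem !mul2E !mxE /= /e /= ?c0 ?dA'; field; rewrite d0.
Qed.

Section Degrees.
Variables (D : nat) (K : comNzRingType).
Definition mdegle k (A : 'M[{mpoly K[D]}]_2) := forall i j, degle k (A i j).

Lemma mdegleM j k A B : mdegle j A -> mdegle k B -> mdegle (j + k) (A * B).
Proof. by move=> hA hB a b; rewrite mxE; apply: degle_sum => i _; apply: degleM. Qed.

Lemma mdegle1 k : mdegle k 1.
Proof.
move=> i j; rewrite mxE; case: (i == j); last exact: degle0.
by apply: (degle_mono (leq0n k)); apply: degle1.
Qed.

Lemma degleXnat k (p : {mpoly K[D]}) b : degle k p -> degle k (p *+ b).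
Proof. by move=> h m hm; rewrite mcoeffMn h ?mul0rn. Qed.

Lemma mdegle_upper a : degle 1 a -> mdegle 1 (upper a).
Proof.
move=> da i j; rewrite !mxE; apply: degleD; first by have := @mdegle1 1 i j; rewrite mxE.
by rewrite mulr_natr; apply: degleXnat.
Qed.

Lemma mdegle_lower a : degle 1 a -> mdegle 1 (lower a).
Proof.
move=> da i j; rewrite !mxE; apply: degleD; first by have := @mdegle1 1 i j; rewrite mxE.
by rewrite mulr_natr; apply: degleXnat.
Qed.

Lemma mdegle_elem x : (forall a b, degle 1 (x a b)) -> mdegle 4 (elem x).
Proof.
move=> hx; apply: (@mdegleM 3 1); last exact: mdegle_lower.
apply: (@mdegleM 2 1); last exact: mdegle_upper.
by apply: (@mdegleM 1 1); [apply: mdegle_upper|apply: mdegle_lower].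
Qed.

Lemma mdegle_adj k A : mdegle k A -> mdegle k (\adj A).
Proof.
move=> hA i j; rewrite mxE /cofactor det_mx11 !mxE.
by rewrite -signr_odd mulr_sign; case: ifP => _; [apply: degleN|]; apply: hA.
Qed.

Lemma mdegle_rep (T : choiceType) (B : T -> 'M[{mpoly K[D]}]_2) w :
  (forall i, mdegle 4 (B i)) -> mdegle (4 * size w) (rep (LSL B) w).
Proof.
move=> hB; elim: w => [|[i b] w IH]; first by rewrite /rep big_nil; apply: mdegle1.
rewrite rep_cons mulnS; apply: mdegleM => //.
by rewrite /LSL /=; case: b; [apply: mdegle_adj|].
Qed.

End Degrees.

Section SL2.
Variables n m : nat.
Let gen := ('I_n + 'I_m)%type.
Local Notation N := (ncoord n m).
Local Notation cvar := (@cvar n m).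
Variable tr : bool.

Definition Bpar (i : 'I_n) : 'M[{mpoly rat[N]}]_2 :=
  elem (fun a b => 'X_(cvar (inl (i, (a, b))))).

Definition tau (w : FxZ_word n m) : {mpoly rat[N]} :=
  (if tr then \tr (rep (LSL Bpar) (projF w)) else 0) + lin rat w.

(** Specialises the generic matrix [1 + X_i] to [Bpar i]. It has no constant terms because [Bpar i]
    is 1 at the origin, so truncation orders are respected. *)
Definition hpar (k : 'I_N) : {mpoly rat[N]} :=
  match enum_val k : coord n m with
  | inl (i, (a, b)) => (Bpar i - 1) a b
  | inr v => 'X_(cvar (inr v))
  end.

Lemma low0_X i : low0 1 ('X_i : {mpoly rat[N]}).
Proof.
move=> u; rewrite ltnS leqn0 mdeg_eq0 => /eqP->.
by rewrite mcoeffX; case: eqP => // /(congr1 (fun m => mdeg m)); rewrite mdeg0 mdeg1.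
Qed.

Lemma Bpar_low i : mcong (trunc_ideal N rat 1) (Bpar i) 1.
Proof.
have up a : low0 1 a -> mcong (trunc_ideal N rat 1) (upper a) 1.
  by move=> ha k l; rewrite /rcong !mxE addrAC subrr add0r; apply: lowMr.
have lo a : low0 1 a -> mcong (trunc_ideal N rat 1) (lower a) 1.
  by move=> ha k l; rewrite /rcong !mxE addrAC subrr add0r; apply: lowMr.
rewrite -[X in mcong _ _ X](_ : 1 * 1 * 1 * 1 = 1); last by rewrite !mulr1.
apply: mcongM; [apply: mcongM; [apply: mcongM|]|].
- exact/up/low0_X.
- exact/lo/low0_X.
- exact/up/low0_X.
- exact/lo/low0_X.
Qed.

Lemma hpar_low k : low0 1 (hpar k).
Proof.
rewrite /hpar; case: (enum_val k : coord n m) => [[i [a b]]|v]; last exact: low0_X.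
have := @Bpar_low i a b; rewrite /rcong; move: (Bpar i) => B h.
by rewrite mxE [X in _ + X]mxE.
Qed.

Lemma det_Bpar i : \det (Bpar i) = 1. Proof. exact: det_elem. Qed.

Lemma subst_hpar c w : low0 c.+1 (subst hpar (tracef c tr w) - tau w).
Proof.
have El : subst hpar (lin int w) = lin rat w.
  rewrite /lin rmorph_sum /=; apply: eq_bigr => v _.
  by rewrite rmorphM rmorph_int /= substX /hpar enum_rankK.
rewrite /tracef /tau rmorphD /= El opprD addrACA subrr addr0.
case: tr; last by rewrite rmorph0 subrr; apply: low_zero.
have LI' a : mcong (trunc_ideal N rat c.+1) (LSL Bpar a * LSL Bpar (linv a)) 1.
  by apply: mcong_eq; apply/mcong_zero; apply: LSL_inv det_Bpar a.
have := @trace_rep_morph _ _ (Ic n m c) (trunc_ideal N rat c.+1) _ _ (@Lgen n m c)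
  (LSL Bpar) (@Lgen_inv n m c) LI' (mmap intr hpar) (fun i => [:: (i, false)]) _ _ (projF w).
rewrite wsub_id; apply=> [p|i]; first exact: subst_low0 hpar_low.
apply: mcong_eq; rewrite rep1 /LSL /=.
apply/matrixP => a b; rewrite mxE.
have -> : @Lgen n m c (i, false) a b = (a == b)%:R + 'X_(cvar (inl (i, (a, b)))).
  by rewrite /Lgen /= !mxE.
rewrite rmorphD rmorph_nat /= substX /hpar enum_rankK; move: (Bpar i) => B.
by rewrite !mxE addrCA subrr addr0.
Qed.

Lemma tau_degle w : degle (4 * size w).+1 (tau w).
Proof.
apply: degleD.
  case: tr; last exact: degle0.
  apply: degle_sum => i _; apply: (degle_mono (j := 4 * size (projF w))).
    by rewrite ltnW // ltnS leq_mul2l size_projF.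
  by apply: mdegle_rep => j; apply: mdegle_elem => a b; apply: degleXU.
apply: degle_sum => v _; apply: (degle_mono (j := 0 + 1)) => //.
apply: degleM; last exact: degleXU.
by rewrite -(rmorph_int (@mpolyC _ rat)) => u u0; rewrite mcoeffC; case: eqP u0 => [->|]; rewrite ?mdeg0 ?mulr0.
Qed.

(** The SL_2 trace polynomials have degree at most [c], so agreement up to degree [c] is
    equality. *)
Lemma tau_eq c u w : (4 * size u < c)%N -> (4 * size w < c)%N ->
  low0 c.+1 (tracef c tr u - tracef c tr w) -> tau u = tau w.
Proof.
move=> uc wc h; apply/eqP; rewrite -subr_eq0; apply/eqP.
apply: (@degle_low_eq0 _ _ c).
  by apply: degleD; [|apply: degleN]; apply: (degle_mono _ (@tau_degle _)).
have -> : tau u - tau w = subst hpar (tracef c tr u - tracef c tr w)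
   - (subst hpar (tracef c tr u) - tau u) + (subst hpar (tracef c tr w) - tau w).
  have aux (K : comNzRingType) (a b d e : K) : d - e = a - b - (a - d) + (b - e) by ring.
  by rewrite rmorphB; apply: aux.
apply: lowD; last exact: subst_hpar.
apply: lowB; last exact: subst_hpar.
exact: subst_low0 hpar_low h.
Qed.

Definition point := (('I_n -> 'M[rat]_2) * (gen -> rat))%type.

Definition good (p : point) := forall i, \det (p.1 i) = 1.

Definition pval (p : point) (w : FxZ_word n m) : rat :=
  (if tr then \tr (rep (LSL p.1) (projF w)) else 0) + \sum_v (expo v w)%:~R * p.2 v.

Definition mkpoint (x : 'I_N -> rat) : point :=
  (fun i => elem (fun a b => x (cvar (inl (i, (a, b))))), fun v => x (cvar (inr v))).

Lemma good_mkpoint x : good (mkpoint x). Proof. by move=> i; apply: det_elem. Qed.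

Lemma pval_mkpoint x w : (tau w).@[x] = pval (mkpoint x) w.
Proof.
rewrite /tau /pval mevalD; congr (_ + _).
  case: tr; last by rewrite meval0.
  have := @trace_rep_morph _ _ (zero_ideal _) (zero_ideal _) _ _ (LSL Bpar)
    (LSL (mkpoint x).1) (LSL_inv det_Bpar) (LSL_inv (good_mkpoint x)) (meval x)
    (fun i => [:: (i, false)]) _ _ (projF w).
  rewrite wsub_id => h; apply/eqP; rewrite -subr_eq0; apply/eqP; apply: h.
    by move=> p /= ->; rewrite meval0.
  move=> i; apply/mcong_zero; rewrite rep1 /LSL [LHS](map_elem (meval x)) /elem /=.
  by rewrite !mevalXU.
rewrite /lin raddf_sum /=; apply: eq_bigr => v _.
by rewrite mevalM mevalXU rmorph_int.
Qed.

Lemma pval_ext p p' w : p.1 =1 p'.1 -> p.2 =1 p'.2 -> pval p w = pval p' w.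
Proof.
move=> h1 h2; rewrite /pval; congr (_ + _); last by apply: eq_bigr => v _; rewrite h2.
case: tr => //; congr (\tr _); apply: eq_bigr => -[i b] _.
by rewrite /LSL /= h1.
Qed.

Lemma mkpoint_surj p : good p -> exists x, forall w, pval p w = pval (mkpoint x) w.
Proof.
move=> gp; have /fin_all_exists[e he] i := elem_surj (gp i).
exists (fun k => match enum_val k : coord n m with
  | inl (i, (a, b)) => e i a b | inr v => p.2 v end) => w.
apply: pval_ext => [i|v] /=; last by rewrite enum_rankK.
rewrite -he /elem; congr (upper _ * lower _ * upper _ * lower _).
all: by rewrite enum_rankK.
Qed.

(** Equality of polynomials becomes equality at all rational representations, a condition that
    pulling back by an endomorphism visibly preserves. *)
Lemma tau_point u w : (forall p, good p -> pval p u = pval p w) <-> tau u = tau w.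
Proof.
split=> [h|E p gp].
  apply/eqP; rewrite -subr_eq0; apply/eqP/mpoly_fun_eq0 => x.
  by rewrite mevalB !pval_mkpoint h ?subrr //; apply: good_mkpoint.
have [x hx] := mkpoint_surj gp.
by rewrite !hx -!pval_mkpoint E.
Qed.

Variable f : gen -> FxZ_word n m.
Hypothesis cf : tr -> central f.

Definition pull (p : point) : point :=
  (fun i => rep (LSL p.1) (subF f i), fun v => \sum_u (expo u (f v))%:~R * p.2 u).

Lemma good_pull p : good p -> good (pull p).
Proof. by move=> gp i; apply: det_rep. Qed.

Lemma pval_pull p w : good p -> pval (pull p) w = pval p (wsub f w).
Proof.
move=> gp; rewrite /pval; congr (_ + _); last first.
  under eq_bigr do rewrite mulr_sumr.
  rewrite exchange_big /=; apply: eq_bigr => u _.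
  rewrite expo_wsub rmorph_sum mulr_suml; apply: eq_bigr => v _.
  by rewrite rmorphM /= mulrA.
case E: tr => //.
have := @trace_rep_morph _ _ (zero_ideal _) (zero_ideal _) _ _ (LSL (pull p).1)
    (LSL p.1) (LSL_inv (good_pull gp)) (LSL_inv gp) idfun (subF f) _ _ (projF w).
move=> h; apply: (@etrans _ _ (\tr (rep (LSL p.1) (wsub (subF f) (projF w))))).
  apply/eqP; rewrite -subr_eq0; apply/eqP; apply: h => // i.
  by apply/mcong_zero; rewrite map_mx_id.
have := mcong_trace (rep_eq (LSL_inv gp) (projF_wsub w (cf E))).
by move=> /= /eqP; rewrite subr_eq0 => /eqP ->.
Qed.

Lemma good_iter_pull k p : good p -> good (iter k pull p).
Proof. by move=> gp; elim: k => //= k; apply: good_pull. Qed.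

Lemma pval_iter_pull k p w : good p -> pval (iter k pull p) w = pval p (iter k (wsub f) w).
Proof.
move=> gp; elim: k w => [//|k IH] w.
by rewrite iterS pval_pull ?IH -?iterSr //; apply: good_iter_pull.
Qed.

Lemma tau_iter k u w : tau u = tau w -> tau (iter k (wsub f) u) = tau (iter k (wsub f) w).
Proof.
move=> /tau_point E; apply/tau_point => p gp; rewrite -!pval_iter_pull //.
exact/E/good_iter_pull.
Qed.

Theorem tau_orbit M q x y : tau (iter M (wsub f) y) = tau y ->
  tau (iter (M * q) (wsub f) x) = tau y ->
  forall j, (N <= j)%N -> tau (iter (M * j) (wsub f) x) = tau y.
Proof.
move=> Ey Ex j Nj.
have Eyk k : tau (iter (M * k) (wsub f) y) = tau y.
  elim: k => [|k IH]; first by rewrite muln0.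
  by rewrite mulnS iterD (tau_iter _ IH).
pose F k := tau (iter (M * k) (wsub f) x) - tau (iter (M * k) (wsub f) y).
pose fn k p := pval p (iter (M * k) (wsub f) x) - pval p (iter (M * k) (wsub f) y).
have Fq : F q = 0 by rewrite /F Ex Eyk subrr.
have surj p : good p -> exists v, forall j, fn j p = fn j (mkpoint v).
  by move=> gp; have [v hv] := mkpoint_surj gp; exists v => k; rewrite /fn !hv.
have Ff k v : (F k).@[v] = fn k (mkpoint v) by rewrite mevalB !pval_mkpoint.
have fS k p : good p -> fn k.+1 p = fn k (iter M pull p).
  by move=> gp; rewrite /fn !pval_iter_pull // -!iterD -mulnS.
have FN := stabilisation good_mkpoint (good_iter_pull M) surj Ff fS Fq.
have := stable_zero_leq good_mkpoint (good_iter_pull M) surj Ff fS Nj FN.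
by rewrite /F Eyk => /eqP; rewrite subr_eq0 => /eqP.
Qed.

End SL2.

(** * The group F_n x Z^m *)

Local Close Scope ring_scope.
Local Open Scope group_scope.

Section FreeWords.
Variable T : choiceType.
Implicit Types (u v w : word T).

Lemma free_of_word_cat u v : free_of_word (u ++ v) = free_of_word u * free_of_word v.
Proof. by apply: val_inj; rewrite /= reduce_catl reduce_catr. Qed.

Lemma free_of_wordP u v : free_of_word u = free_of_word v <-> reduce u = reduce v.
Proof. by split=> [/(congr1 val)|E] //; apply: val_inj. Qed.

Lemma free_of_fword (x : freegroup T) : free_of_word (fword x) = x.
Proof. by apply: val_inj => /=; apply: reduce_id; case: x. Qed.

Lemma free_of_winv u : free_of_word (winv u) = (free_of_word u)^-1.
Proof.
apply: (mulIg (free_of_word u)); rewrite mulVg -free_of_word_cat.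
by apply/free_of_wordP; rewrite reduce_winv.
Qed.

End FreeWords.

Section Conjugacy.
Variable G : groupType.
Implicit Types x y z : G.

Lemma conjugateP x y : conjugate x y <-> exists g, x * g = g * y.
Proof.
split=> -[g E]; exists g; first by rewrite -E conjgE mulgA mulgV mul1g.
by rewrite conjgE E mulgA mulVg mul1g.
Qed.

Lemma conjugate_refl x : conjugate x x.
Proof. by exists 1; rewrite conjg1. Qed.

Lemma conjugate_sym x y : conjugate x y -> conjugate y x.
Proof. by move=> [g <-]; exists g^-1; rewrite conjgK. Qed.

Lemma conjugate_trans x y z : conjugate x y -> conjugate y z -> conjugate x z.
Proof. by move=> [g <-] [h <-]; exists (g * h); rewrite conjgM. Qed.

Lemma conjugate_iter (f : {multiplicative G -> G}) k x y :
  conjugate x y -> conjugate (iter k f x) (iter k f y).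
Proof.
elim: k => //= k IH /IH /conjugateP[g E]; apply/conjugateP; exists (f g).
by rewrite -!gmulfM E.
Qed.

Lemma multiplicative1 (f : {multiplicative G -> G}) : f 1 = 1.
Proof. by apply: (mulgI (f 1)); rewrite -gmulfM !mulg1. Qed.

Lemma multiplicativeV (f : {multiplicative G -> G}) x : f x^-1 = (f x)^-1.
Proof. by apply: (mulgI (f x)); rewrite -gmulfM !mulgV multiplicative1. Qed.

End Conjugacy.

Section EvalWords.
Variables n m : nat.
Let gen := ('I_n + 'I_m)%type.
Implicit Types (u v w : FxZ_word n m).

Lemma FxZ_eval_cat u v : FxZ_eval (u ++ v) = FxZ_eval u * FxZ_eval v.
Proof. by rewrite /FxZ_eval /word_eval big_cat. Qed.

Lemma FxZ_eval1 w : (FxZ_eval w).1 = free_of_word (projF w).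
Proof.
elim: w => [|[g b] w IH]; first by rewrite /FxZ_eval /word_eval big_nil.
rewrite -cat1s FxZ_eval_cat projF_cat free_of_word_cat /= -IH; congr (_ * _).
rewrite /FxZ_eval /word_eval big_seq1 /=; case: g => [i|j] /=; last by case: b => //=; rewrite invg1.
by case: b => //=; rewrite /free_gen -free_of_winv.
Qed.

Lemma FxZ_eval2 w j : ((FxZ_eval w).2 : 'rV[int]_m) 0%R j = expo (inr j) w.
Proof.
elim: w => [|[g b] w IH].
  by rewrite /FxZ_eval /word_eval big_nil expo_nil mxE.
rewrite -cat1s FxZ_eval_cat expo_cat -IH.
rewrite [LHS]mxE; congr (_ + _)%R.
rewrite /FxZ_eval /word_eval big_seq1 expo_cons expo_nil addr0 /=.
case: g => [i|l] /=; first by case: b; rewrite !mxE /= ?oppr0.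
rewrite (inj_eq inr_inj) eq_sym.
by case: b; rewrite !mxE /=; case: (j == l).
Qed.

Lemma FxZ_eval_inj u v : FxZ_eval u = FxZ_eval v <->
  reduce (projF u) = reduce (projF v) /\ forall j, expo (inr j) u = expo (inr j) v.
Proof.
split=> [E|[E1 E2]].
  split=> [|j]; first by apply/free_of_wordP; rewrite -!FxZ_eval1 E.
  by rewrite -!FxZ_eval2 E.
have : (FxZ_eval u).1 = (FxZ_eval v).1 by rewrite !FxZ_eval1; apply/free_of_wordP.
have : (FxZ_eval u).2 = (FxZ_eval v).2 by apply/rowP => j; rewrite !FxZ_eval2.
by case: (FxZ_eval u) (FxZ_eval v) => [? ?] [? ?] /= -> ->.
Qed.

Definition expoF (i : 'I_n) (w : word 'I_n) : int :=
  \sum_(a <- w) (if a.1 == i then (if a.2 then -1 else 1) else 0)%R.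

Lemma expo_projF i w : expo (inl i) w = expoF i (projF w).
Proof.
elim: w => [|[[k|j] b] w IH]; first by rewrite expo_nil /expoF big_nil.
  rewrite expo_cons IH /expoF big_cons /=; congr (_ + _)%R.
by rewrite expo_cons /= add0r.
Qed.

Lemma expoF_cat i (u v : word 'I_n) : expoF i (u ++ v) = (expoF i u + expoF i v)%R.
Proof. by rewrite /expoF big_cat. Qed.

Lemma expoF_cons i a (w : word 'I_n) :
  expoF i (a :: w) = ((if a.1 == i then (if a.2 then -1 else 1) else 0) + expoF i w)%R.
Proof. by rewrite /expoF big_cons. Qed.

Lemma expoF_reduce i (w : word 'I_n) : expoF i (reduce w) = expoF i w.
Proof.
elim: w => //= a w IH; rewrite [RHS]expoF_cons -{}IH.
rewrite /= /push -/(reduce w); case: (reduce w) => [|b v]; first by rewrite expoF_cons.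
case: eqP => [->|_]; last by rewrite expoF_cons.
rewrite [in RHS]expoF_cons /linv /= addrA.
by case: (_ == i); case: a.2; rewrite /= ?addr0 ?addNr ?subrr ?add0r.
Qed.

Lemma FxZ_conjP u v : conjugate (FxZ_eval u) (FxZ_eval v) <->
  conjugate (free_of_word (projF u)) (free_of_word (projF v)) /\
  forall j, expo (inr j) u = expo (inr j) v.
Proof.
split=> [/conjugateP[g E]|[/conjugateP[g E] E2]].
  split; first by apply/conjugateP; exists g.1; rewrite -!FxZ_eval1 -[_ * g.1]/((_ * g).1) E.
  move=> j; rewrite -!FxZ_eval2.
  have : ((FxZ_eval u).2 * g.2 = g.2 * (FxZ_eval v).2) by rewrite -[_ * _]/((_ * g).2) E.
  move=> /(congr1 (fun x : 'rV[int]_m => x 0%R j)).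
  by rewrite [LHS]mxE [RHS]mxE addrC => /addrI.
apply/conjugateP; exists (g, 1).
have E' : (FxZ_eval u).2 = (FxZ_eval v).2 by apply/rowP => j; rewrite !FxZ_eval2.
have : (FxZ_eval u).1 * g = g * (FxZ_eval v).1 by rewrite !FxZ_eval1.
case: (FxZ_eval u) (FxZ_eval v) E' => [a1 a2] [b1 b2] /= -> E1.
by congr (_, _); rewrite // mulg1 mul1g.
Qed.

Lemma conj_words (T : choiceType) (u v : word T) :
  conjugate (free_of_word u) (free_of_word v) <->
  exists g, reduce (u ++ g) = reduce (g ++ v).
Proof.
split=> [/conjugateP[g]|[g E]].
  rewrite -(free_of_fword g) -!free_of_word_cat => /free_of_wordP E; by exists (fword g).
by apply/conjugateP; exists (free_of_word g); rewrite -!free_of_word_cat; apply/free_of_wordP.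
Qed.

Lemma expo_conj u v : conjugate (FxZ_eval u) (FxZ_eval v) ->
  forall g, expo g u = expo g v.
Proof.
move=> /FxZ_conjP[/conj_words[g E] E2] [i|j] //.
rewrite !expo_projF; have := congr1 (expoF i) E.
by rewrite !expoF_reduce !expoF_cat addrC => /addrI.
Qed.

Section Endomorphism.
Variables (Phi : {multiplicative FxZ n m -> FxZ n m}).
Variables (us : n.-tuple (FxZ_word n m)) (vs : m.-tuple (FxZ_word n m)).
Hypothesis rep : represents Phi us vs.

Definition images (g : gen) : FxZ_word n m :=
  match g with inl i => tnth us i | inr j => tnth vs j end.

Lemma images_eval g : Phi (FxZ_gen g) = FxZ_eval (images g).
Proof. by case: rep => h1 h2; case: g. Qed.

Lemma FxZ_eval_winv w : FxZ_eval (winv w) = (FxZ_eval w)^-1.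
Proof.
elim: w => [|[g b] w IH]; first by rewrite /FxZ_eval /word_eval !big_nil invg1.
rewrite winv_cons -cats1 -[(g, b) :: w]cat1s !FxZ_eval_cat IH invgM; congr (_ * _).
by rewrite /FxZ_eval /word_eval !big_seq1 /linv /=; case: b => //=; rewrite invgK.
Qed.

Lemma FxZ_eval_wsub w : FxZ_eval (wsub images w) = Phi (FxZ_eval w).
Proof.
elim: w => [|[g b] w IH].
  by rewrite /wsub /= /FxZ_eval /word_eval big_nil multiplicative1.
rewrite wsub_cons -[(g, b) :: w]cat1s !FxZ_eval_cat IH gmulfM; congr (_ * _).
rewrite {2}/FxZ_eval /word_eval big_seq1 /wlet /=.
by case: b; rewrite ?FxZ_eval_winv ?multiplicativeV images_eval.
Qed.

Lemma FxZ_eval_iter k w : FxZ_eval (iter k (wsub images) w) = iter k Phi (FxZ_eval w).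
Proof. by elim: k => //= k <-; rewrite FxZ_eval_wsub. Qed.

End Endomorphism.

End EvalWords.

(** * Conjugacy in free groups *)

Local Close Scope group_scope.
Local Open Scope ring_scope.

Definition cycred (T : choiceType) (w : word T) := cycle (fun a b => b != linv a) w.

Lemma size_reduce (T : choiceType) (w : word T) : (size (reduce w) <= size w)%N.
Proof.
elim: w => //= a w IH; rewrite /push -/(reduce w).
case: (reduce w) IH => [//|b v] /= IH; case: ifP => _ //=.
by rewrite (leq_trans (leqnSn _)) // (leq_trans IH).
Qed.

Lemma linv_neq (T : choiceType) (a : T * bool) : a != linv a.
Proof. by case: a => x [] /=; apply/negP => /eqP []. Qed.

(** While the last letter is inverse to the first, a conjugation removes both. *)
Lemma cycred_exists (T : choiceType) (w : word T) : exists w0,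
  [/\ (size w0 <= size w)%N, cycred w0 & conjugate (free_of_word w) (free_of_word w0)].
Proof.
have [k] := ubnP (size w); elim: k w => // k IH w wk.
have E : free_of_word w = free_of_word (reduce w).
  by apply/free_of_wordP; rewrite (reduce_id (reduce_reduced w)).
have := size_reduce w; have := reduce_reduced w.
rewrite E; move: (reduce w) => r rr rw.
have [cr|] := boolP (cycred r); first by exists r; split=> //; apply: conjugate_refl.
case: r rr rw {E} => [//|a r] rr rw; rewrite /cycred /= rcons_path negb_and.
rewrite /reduced /= in rr; rewrite rr /= negbK => /eqP E.
case: (lastP r) E rr rw => [|v b] E rr rw; first by move/eqP: E; rewrite (negbTE (linv_neq a)).
rewrite last_rcons in E; rewrite E.
have [|w0 [s0 c0 h0]] := IH v.
  by move: rw wk; rewrite /= size_rcons => h1 h2; rewrite -ltnS (leq_trans _ h2) // ltnS (leq_trans _ h1).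
exists w0; split=> //.
  by apply: leq_trans s0 (leq_trans _ rw); rewrite /= size_rcons -addn2 leq_addr.
apply: conjugate_trans h0; apply/conj_words; exists [:: linv b].
rewrite -cats1 -cat_cons -catA -reduce_catr (_ : reduce ([:: b] ++ [:: linv b]) = [::]).
  by rewrite cats0.
by rewrite /reduce /= eqxx.
Qed.

(** * Hyperbolic representations and cyclic length *)

Section Hyperbolic.
Variable n : nat.
Let letter := ('I_n * bool)%type.
Implicit Types (a b : letter) (w : word 'I_n) (t : rat).

(** Any injective assignment of slopes puts the letters and their inverses on pairwise distinct
    lines. *)
Definition slope a : rat := ((2 * a.1 + a.2)%N)%:R.

Lemma slope_inj a b : slope a = slope b -> a = b.
Proof.
move=> /eqP; rewrite /slope eqr_nat => /eqP; case: a b => [i x] [j y] /= E.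
have [E1 E2] : (i = j :> nat) /\ x = y by case: x y E => [] []; lia.
by congr (_, _) => //; apply: val_inj.
Qed.

Definition vv a (k : 'I_2) : rat := if k == 0 then 1 else slope a.
Definition ww a (k : 'I_2) : rat :=
  (if k == 0 then - slope (linv a) else 1) / (slope a - slope (linv a)).

(* The projection onto the line of slope [slope a] along that of slope [slope (linv a)]. *)
Definition Pi a : 'M[rat]_2 := \matrix_(k, l) (vv a k * ww a l).

(** The scalar that appears in the product of the rank one matrices [Pi a] and [Pi b]; it vanishes
    only if the line of [b] is the kernel of [Pi a], that is for b inverse to a. *)
Definition pairing a b := ww a 0 * vv b 0 + ww a 1 * vv b 1.

Lemma slope_neq a : slope a - slope (linv a) != 0.
Proof.
by rewrite subr_eq0; apply: contra (linv_neq a) => /eqP/slope_inj <-.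
Qed.

Lemma pairing_neq0 a b : b != linv a -> pairing a b != 0.
Proof.
move=> ab; rewrite /pairing /ww /vv /=.
have -> : - slope (linv a) / (slope a - slope (linv a)) * 1 +
          1 / (slope a - slope (linv a)) * slope b =
          (slope b - slope (linv a)) / (slope a - slope (linv a)) by ring.
rewrite mulf_neq0 ?invr_eq0 ?slope_neq // subr_eq0.
by apply: contra ab => /eqP/slope_inj ->.
Qed.

Lemma slope_neq' a : slope (linv a) - slope a != 0.
Proof. by rewrite -opprB oppr_eq0 slope_neq. Qed.

(** Eigenvalues t and 1/t on the lines of x_i and of its inverse. For large t the generators play
    ping-pong, and the trace of a cyclically reduced word grows like t to its length. *)
Definition Bt t (i : 'I_n) : 'M[rat]_2 := t *: Pi (i, false) + t^-1 *: Pi (i, true).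

Lemma Bt_mul t a : t != 0 ->
  (t *: Pi a + t^-1 *: Pi (linv a)) * (t *: Pi (linv a) + t^-1 *: Pi a) = 1.
Proof.
move=> t0; have h1 := slope_neq a; have h2 := slope_neq' a.
by apply: mx2P; rewrite mul2E !mxE /vv /ww /= linvK;
  move: (slope a) (slope (linv a)) h1 h2 => p q h1 h2; field; rewrite ?h1 ?h2 ?t0.
Qed.

Lemma det_Bt t i : t != 0 -> \det (Bt t i) = 1.
Proof.
move=> t0; rewrite det2 !mxE /vv /ww /= /linv /=.
have h1 := slope_neq (i, false); have h2 := slope_neq' (i, false).
by rewrite /linv /= in h1 h2 *; move: (slope (i, false)) (slope (i, true)) h1 h2 => p q h1 h2;
  field; rewrite ?h1 ?h2 ?t0.
Qed.

Lemma LSL_Bt t a : t != 0 -> LSL (Bt t) a = t *: Pi a + t^-1 *: Pi (linv a).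
Proof.
move=> t0; case: a => i [] /=; rewrite /LSL /=; last by [].
have E := Bt_mul (i, false) t0.
have : \adj (Bt t i) * (Bt t i * (t *: Pi (i, true) + t^-1 *: Pi (i, false))) = \adj (Bt t i).
  by rewrite E mulr1.
rewrite mulrA -[\adj _ * _]/(_ *m _) mul_adj_mx det_Bt // => <-.
by rewrite mul1r.
Qed.

(** The matrix of the letter multiplied by t, which clears the denominator. *)
Definition Pmx a : 'M[{poly rat}]_2 :=
  'X^2 *: map_mx polyC (Pi a) + map_mx polyC (Pi (linv a)).

Definition tpoly w : {poly rat} := \tr (\prod_(a <- w) Pmx a).

Lemma horner_tpoly t w : t != 0 -> (tpoly w).[t] = t ^+ size w * \tr (rep (LSL (Bt t)) w).
Proof.
move=> t0; rewrite -[LHS]/(horner_eval t (tpoly w)) /tpoly -trace_map_mx rmorph_prod /=.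
rewrite -mxtraceZ; congr (\tr _).
elim: w => [|a w IH]; first by rewrite /rep !big_nil scale1r.
have E : map_mx (horner_eval t) (Pmx a) = t *: (t *: Pi a + t^-1 *: Pi (linv a)).
  rewrite /Pmx; move: (Pi a) (Pi (linv a)) => P Q; apply/matrixP => i j.
  by rewrite !mxE /horner_eval !hornerE; field; rewrite t0.
rewrite rep_cons big_cons IH E LSL_Bt // exprS -scalerAr -scalerAl.
by rewrite !scalerA mulrC.
Qed.

Definition lead d (A : 'M[{poly rat}]_2) (C : 'M[rat]_2) :=
  forall i j, (size (A i j) <= d.+1)%N /\ (A i j)`_d = C i j.

Lemma leadM d e A B C C' : lead d A C -> lead e B C' -> lead (d + e) (A * B) (C * C').
Proof.
move=> hA hB i j; rewrite !mxE; split.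
  apply: leq_trans (size_sum _ _ _) _; apply/bigmax_leqP => k _.
  apply: leq_trans (size_polyMleq _ _) _.
  have [h1 _] := hA i k; have [h2 _] := hB k j.
  by move: h1 h2; move: (size (A i k)) (size (B k j)) => p q; lia.
rewrite coef_sum; apply: eq_bigr => k _.
have [h1 <-] := hA i k; have [h2 <-] := hB k j.
rewrite coefM (bigD1 (inord d)) //= inordK ?ltnS ?leq_addr // addKn big1 ?addr0 //.
move=> [l lde] /= /negbTE; rewrite -val_eqE /= inordK ?ltnS ?leq_addr // => ld.
have [ll|ll] := ltnP d l; first by rewrite nth_default ?mul0r // (leq_trans h1).
by rewrite [X in _ * X]nth_default ?mulr0 // (leq_trans h2) //; move: ld ll lde; lia.
Qed.

Lemma lead_Pmx a : lead 2 (Pmx a) (Pi a).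
Proof.
move=> i j; rewrite /Pmx !mxE; split.
  rewrite (leq_trans (size_polyD _ _)) // geq_max; apply/andP; split.
    by rewrite mulrC mul_polyC (leq_trans (size_scale_leq _ _)) // size_polyXn.
  by rewrite (leq_trans (size_polyC_leq1 _)).
by rewrite coefD mulrC coefCM coefXn coefC /= mulr1 addr0.
Qed.

Lemma lead_prod w : lead (2 * size w) (\prod_(a <- w) Pmx a) (\prod_(a <- w) Pi a).
Proof.
elim: w => [|a w IH]; last by rewrite !big_cons mulnS; apply: leadM (lead_Pmx a) IH.
rewrite !big_nil => i j; rewrite !mxE; case: (i == j).
  by rewrite size_poly1 coef1.
by rewrite size_poly0 coef0.
Qed.

Lemma prod_Pi a w : path (fun a b => b != linv a) a w ->
  exists2 c, c != 0 & \prod_(b <- a :: w) Pi b = \matrix_(k, l) (c * (vv a k * ww (last a w) l)).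
Proof.
elim: w a => [|b w IH] a /=.
  by exists 1; rewrite ?oner_eq0 // big_seq1; apply/matrixP => k l; rewrite !mxE mul1r.
move=> /andP[ab /IH[c c0 E]]; exists (pairing a b * c).
  by rewrite mulf_neq0 ?pairing_neq0.
rewrite big_cons E; apply/matrixP => k l.
by rewrite [LHS]mul2E !mxE /pairing; ring.
Qed.

(* The leading coefficient is a product of pairings of consecutive letters. *)
Lemma size_tpoly w : cycred w -> size (tpoly w) = (2 * size w).+1.
Proof.
case: w => [_|a w]; first by rewrite /tpoly big_nil mxtrace1 -polyC_natr size_polyC pnatr_eq0.
rewrite /cycred /= rcons_path => /andP[pw lw].
have hl := lead_prod (a :: w).
have le : (size (tpoly (a :: w)) <= (2 * size (a :: w)).+1)%N.
  apply: leq_trans (size_sum _ _ _) _; apply/bigmax_leqP => k _.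
  by have [] := hl k k.
apply/eqP; rewrite eqn_leq le ltnNge /=; apply/negP => h.
have : (tpoly (a :: w))`_(2 * size (a :: w)) = 0 by rewrite nth_default.
rewrite /tpoly coef_sum (eq_bigr (fun k => (\prod_(b <- a :: w) Pi b) k k)); last first.
  by move=> k _; have [_ ->] := hl k k.
have [c c0 ->] := prod_Pi pw.
rewrite !big_ord_recl big_ord0 addr0 !mxE -mulrDr => /eqP.
rewrite mulf_eq0 (negbTE c0) /=; have := pairing_neq0 lw; rewrite /pairing.
rewrite [ww _ 0 * _]mulrC [ww _ 1 * _]mulrC => /negbTE.
by have -> : lift ord0 ord0 = 1 :> 'I_2 by [apply: val_inj]; move=> ->.
Qed.

Lemma poly_eq0_nonzero (P : {poly rat}) : (forall t, t != 0 -> P.[t] = 0) -> P = 0.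
Proof.
move=> P0; apply/eqP; apply: contraT => Pn0.
have := @max_poly_roots _ P [seq (i.+1%:R : rat) | i <- iota 0 (size P)] Pn0.
rewrite size_map size_iota ltnn; apply.
  by apply/allP => x /mapP[i _ ->]; apply/rootP/P0; rewrite pnatr_eq0.
by rewrite map_inj_uniq ?iota_uniq // => i j /eqP; rewrite eqr_nat => /eqP[].
Qed.

(** Compare degrees: |w| + 2 |u| = |u| + 2 |w|. *)
Lemma cycred_size u w : cycred u -> cycred w ->
  (forall t, t != 0 -> \tr (rep (LSL (Bt t)) u) = \tr (rep (LSL (Bt t)) w)) ->
  size u = size w.
Proof.
move=> cu cw E.
have EP : 'X^(size w) * tpoly u = 'X^(size u) * tpoly w.
  apply/eqP; rewrite -subr_eq0; apply/eqP/poly_eq0_nonzero => t t0.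
  by rewrite !hornerE !horner_tpoly // E //; ring.
have := congr1 (fun p : {poly rat} => size p) EP.
have nz v : cycred v -> tpoly v != 0 by move=> cv; rewrite -size_poly_eq0 size_tpoly.
rewrite !size_monicM ?monicXn ?nz // !size_polyXn !size_tpoly //=; lia.
Qed.

End Hyperbolic.

Section Fibres.
Variables n m : nat.
Implicit Types (u w : FxZ_word n m).

(** At the trivial representation all traces agree, and the linear coordinates can single out
    [v]. *)
Lemma tau_expo tr u w : tau tr u = tau tr w -> forall v, expo v u = expo v w.
Proof.
move=> /tau_point E v.
pose p : point n m := (fun=> 1, fun v' => (v' == v)%:R).
have gp : good p by move=> i; rewrite /= det1.
have := E p gp; rewrite /pval.
have one z : rep (LSL (fun _ : 'I_n => 1 : 'M[rat]_2)) z = 1.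
  elim: z => [|[i b] z IH]; first by rewrite /rep big_nil.
  rewrite rep_cons IH mulr1 /LSL /=; case: b => //.
  by have := mul_mx_adj (1 : 'M[rat]_2); rewrite det1 mul1mx.
rewrite /= !one => /addrI.
have del z : \sum_v0 (expo v0 z)%:~R * (v0 == v)%:R = (expo v z)%:~R :> rat.
  rewrite (bigD1 v) //= eqxx mulr1 big1 ?addr0 // => v' /negbTE ->.
  by rewrite mulr0.
by rewrite !del => /intr_inj.
Qed.

Lemma tau_size u w (u0 w0 : word 'I_n) : tau true u = tau true w ->
  cycred u0 -> conjugate (free_of_word (projF u)) (free_of_word u0) ->
  cycred w0 -> conjugate (free_of_word (projF w)) (free_of_word w0) ->
  size u0 = size w0.
Proof.
move=> /tau_point E cu hu cw hw; apply: cycred_size => // t t0.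
have gp : @good n m (@Bt n t, fun=> 0) by move=> i; exact: det_Bt.
have := E _ gp; rewrite /pval /= !big1 ?addr0; try by move=> v _; rewrite mulr0.
have LI := LSL_inv gp.
have tr_conj (x y : word 'I_n) : conjugate (free_of_word x) (free_of_word y) ->
    \tr (rep (LSL (Bt t)) x) = \tr (rep (LSL (Bt t)) y).
  move=> /conj_words[g /(rep_conj_trace LI) /= /eqP].
  by rewrite subr_eq0 => /eqP.
by rewrite (tr_conj _ _ hu) (tr_conj _ _ hw).
Qed.

(** The successor keeps the base positive, so that the bound is monotone in [s] also for n = 0. *)
Definition class_bound s := ((2 * n).+1 ^ s)%N.

(** All cyclically reduced forms have the length of that of [y], so two of them coincide by the
    pigeonhole principle; the exponents agree by [tau_expo]. *)
Lemma finite_fibres (z : nat -> FxZ_word n m) y s K : (size y <= s)%N ->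
  (class_bound s < K)%N -> (forall i, (i < K)%N -> tau true (z i) = tau true y) ->
  exists i j, [/\ (i < j)%N, (j < K)%N & conjugate (FxZ_eval (z i)) (FxZ_eval (z j))].
Proof.
move=> ys sK Ez.
have [y0 [sy cy hy]] := cycred_exists (projF y).
have y0s : (size y0 <= s)%N by rewrite (leq_trans sy) // (leq_trans (size_projF y)).
have /fin_all_exists[r hr] : forall i : 'I_K, exists r : (size y0).-tuple ('I_n * bool),
    conjugate (free_of_word (projF (z i))) (free_of_word r).
  move=> i; have [r [sr cr hr]] := cycred_exists (projF (z i)).
  have E : size r == size y0 by rewrite (tau_size (Ez i (ltn_ord i)) cr hr cy hy).
  by exists (Tuple E).
have ninj : ~~ injectiveb r.
  apply/negP => /injectiveP /leq_card; rewrite card_tuple card_prod card_ord card_bool leqNgt card_ord.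
  move/negP; apply; apply: leq_ltn_trans sK; rewrite /class_bound mulnC.
  apply: (@leq_trans ((2 * n).+1 ^ size y0)); last by rewrite leq_pexp2l.
  by case: (size y0) => // k; rewrite leq_exp2r.
have [i [j [ij rij]]] : exists i j : 'I_K, (i < j)%N /\ r i = r j.
  move/injectivePn: ninj => [i [j ij E]].
  case: (ltngtP i j) => [lt|gt|/val_inj eq]; [by exists i, j|by exists j, i|].
  by rewrite eq eqxx in ij.
exists i, j; split=> //; apply/FxZ_conjP; split.
  by apply: conjugate_trans (hr i) _; rewrite rij; apply/conjugate_sym/hr.
by move=> k; apply: (tau_expo (tr := true)); rewrite !Ez.
Qed.

End Fibres.

(** * Centralizers in free groups *)

Section FreeCentralizer.
Variable n : nat.
Implicit Types (u v w : word 'I_n).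

Lemma proportional_commute (p s t a b a' b' c c' : rat) : p != 0 ->
  p * b = a * s -> p * c = a * t -> p * b' = a' * s -> p * c' = a' * t ->
  b * c' = b' * c.
Proof.
move=> p0 h1 h2 h3 h4; apply: (mulfI (mulf_neq0 p0 p0)).
have -> : p * p * (b * c') = (p * b) * (p * c') by ring.
have -> : p * p * (b' * c) = (p * b') * (p * c) by ring.
by rewrite h1 h2 h3 h4; ring.
Qed.

(* Writing a matrix modulo scalars as the vector of its entries 01, 10 and 00 - 11,
   two matrices commute iff these vectors are proportional. *)
Lemma commute_2x2 (A B C : 'M[rat]_2) : ~ (exists a, A = a%:M) ->
  A * B = B * A -> A * C = C * A -> B * C = C * B.
Proof.
move=> nA AB AC.
have e X Y i j : X * Y = Y * X :> 'M[rat]_2 ->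
   X i 0 * Y 0 j + X i 1 * Y 1 j = Y i 0 * X 0 j + Y i 1 * X 1 j.
  by move=> E; rewrite -!mul2E E.
have rel X Y : X * Y = Y * X :> 'M[rat]_2 ->
  [/\ X 0 1 * Y 1 0 = X 1 0 * Y 0 1, X 0 1 * (Y 0 0 - Y 1 1) = (X 0 0 - X 1 1) * Y 0 1 &
      X 1 0 * (Y 0 0 - Y 1 1) = (X 0 0 - X 1 1) * Y 1 0].
  move=> E; have h1 := e _ _ 0 0 E; have h2 := e _ _ 0 1 E; have h3 := e _ _ 1 0 E.
  split; lra.
have comm (X Y : 'M[rat]_2) : X 0 1 * Y 1 0 = X 1 0 * Y 0 1 ->
    X 0 1 * (Y 0 0 - Y 1 1) = (X 0 0 - X 1 1) * Y 0 1 ->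
    X 1 0 * (Y 0 0 - Y 1 1) = (X 0 0 - X 1 1) * Y 1 0 -> X * Y = Y * X :> 'M[rat]_2.
  by move=> h1 h2 h3; apply: mx2P; rewrite !mul2E; lra.
have [b1 b2 b3] := rel _ _ AB; have [c1 c2 c3] := rel _ _ AC.
have scal : A 0 1 = 0 -> A 1 0 = 0 -> A 0 0 - A 1 1 = 0 -> exists a, A = a%:M.
  by move=> h1 h2 /eqP; rewrite subr_eq0 => /eqP h3; exists (A 0 0); apply: mx2P; rewrite !mxE.
set x := A 0 1 in b1 b2 b3 c1 c2 c3 scal; set y := A 1 0 in b1 b2 b3 c1 c2 c3 scal.
set z := A 0 0 - A 1 1 in b1 b2 b3 c1 c2 c3 scal.
move: (B 0 0 - B 1 1) b2 b3 (comm B C) => bz b2 b3.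
move: (C 0 0 - C 1 1) c2 c3 => cz c2 c3; apply.
- have [x0|x0] := eqVneq x 0; last by apply: (@proportional_commute x (B 0 1) (C 0 1) x _ y) => //; lra.
  have [y0|y0] := eqVneq y 0; last by apply: (@proportional_commute y (B 1 0) (C 1 0) x _ y) => //; lra.
  have [z0|z0] := eqVneq z 0; first by case: nA; apply: scal.
  by apply: (@proportional_commute z bz cz x _ y) => //; lra.
- have [x0|x0] := eqVneq x 0; last by apply: (@proportional_commute x (B 0 1) (C 0 1) x _ z) => //; lra.
  have [y0|y0] := eqVneq y 0; last by apply: (@proportional_commute y (B 1 0) (C 1 0) x _ z) => //; lra.
  have [z0|z0] := eqVneq z 0; first by case: nA; apply: scal.
  by apply: (@proportional_commute z bz cz x _ z) => //; lra.
- have [x0|x0] := eqVneq x 0; last by apply: (@proportional_commute x (B 0 1) (C 0 1) y _ z) => //; lra.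
  have [y0|y0] := eqVneq y 0; last by apply: (@proportional_commute y (B 1 0) (C 1 0) y _ z) => //; lra.
  have [z0|z0] := eqVneq z 0; first by case: nA; apply: scal.
  by apply: (@proportional_commute z bz cz y _ z) => //; lra.
Qed.

(** The hypothesis says that the trace is constantly 2; degrees then give 2 |u| = |u|. *)
Lemma free_trivial u : cycred u ->
  (forall t, t != 0 -> (tpoly u).[t] = 2 * t ^+ size u) -> u = [::].
Proof.
move=> cu E; have : tpoly u = 2%:P * 'X^(size u).
  apply/eqP; rewrite -subr_eq0; apply/eqP/poly_eq0_nonzero => t t0.
  by rewrite !hornerE E // subrr.
move/(congr1 (fun p : {poly rat} => size p)); rewrite size_tpoly // size_Cmul // size_polyXn.
by move=> [] h; apply/size0nil; move: h; case: (size u) => // k; lia.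
Qed.

(* At every t where the image of u is not scalar the images of v and w commute. So a
   product of three polynomials in t vanishes: either the trace of u is always 2, or
   always -2, both excluded by the degree, or that of [v, w] is always 2. *)
Lemma free_commute u v w : reduce u <> [::] ->
  reduce (u ++ v) = reduce (v ++ u) -> reduce (u ++ w) = reduce (w ++ u) ->
  reduce (v ++ w) = reduce (w ++ v).
Proof.
move=> un uv uw.
have [u0 [_ cu hu]] := cycred_exists u.
have [k0 [_ ck hk]] := cycred_exists ((v ++ w) ++ winv (w ++ v)).
have u0n : u0 <> [::].
  move=> u00; move: hu; rewrite u00 => /conj_words[g]; rewrite cats0 => E.
  case: un; have := congr1 (fun x => free_of_word x) E.
  move/free_of_wordP: E; rewrite free_of_word_cat -{2}[free_of_word g]mul1g => /mulIg.
  by move/free_of_wordP.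
have tr_conj (t : rat) (x y : word 'I_n) : t != 0 -> conjugate (free_of_word x) (free_of_word y) ->
    \tr (rep (LSL (Bt t)) x) = \tr (rep (LSL (Bt t)) y).
  move=> t0 /conj_words[g /(rep_conj_trace (LSL_inv (fun i => det_Bt i t0))) /= /eqP].
  by rewrite subr_eq0 => /eqP.
pose P := (tpoly k0 - 2%:P * 'X^(size k0)) *
  ((tpoly u0 - 2%:P * 'X^(size u0)) * (tpoly u0 + 2%:P * 'X^(size u0))).
have P0 : P = 0.
  apply: poly_eq0_nonzero => t t0.
  have LI := LSL_inv (fun i : 'I_n => det_Bt i t0).
  have req (x y : word 'I_n) : reduce x = reduce y -> rep (LSL (Bt t)) x = rep (LSL (Bt t)) y.
    by move=> E; have /mcong_zero := rep_eq LI E.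
  have [sc|nsc] := boolP (is_scalar_mx (rep (LSL (Bt (n := n) t)) u)).
    have /is_scalar_mxP[a Ea] := sc.
    (* A scalar matrix of determinant 1 is 1 or -1, so the trace is 2 or -2 and one of the two last
       factors of [P] vanishes at [t]. *)
    have da : a ^+ 2 = 1.
      by rewrite -det_scalar -Ea det_rep // => i; rewrite det_Bt.
    have tu : (tpoly u0).[t] = t ^+ size u0 * (a *+ 2).
      by rewrite horner_tpoly // -(tr_conj _ _ _ t0 hu) Ea mxtrace_scalar.
    have /orP[/eqP a1|/eqP a1] : (a == 1) || (a == -1) by rewrite -sqrf_eq1 da.
      by rewrite /P !(hornerM, hornerD, hornerN, hornerC, hornerXn) tu a1 mulr2n; ring.
    by rewrite /P !(hornerM, hornerD, hornerN, hornerC, hornerXn) tu a1 mulr2n; ring.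
  have com : rep (LSL (Bt (n := n) t)) v * rep (LSL (Bt t)) w =
             rep (LSL (Bt t)) w * rep (LSL (Bt t)) v.
    apply: (@commute_2x2 (rep (LSL (Bt t)) u)).
    - by move=> [a Ea]; move: nsc; rewrite Ea scalar_mx_is_scalar.
    - by rewrite -!rep_cat; apply: req.
    - by rewrite -!rep_cat; apply: req.
  have k2 : \tr (rep (LSL (Bt t)) k0) = 2.
    rewrite -(tr_conj _ _ _ t0 hk) rep_cat.
    have -> : rep (LSL (Bt (n := n) t)) (v ++ w) = rep (LSL (Bt t)) (w ++ v) by rewrite !rep_cat.
    have /mcong_zero -> := rep_winv LI (w ++ v).
    by rewrite mxtrace1.
  by rewrite /P !(hornerM, hornerD, hornerN, hornerC, hornerXn) horner_tpoly // k2; ring.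
move/eqP: P0; rewrite mulf_eq0 => /orP[/eqP E|].
  have k00 : k0 = [::].
    apply: free_trivial => // t t0; apply/eqP; rewrite -subr_eq0.
    by have := congr1 (fun p : {poly rat} => p.[t]) E; rewrite !hornerE => ->.
  move: hk; rewrite k00 => /conj_words[g]; rewrite cats0 => E1.
  move/free_of_wordP: E1; rewrite free_of_word_cat -{2}[free_of_word g]mul1g => /mulIg.
  by rewrite free_of_word_cat free_of_winv => /divg1_eq /free_of_wordP.
have sz (e : {poly rat}) : (size e <= (size u0).+1)%N -> tpoly u0 + e != 0.
  move=> se; rewrite -size_poly_eq0 size_polyDl size_tpoly //.
  by apply: leq_ltn_trans se _; case: (u0) u0n => //= a l _; lia.
have s2 : (size (2%:P * 'X^(size u0) : {poly rat})%R <= (size u0).+1)%N.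
  by rewrite size_Cmul // size_polyXn.
by rewrite mulf_eq0 (negbTE (sz _ s2)) (negbTE (sz _ _)) // size_polyN.
Qed.

End FreeCentralizer.

(** * A bound on the exponent *)

Local Close Scope ring_scope.
Local Open Scope group_scope.

Section NonCentral.
Variables n m : nat.
Let gen := ('I_n + 'I_m)%type.
Implicit Types (u v w : FxZ_word n m).

Lemma expo_count (g : gen) w :
  expo g w = ((count_mem (g, false) w)%:Z - (count_mem (g, true) w)%:Z)%R.
Proof.
elim: w => [|[h b] w IH]; first by rewrite expo_nil subrr.
rewrite expo_cons IH /= !xpair_eqE; case: (h == g) => /=; last by rewrite add0r.
by case: b => /=; rewrite ?add0n; lia.
Qed.

Variables (Phi : {multiplicative FxZ n m -> FxZ n m}).
Variables (us : n.-tuple (FxZ_word n m)) (vs : m.-tuple (FxZ_word n m)).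
Hypothesis rep : represents Phi us vs.
Let f := images us vs.

(** The inverse of the first letter must occur later, since its exponent sum is zero; move the first
    letter there, cancel and induct on the length. *)
Lemma commuting_eval1 (h : gen -> FxZ n m) w :
  (forall g g', h g * h g' = h g' * h g) ->
  (forall g, expo g w = 0%R) -> word_eval h w = 1.
Proof.
move=> hC; have [k] := ubnP (size w); elim: k w => // k IH [|[g b] w] wk E.
  by rewrite /word_eval big_nil.
have cons z a : word_eval h (a :: z) = (if a.2 then (h a.1)^-1 else h a.1) * word_eval h z.
  by rewrite /word_eval big_cons.
have cat z z' : word_eval h (z ++ z') = word_eval h z * word_eval h z'.
  by rewrite /word_eval big_cat.
have comV g1 g2 : (h g1)^-1 * h g2 = h g2 * (h g1)^-1.
  by apply: (mulgI (h g1)); rewrite mulgA mulgV mul1g mulgA hC -mulgA mulgV mulg1.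
have com1 z : h g * word_eval h z = word_eval h z * h g.
  elim: z => [|[g' []] z IHz]; first by rewrite /word_eval big_nil mulg1 mul1g.
    by rewrite cons /= mulgA -comV -mulgA IHz mulgA.
  by rewrite cons /= mulgA hC -mulgA IHz mulgA.
have comV1 z : (h g)^-1 * word_eval h z = word_eval h z * (h g)^-1.
  by apply: (mulgI (h g)); rewrite mulgA mulgV mul1g mulgA com1 -mulgA mulgV mulg1.
have : (g, ~~ b) \in w.
  have := E g; rewrite expo_count /= !xpair_eqE eqxx /= => Eg.
  rewrite -has_pred1 has_count; move: Eg.
  by case: (b) => /=; rewrite ?add0n ?add1n /=;
    move: (count_mem (g, false) w) (count_mem (g, true) w) => c d; lia.
move=> hw; case/splitPr: hw wk E => p q wk E.
rewrite cons cat cons /=.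
have Epq : word_eval h (p ++ q) = 1.
  apply: IH; first by move: wk; rewrite /= !size_cat /= => hh; rewrite -ltnS (leq_trans _ hh) // addnS ltnS.
  move=> g'; have := E g'; rewrite expo_cons !expo_cat expo_cons /=.
  by case: (g == g'); case: (b) => /=; rewrite ?add0r; lia.
rewrite cat in Epq; rewrite mulgA; case: (b) => /=.
  by rewrite comV1 -!mulgA [(h g)^-1 * _]mulgA mulVg mul1g.
by rewrite com1 -!mulgA [h g * _]mulgA mulgV mul1g.
Qed.

(* If some t_j has a non-central image then the whole image of Phi is abelian. *)
Lemma noncentral_images_commute g g' : ~ central f ->
  FxZ_eval (f g) * FxZ_eval (f g') = FxZ_eval (f g') * FxZ_eval (f g).
Proof.
move=> nc.
have [j nj] : exists j, reduce (projF (f (inr j))) <> [::].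
  have [/forallP h|] := boolP [forall j, reduce (projF (f (inr j))) == [::]].
    by case: nc => j; apply/eqP.
  by rewrite negb_forall => /existsP[j /eqP h]; exists j.
(* As t_j is central, its image commutes with the image of [Phi]; the free part of that image is
   non-trivial, so [free_commute] makes all free parts commute. *)
have ctr (x : FxZ n m) : x * FxZ_gen (inr j) = FxZ_gen (inr j) * x.
  case: x => x1 x2; congr (_, _); first by rewrite /= mulg1 mul1g.
  exact: (@addrC 'rV[int]_m).
have cj h : reduce (projF (f (inr j)) ++ projF (f h)) = reduce (projF (f h) ++ projF (f (inr j))).
  apply/free_of_wordP; rewrite !free_of_word_cat -!FxZ_eval1 -!(images_eval rep).
  by rewrite -[_.1 * _.1]/((_ * _).1) -gmulfM -ctr gmulfM.
rewrite -!FxZ_eval_cat; apply/FxZ_eval_inj; split.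
  by rewrite !projF_cat; apply: (free_commute nj).
by move=> l; rewrite !expo_cat addrC.
Qed.

(** [Phi] has abelian image, hence factors through the exponents. *)
Lemma noncentral_eval u w : ~ central f -> (forall g, expo g u = expo g w) ->
  FxZ_eval (wsub f u) = FxZ_eval (wsub f w).
Proof.
move=> nc E.
have ev z : FxZ_eval (wsub f z) = word_eval (fun g => FxZ_eval (f g)) z.
  elim: z => [|[g b] z IH]; first by rewrite /wsub /= /FxZ_eval /word_eval !big_nil.
  rewrite wsub_cons FxZ_eval_cat IH /word_eval big_cons; congr (_ * _).
  by rewrite /wlet /=; case: b; rewrite ?FxZ_eval_winv.
have : FxZ_eval (wsub f (u ++ winv w)) = 1.
  rewrite ev; apply: commuting_eval1 => [g g'|g]; first exact: noncentral_images_commute.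
  by rewrite expo_cat expo_winv E subrr.
rewrite wsub_cat FxZ_eval_cat.
have -> : FxZ_eval (wsub f (winv w)) = (FxZ_eval (wsub f w))^-1.
  by rewrite !(FxZ_eval_wsub rep) FxZ_eval_winv multiplicativeV.
exact: divg1_eq.
Qed.

End NonCentral.

Lemma tau_conj n m tr (u w : FxZ_word n m) : conjugate (FxZ_eval u) (FxZ_eval w) ->
  tau tr u = tau tr w.
Proof.
move=> uw; apply/tau_point => p gp; rewrite /pval; congr (_ + _)%R.
  case: tr => //; have /FxZ_conjP[/conj_words[g E] _] := uw.
  have := rep_conj_trace (LSL_inv gp) E; move=> /= /eqP.
  by rewrite subr_eq0 => /eqP.
by apply: eq_bigr => v _; rewrite (expo_conj uw).
Qed.

Section Bound.
Variables n m : nat.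
Let gen := ('I_n + 'I_m)%type.
Local Notation N := (ncoord n m).
Local Notation M := (idem_exp N).

(** Bounds the lengths after up to [M] applications: the remainder part of the orbit of [wx] and the
    image of [wy] under Phi^M. *)
Definition size_bound s := (s ^ M * s)%N.

(** The truncation degree is the one required by [tau_eq]. The summand [N] is the stabilisation
    threshold, and the last one leaves room for the pigeonhole principle, or for the index N + 2 in
    the non-central case. *)
Definition q_bound s := (@trace_orbit_bound n m (4 * size_bound s).+1 (size_bound s)
  + N + (class_bound n (size_bound s)).+2)%N.

Definition k_bound s := (M * (q_bound s).+1)%N.

Lemma size_wsub (f : gen -> FxZ_word n m) s w : (forall g, size (f g) <= s)%N ->
  (size (wsub f w) <= s * size w)%N.
Proof.
move=> fs; elim: w => [|[g b] w IH]; first by rewrite /wsub /= muln0.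
rewrite wsub_cons size_cat mulnS leq_add // /wlet /=; case: b; rewrite ?size_winv; exact: fs.
Qed.

Lemma size_iter_wsub (f : gen -> FxZ_word n m) s k w : (forall g, size (f g) <= s)%N ->
  (size (iter k (wsub f) w) <= s ^ k * size w)%N.
Proof.
move=> fs; elim: k => [|k IH]; first by rewrite mul1n.
by rewrite iterS expnS -mulnA; apply: leq_trans (size_wsub _ fs) _; rewrite leq_mul2l IH orbT.
Qed.

Variables (Phi : {multiplicative FxZ n m -> FxZ n m}).
Variables (us : n.-tuple (FxZ_word n m)) (vs : m.-tuple (FxZ_word n m)).
Hypothesis rep : represents Phi us vs.
Local Notation f := (images us vs).
Variables (wx wy : FxZ_word n m) (s : nat).
Hypothesis s0 : (0 < s)%N.
Hypothesis fs : forall g, (size (f g) <= s)%N.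
Hypothesis xs : (size wx <= s)%N.
Hypothesis ys : (size wy <= s)%N.

Let P k := conjugate (iter k Phi (FxZ_eval wx)) (FxZ_eval wy).

Lemma descent k : (k_bound s <= k)%N -> P k -> exists2 k', (k' < k)%N & P k'.
Proof.
move=> kb Pk; have M0 : (0 < M)%N := idem_exp_gt0 N.
set q := (k %/ M)%N; set r := (k %% M)%N.
have kE : k = (M * q + r)%N by rewrite mulnC -divn_eq.
have rM : (r < M)%N by rewrite ltn_mod.
have qb : (q_bound s <= q)%N.
  have kq : (k < M * q.+1)%N by rewrite {1}kE mulnS addnC ltn_add2r.
  rewrite -ltnS -(ltn_pmul2l M0); apply: leq_ltn_trans kq; apply: leq_trans kb.
  by rewrite leq_pmul2l.
set x := iter r (wsub f) wx; set S := size_bound s.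
have spow j : (j <= M)%N -> (s ^ j * s <= S)%N.
  by move=> jM; rewrite leq_mul2r leq_pexp2l ?orbT.
have xS : (size x <= S)%N.
  by apply: leq_trans (size_iter_wsub _ _ fs) (leq_trans _ (spow _ (ltnW rM))); rewrite leq_mul2l xs orbT.
have iS : (size (iter M (wsub f) wy) <= S)%N.
  by apply: leq_trans (size_iter_wsub _ _ fs) (leq_trans _ (spow _ (leqnn _))); rewrite leq_mul2l ys orbT.
have sS : (s <= S)%N by have := spow 0%N (leq0n _); rewrite expn0 mul1n.
have z_eval j : FxZ_eval (iter (M * j) (wsub f) x) = iter (M * j + r) Phi (FxZ_eval wx).
  by rewrite /x -iterD (FxZ_eval_iter rep).
have Pq : conjugate (FxZ_eval (iter (M * q) (wsub f) x)) (FxZ_eval wy).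
  by rewrite z_eval -kE.
have shift i j : (i < j)%N -> (j <= q)%N ->
    conjugate (FxZ_eval (iter (M * i) (wsub f) x)) (FxZ_eval (iter (M * j) (wsub f) x)) ->
    exists2 k', (k' < k)%N & P k'.
  move=> ij jq cij; exists (M * (q - (j - i)) + r)%N.
    by rewrite kE ltn_add2r ltn_pmul2l // ltn_subrL; lia.
  apply: conjugate_trans Pq; rewrite z_eval.
  have := conjugate_iter Phi (M * (q - j)) cij; rewrite !z_eval -!iterD !addnA -!mulnDr.
  have -> : (q - j + i = q - (j - i))%N by lia.
  by rewrite subnK.
(* Traces are used only if every t_j goes to the centre; otherwise [subF] would not describe the
   free parts, and only exponents are followed. *)
pose tr := [forall j, reduce (projF (f (inr j))) == [::]].
have cf : tr -> central f by move/forallP => h j; apply/eqP.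
have Ey : tau tr (iter M (wsub f) wy) = tau tr wy.
  have /FxZ_conjP[/conj_words[g Eg] _] := Pq.
  apply: (@tau_eq _ _ _ (4 * S).+1).
  - by rewrite ltnS leq_mul2l iS.
  - by rewrite ltnS leq_mul2l (leq_trans ys sS).
  apply: (tracef_fixed cf (s := S) _ xS _ _ Eg).
  - by move=> g'; apply: leq_trans (fs g') sS.
  - exact: leq_trans ys sS.
  - by apply: leq_trans qb; rewrite /q_bound -addnA leq_addr.
  - exact: expo_conj Pq.
have Ex := tau_conj tr Pq.
have stab := tau_orbit cf Ey Ex.
have qN : (N + (class_bound n S).+2 <= q)%N.
  by apply: leq_trans qb; rewrite /q_bound -addnA leq_addl.
have [Htr|ntr] := boolP tr.
  have Htr' : tr = true := Htr.
  have Ez i : (i < (class_bound n S).+1)%N -> tau true (iter (M * (N + i)) (wsub f) x) = tau true wy.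
    by move=> _; rewrite -Htr'; apply: stab; rewrite leq_addr.
  have [i [j [ij jK cij]]] := finite_fibres (leq_trans ys sS) (ltnSn _) Ez.
  by apply: (shift _ _ _ _ cij); lia.
have nc : ~ central f.
  by move=> h; move/negP: ntr; apply; apply/forallP => j; apply/eqP.
apply: (shift N.+1 N.+2) => //; first by lia.
(* From [N] on the exponents are constant; one application of [Phi] turns equal exponents into equal
   elements. *)
have E1 : FxZ_eval (wsub f (iter (M * N) (wsub f) x)) =
          FxZ_eval (wsub f (iter (M * N.+1) (wsub f) x)).
  apply: (noncentral_eval rep nc) => g.
  by apply: (tau_expo (tr := tr)); rewrite !stab.
have E2 : FxZ_eval (iter (M * N.+1) (wsub f) x) = FxZ_eval (iter (M * N.+2) (wsub f) x).
  have step j : iter (M * j.+1) (wsub f) x = iter M.-1 (wsub f) (wsub f (iter (M * j) (wsub f) x)).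
    by rewrite -iterSr prednK // -iterD -mulnS.
  by rewrite [in LHS]step [in RHS]step !(FxZ_eval_iter rep) E1.
rewrite E2; exact: conjugate_refl.
Qed.

Theorem bounded_exponent : (exists k, P k) -> exists2 k, (k <= k_bound s)%N & P k.
Proof.
move=> [k]; have [l] := ubnP k; elim: l k => // l IH k kl Pk.
have [kb|kb] := leqP k (k_bound s); first by exists k.
have [k' k'k Pk'] := descent (ltnW kb) Pk.
by apply: IH Pk'; apply: leq_trans k'k _.
Qed.

End Bound.

(** * Short conjugators *)

Section Rotation.
Variable T : choiceType.
Implicit Types (u v g : word T).

Lemma reduce_size_eq u : size (reduce u) = size u -> reduce u = u.
Proof.
elim: u => [//|a u IH] /=; rewrite /push -/(reduce u).
have := size_reduce u; case E1: (reduce u) IH => [|b v] IH /=.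
  by move=> _ [] /esym/size0nil ->.
case: eqP => [_ /= h1 h2|_ /= _ [] h1]; first by move: h1 h2; lia.
by rewrite IH //= h1.
Qed.

Lemma cycred_reduced u : cycred u -> reduced u.
Proof. by case: u => // a u; rewrite /cycred /= rcons_path => /andP[]. Qed.

Lemma cycred_rot i u : cycred (rot i u) = cycred u.
Proof. exact: rot_cycle. Qed.

Lemma reduced_cat u v : reduced u -> reduced v ->
  reduced (u ++ v) \/ exists u' a v', u = rcons u' a /\ v = linv a :: v'.
Proof.
case: (lastP u) => [|u' a]; first by left.
case: v => [|b v']; first by rewrite cats0; left.
move=> ru rv; have [E|nE] := eqVneq b (linv a); last left.
  by right; exists u', a, v'; rewrite E.
move: ru; rewrite /reduced; case: u' => [|c u'] /=; first by rewrite nE.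
by rewrite cat_path rcons_path last_rcons /= nE => /andP[-> ->].
Qed.

Lemma cat_cancel u a v : reduce (rcons u a ++ linv a :: v) = reduce (u ++ v).
Proof.
rewrite -cats1 -catA -reduce_catr (_ : reduce ([:: a] ++ linv a :: v) = reduce v) ?reduce_catr //.
have := pushK (linv a) (reduce_reduced v); rewrite linvK.
by rewrite /reduce.
Qed.

(** Induction on [g]. If [u ++ g] cancels, rotate [u] by one letter and shorten [g]. Otherwise
    comparing lengths gives [u ++ g = g ++ v] as words: either [g] is a proper prefix of [u] and the
    rotation is found, or [u] is a prefix of [g] and is stripped off. *)
Lemma rotation_conj u v g : cycred u -> cycred v -> size u = size v -> reduced g ->
  reduce (u ++ g) = reduce (g ++ v) -> exists i, v = rot i u.
Proof.
have [k] := ubnP (size g); elim: k u g => // k IH u g gk cu cv suv rg E.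
have [ru|[u' [a [g' [Eu Eg]]]]] := reduced_cat (cycred_reduced cu) rg; last first.
  have cu' : cycred (a :: u').
    by rewrite -(cycred_rot 1) rot1_cons -Eu.
  have gk' : (size g' < k)%N by move: gk; rewrite Eg.
  have [|||i ->] := IH (a :: u') g' gk' cu' cv.
  - by rewrite -suv Eu size_rcons.
  - by move: rg; rewrite Eg /reduced /=; apply: path_sorted.
  - move: E; rewrite Eu Eg cat_cancel => E.
    have h1 : reduce (a :: reduce (u' ++ g')) = reduce ((a :: u') ++ g').
      by rewrite -[a :: reduce _]cat1s reduce_catr.
    have h2 : reduce (a :: reduce ((linv a :: g') ++ v)) = reduce (g' ++ v).
      by rewrite -[a :: reduce _]cat1s reduce_catr; apply: (cat_cancel [::] a (g' ++ v)).
    by apply: (etrans (esym h1)); apply: (etrans _ h2); rewrite E.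
  have Er : a :: u' = rotr 1 u by rewrite Eu rotr1_rcons.
  have [iu|ui] := leqP i (size u).
    rewrite Er /rotr; exists (if i + (size u - 1) <= size u then i + (size u - 1) else i + (size u - 1) - size u)%N.
    by rewrite rot_add_mod // leq_subr.
  by exists (size u - 1)%N; rewrite rot_oversize ?Er ?size_rotr // ltnW.
have Eg : u ++ g = g ++ v.
  rewrite -(reduce_id ru) E; apply: reduce_size_eq.
  by rewrite -E reduce_id // !size_cat suv addnC.
have [gu|ug] := ltnP (size g) (size u).
  exists (size g).
  have Et : take (size g) u = g.
    by have := congr1 (take (size g)) Eg; rewrite [RHS]take_size_cat // takel_cat // ltnW.
  have := congr1 (drop (size g)) Eg; rewrite [RHS]drop_size_cat // drop_cat gu => <-.
  by rewrite /rot Et.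
have Et : take (size u) g = u.
  by have := congr1 (take (size u)) Eg; rewrite [LHS]take_size_cat // takel_cat.
have gE : g = u ++ drop (size u) g by rewrite -{1}(cat_take_drop (size u) g) Et.
have [u0|u0] := posnP (size u).
  by exists 0%N; rewrite rot0 (size0nil u0); apply: size0nil; rewrite -suv.
apply: (IH u (drop (size u) g)) => //.
- by rewrite size_drop; move: gk; lia.
- move: rg; rewrite {1}gE /reduced; case: (u) => [//|b w] /=.
  by rewrite cat_path => /andP[_]; case: (drop _ _) => // c l /= /andP[].
- by move: Eg; rewrite {1 2}gE -catA => /eqP; rewrite eqseq_cat // eqxx /= => /eqP ->.
Qed.

Lemma cycred_conjugator u : exists u0 p, [/\ (size p <= size u)%N, (size u0 <= size u)%N,
  cycred u0 & reduce (u ++ p) = reduce (p ++ u0)].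
Proof.
have [k] := ubnP (size u); elim: k u => // k IH w wk.
have [cr|] := boolP (cycred (reduce w)).
  exists (reduce w), [::]; split=> //; first exact: size_reduce.
  by rewrite cats0 cat0s (reduce_id (reduce_reduced w)).
have := reduce_reduced w; have := size_reduce w.
have Er v : reduce (w ++ v) = reduce (reduce w ++ v) by rewrite reduce_catl.
case: (reduce w) Er => [//|a r] Er rw rr; rewrite /cycred /= rcons_path negb_and.
rewrite /reduced /= in rr; rewrite rr /= negbK => /eqP E.
case: (lastP r) E rr rw Er => [|v b] E rr rw Er.
  by move/eqP: E; rewrite (negbTE (linv_neq a)).
rewrite last_rcons in E; rewrite /= size_rcons in rw.
have [|u0 [p [sp su cu h]]] := IH v.
  by rewrite -ltnS (leq_trans _ wk) // ltnS (leq_trans _ rw).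
exists u0, (linv b :: p); split=> //=.
- by apply: leq_trans rw; rewrite ltnS (leq_trans sp).
- by apply: leq_trans su (leq_trans _ rw); rewrite -addn2 leq_addr.
rewrite Er E -rcons_cons; have := cat_cancel (linv b :: v) b p; rewrite /= => ->.
by rewrite /reduce /= -/(reduce (v ++ p)) -/(reduce (p ++ u0)) h.
Qed.

End Rotation.

(** Compose a conjugator from [u] to its cyclic reduction, a prefix of the latter realising a
    rotation, and the inverse of a conjugator for [v]. *)
Lemma short_conjugator n (u v : word 'I_n) : conjugate (free_of_word u) (free_of_word v) ->
  exists g, (size g <= 2 * size u + size v)%N /\ reduce (u ++ g) = reduce (g ++ v).
Proof.
have [u0 [p [sp su cu hp]]] := cycred_conjugator u.
have [v0 [r [sr sv cv hr]]] := cycred_conjugator v.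
have cju : conjugate (free_of_word u) (free_of_word u0) by apply/conj_words; exists p.
have cjv : conjugate (free_of_word v) (free_of_word v0) by apply/conj_words; exists r.
move=> cuv; have cuv0 : conjugate (free_of_word u0) (free_of_word v0).
  by apply: conjugate_trans (conjugate_sym cju) (conjugate_trans cuv cjv).
have /conj_words[g] := cuv0.
rewrite -[in RHS]reduce_catl -[in LHS]reduce_catr => Eg.
have suv : size u0 = size v0.
  apply: cycred_size => // t t0.
  have gp : forall i : 'I_n, (\det (Bt t i) = 1)%R by move=> i; exact: det_Bt.
  have /conj_words[h /(rep_conj_trace (LSL_inv gp)) /= /eqP] := cuv0.
  by rewrite subr_eq0 => /eqP.
have [i Ei] := rotation_conj cu cv suv (reduce_reduced g) Eg.
exists (p ++ take i u0 ++ winv r); split.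
  have h : (size (take i u0) <= size u0)%N by rewrite size_take_min geq_minr.
  rewrite !size_cat size_winv mul2n -addnn -addnA; apply: leq_add => //.
  by apply: leq_add => //; apply: leq_trans h su.
have E (x y : word 'I_n) : reduce x = reduce y <-> free_of_word x = free_of_word y.
  by split=> /free_of_wordP.
move: hp hr => /E hp /E hr; apply/E; rewrite !free_of_word_cat in hp hr *.
have ht : free_of_word u0 * free_of_word (take i u0) = free_of_word (take i u0) * free_of_word v0.
  by rewrite Ei /rot free_of_word_cat mulgA -[X in _ = X * _]free_of_word_cat cat_take_drop.
rewrite !mulgA hp -[_ * _ * free_of_word (take i u0)]mulgA ht -!mulgA; congr (_ * (_ * _)).
rewrite free_of_winv; apply: (mulIg (free_of_word r)); rewrite -!mulgA mulVg mulg1.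
by rewrite hr mulgA mulVg mul1g.
Qed.

(** * Elementary bounds *)

Local Close Scope group_scope.

Definition tower h x := iter h (expn 2) x.

(** The program has to compute its search bound. A tower of constant height is easily programmed,
    and this class is closed under all operations that occur in the bounds. *)
Definition elementary (f : nat -> nat) := exists h, forall s, f s <= tower h (s + h).

Lemma leq_exp2 x : x <= 2 ^ x. Proof. exact: ltnW (ltn_expl x (ltnSn 1)). Qed.

Lemma leq_tower h x y : x <= y -> tower h x <= tower h y.
Proof. by move=> xy; elim: h => //= h IH; rewrite leq_exp2l. Qed.

Lemma tower_mono h h' x : h <= h' -> tower h x <= tower h' x.
Proof.
by move=> /subnK <-; elim: (_ - _) => //= k IH; apply: leq_trans IH (leq_exp2 _).
Qed.

Lemma tower_raise h h' s : h <= h' -> tower h (s + h) <= tower h' (s + h').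
Proof.
move=> hh; apply: leq_trans (tower_mono _ hh); apply: leq_tower; by rewrite leq_add2l.
Qed.

Section Closure.
Implicit Types f g : nat -> nat.

Lemma elementary_le f g : (forall s, f s <= g s) -> elementary g -> elementary f.
Proof. by move=> fg [h H]; exists h => s; apply: leq_trans (fg s) (H s). Qed.

Lemma elementary_id : elementary id.
Proof. by exists 0 => s; rewrite addn0. Qed.

Lemma elementary_const c : elementary (fun=> c).
Proof.
exists c => s; apply: (@leq_trans (s + c)); first exact: leq_addl.
exact: (@tower_mono 0).
Qed.

Lemma elementary_pow2 f : elementary f -> elementary (fun s => 2 ^ f s).
Proof.
move=> [h H]; exists h.+1 => s.
apply: (@leq_trans (2 ^ tower h (s + h))); first by rewrite leq_exp2l.
by rewrite /tower iterS leq_exp2l // leq_tower // leq_add2l.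
Qed.

Lemma elementary_common f g : elementary f -> elementary g ->
  exists h, forall s, f s <= tower h (s + h) /\ g s <= tower h (s + h).
Proof.
move=> [h1 H1] [h2 H2]; exists (maxn h1 h2) => s; split.
  by apply: leq_trans (H1 s) (tower_raise _ (leq_maxl _ _)).
by apply: leq_trans (H2 s) (tower_raise _ (leq_maxr _ _)).
Qed.

Lemma elementary_max f g : elementary f -> elementary g ->
  elementary (fun s => maxn (f s) (g s)).
Proof.
move=> ef eg; have [h H] := elementary_common ef eg; exists h => s.
by have [h1 h2] := H s; rewrite geq_max h1.
Qed.

Lemma elementaryD f g : elementary f -> elementary g -> elementary (fun s => f s + g s).
Proof.
move=> ef eg; apply: (elementary_le _ (elementary_pow2 (elementary_max ef eg))) => s.
apply: (@leq_trans (2 * maxn (f s) (g s))).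
  by rewrite mul2n -addnn leq_add // ?leq_maxl ?leq_maxr.
case: (maxn _ _) => // k; rewrite expnS leq_mul //; exact: ltn_expl.
Qed.

Lemma elementaryM f g : elementary f -> elementary g -> elementary (fun s => f s * g s).
Proof.
move=> ef eg.
apply: (elementary_le _ (elementary_pow2 (elementaryD ef eg))) => s.
by rewrite expnD leq_mul // leq_exp2.
Qed.

Lemma elementaryX f g : elementary f -> elementary g -> elementary (fun s => f s ^ g s).
Proof.
move=> ef eg; apply: (elementary_le _ (elementary_pow2 (elementaryM ef eg))) => s.
rewrite expnM; case: (g s) => // k; by rewrite leq_exp2r ?leq_exp2.
Qed.

Lemma elementaryS f : elementary f -> elementary (fun s => (f s).+1).
Proof.
move=> ef; apply: (elementary_le _ (elementaryD ef (elementary_const 1))) => s.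
by rewrite addn1.
Qed.

Lemma elementary_fact f : elementary f -> elementary (fun s => (f s)`!).
Proof.
move=> ef; apply: (elementary_le _ (elementaryX ef ef)) => s.
elim: (f s) => // k IH; rewrite factS expnS leq_mul //.
by apply: leq_trans IH _; case: k => // k; rewrite leq_exp2r.
Qed.

End Closure.

(* Syntactic matching, since unification would unfold the operations of nat. *)
Ltac elementary := repeat first
  [ assumption | exact: elementary_id | exact: elementary_const
  | lazymatch goal with
    | |- elementary (fun s => _ ^ _) => apply: elementaryX
    | |- elementary (fun s => _ * _) => apply: elementaryM
    | |- elementary (fun s => _ + _) => apply: elementaryD
    | |- elementary (fun s => _`!) => apply: elementary_fact
    | |- elementary (fun s => _.+1) => apply: elementaryS
    end ].

Lemma elementary_orbit_bound d h : elementary d -> elementary h ->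
  elementary (fun s => orbit_bound (d s) (h s)).
Proof.
move=> ed eh; rewrite /orbit_bound /kron_bound /gamma_bound; elementary.
Qed.

Lemma elementary_k_bound n m : elementary (k_bound n m).
Proof.
have es : elementary (size_bound n m) by rewrite /size_bound; elementary.
have ec : elementary (fun s => (4 * size_bound n m s).+1) by elementary.
have eh : elementary (fun s => trace_height n m (4 * size_bound n m s).+1 (size_bound n m s)).
  by rewrite /trace_height /letter_height; elementary.
(* The truncation degree depends on [s], so the cardinal is replaced by its closed bound; [idem_exp]
   depends on n and m only and is a constant. *)
have en : elementary (fun s => nmon (ncoord n m) (4 * size_bound n m s).+1).
  apply: (@elementary_le _ (fun s => (4 * size_bound n m s).+2 ^ ncoord n m)); last by elementary.
  by move=> s; apply: leq_trans (nmon_le _ _).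
rewrite /k_bound /q_bound /trace_orbit_bound /poly_orbit_bound /class_bound; elementary.
apply: elementary_orbit_bound => //; elementary.
Qed.

Lemma size_code l : size l <= CodeSeq.code l.
Proof.
elim: l => //= a l IH; apply: (@leq_trans (1 * (CodeSeq.code l).*2.+1)).
  by rewrite mul1n ltnS -addnn; apply: leq_trans IH (leq_addr _ _).
by rewrite leq_mul2r expn_gt0.
Qed.

Lemma code_bound L l : all (fun a => a < L) l -> CodeSeq.code l < 2 ^ (L * size l).
Proof.
elim: l => [|a l IH] /=; first by rewrite muln0.
case/andP=> aL /IH h; rewrite (mulnS L).
apply: (@leq_trans (2 ^ a.+1 * 2 ^ (L * size l))); last first.
  by rewrite -expnD leq_exp2l // leq_add2r.
rewrite expnSr -mulnA ltn_pmul2l ?expn_gt0 //; move: h; lia.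
Qed.

(** Bounds the code of a conjugator: letter codes are below 2n, and the length is that of
    [short_conjugator] for words of length at most s^k s and s. *)
Definition conjugator_bound n m s := 2 ^ (n.*2 * (2 * (s ^ k_bound n m s * s) + s)).

Lemma elementary_search n m :
  elementary (fun s => k_bound n m s + conjugator_bound n m s).
Proof.
have ek := elementary_k_bound n m.
by rewrite /conjugator_bound; elementary.
Qed.

(** * Recursive functions *)

Definition recursive k (F : k.-tuple nat -> nat) :=
  exists A : recfun k, forall s, computes A s (F s).

Section Recursive.
Variable k : nat.
Implicit Types F G N B : k.-tuple nat -> nat.

Lemma recursive_ext F G : (forall s, F s = G s) -> recursive F -> recursive G.
Proof. by move=> FG [A cA]; exists A => s; rewrite -FG. Qed.

Lemma recursive_proj (i : 'I_k) : recursive (fun s => tnth s i).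
Proof. by exists (RProj i). Qed.

Lemma recursive_comp l (F : l.-tuple nat -> nat) (Gs : 'I_l -> k.-tuple nat -> nat) :
  recursive F -> (forall i, recursive (Gs i)) -> recursive (fun s => F [tuple Gs i s | i < l]).
Proof.
move=> [A cA] /fin_all_exists[Bs cB]; exists (RComp A Bs) => s.
by exists [tuple Gs i s | i < l] => // i; rewrite tnth_mktuple.
Qed.

Lemma recursive0 : recursive (fun _ : k.-tuple nat => 0).
Proof.
have Bs : 'I_0 -> recfun k by case.
by exists (RComp RZero Bs) => s; exists [tuple] => // -[].
Qed.

Lemma recursiveS F : recursive F -> recursive (fun s => (F s).+1).
Proof.
move=> [A cA]; exists (RComp RSucc (fun=> A)) => s.
by exists [tuple F s] => // i; rewrite (tnth_nth 0) ord1.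
Qed.

Lemma recursive_const c : recursive (fun _ : k.-tuple nat => c).
Proof. elim: c => [|c]; [exact: recursive0 | exact: recursiveS]. Qed.

End Recursive.

Definition recursive_map k l (T : k.-tuple nat -> l.-tuple nat) :=
  forall i, recursive (fun s => tnth (T s) i).

Lemma recursive_map_cons k l X (T : k.-tuple nat -> l.-tuple nat) :
  recursive X -> recursive_map T -> recursive_map (fun s => [tuple of X s :: T s]).
Proof.
move=> rX rT i; case: (unliftP ord0 i) => [j|] ->.
  by apply: recursive_ext (rT j) => s; rewrite tnthS.
by apply: recursive_ext rX => s; rewrite tnth0.
Qed.

Lemma recursive_map_id k : recursive_map (fun s : k.-tuple nat => s).
Proof. by move=> i; exact: recursive_proj. Qed.

Lemma recursive_map_behead k l (T : k.-tuple nat -> l.+1.-tuple nat) :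
  recursive_map T -> recursive_map (fun s => behead_tuple (T s)).
Proof. by move=> rT i; apply: recursive_ext (rT (inord i.+1)) => s; rewrite tnth_behead. Qed.

Lemma recursive_subst k l F (T : k.-tuple nat -> l.-tuple nat) :
  recursive F -> recursive_map T -> recursive (fun s => F (T s)).
Proof.
move=> rF rT; apply: recursive_ext (recursive_comp rF rT) => s; congr F.
by apply: eq_from_tnth => i; rewrite tnth_mktuple.
Qed.

Lemma recursive_weaken k (F : k.-tuple nat -> nat) :
  recursive F -> recursive (fun s : k.+1.-tuple nat => F (behead_tuple s)).
Proof.
by move=> rF; apply: recursive_subst rF _; apply: recursive_map_behead; exact: recursive_map_id.
Qed.

Lemma recursive_head k : recursive (fun s : k.+1.-tuple nat => thead s).
Proof. exact: recursive_proj. Qed.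

Lemma behead_cons k (x : nat) (s : k.-tuple nat) : behead_tuple [tuple of x :: s] = s.
Proof. exact: val_inj. Qed.

(* In the step S the two leading entries of the tuple hold the index and the previous value. *)
Lemma recursive_nat_rec k (N B : k.-tuple nat -> nat) (S : nat -> nat -> k.-tuple nat -> nat) :
  recursive N -> recursive B ->
  recursive (fun s : k.+2.-tuple nat =>
    S (thead s) (thead (behead_tuple s)) (behead_tuple (behead_tuple s))) ->
  recursive (fun s => nat_rec (fun=> nat) (B s) (fun i v => S i v s) (N s)).
Proof.
move=> rN [A cA] [C cC].
pose F (s : k.+1.-tuple nat) :=
  nat_rec (fun=> nat) (B (behead_tuple s)) (fun i v => S i v (behead_tuple s)) (thead s).
have rF : recursive F.
  exists (RPrec A C) => s /=; rewrite /F; elim: (thead s) => [|i IH] /=; first exact: cA.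
  eexists; first exact: IH.
  set w := nat_rec _ _ _ i.
  have := cC [tuple of i :: w :: behead_tuple s].
  by rewrite behead_cons !theadE behead_cons.
apply: recursive_ext (recursive_subst rF (recursive_map_cons rN (@recursive_map_id _))) => s; rewrite /F theadE.
by rewrite behead_cons.
Qed.

Lemma recursive_iter k (N B : k.-tuple nat -> nat) (S : nat -> k.-tuple nat -> nat) :
  recursive N -> recursive B ->
  recursive (fun s : k.+2.-tuple nat => S (thead (behead_tuple s)) (behead_tuple (behead_tuple s))) ->
  recursive (fun s => iter (N s) (fun v => S v s) (B s)).
Proof.
move=> rN rB rS; apply: recursive_ext (recursive_nat_rec rN rB (S := fun _ => S) rS) => s.
by elim: (N s) => //= i ->.
Qed.

Lemma recursive_prev k : recursive (fun s : k.+2.-tuple nat => thead (behead_tuple s)).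
Proof. exact: (recursive_weaken (@recursive_head k)). Qed.

Lemma recursive_weaken2 k (F : k.-tuple nat -> nat) : recursive F ->
  recursive (fun s : k.+2.-tuple nat => F (behead_tuple (behead_tuple s))).
Proof. by move=> rF; exact: (recursive_weaken (recursive_weaken rF)). Qed.

Lemma recursiveD k (F G : k.-tuple nat -> nat) : recursive F -> recursive G -> recursive (fun s => F s + G s).
Proof.
move=> rF rG; apply: recursive_ext (recursive_iter (S := fun v _ => v.+1) rG rF _) => [s|].
  by rewrite iter_succn.
exact: recursiveS (@recursive_prev _).
Qed.

Lemma recursiveM k (F G : k.-tuple nat -> nat) : recursive F -> recursive G -> recursive (fun s => F s * G s).
Proof.
move=> rF rG.
apply: recursive_ext (recursive_iter (S := fun v s => F s + v) rG (recursive_const _ 0) _) => [s|].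
  by rewrite iter_addn addn0.
by apply: recursiveD; [exact: recursive_weaken2|exact: recursive_prev].
Qed.

Lemma recursiveX k (F G : k.-tuple nat -> nat) : recursive F -> recursive G -> recursive (fun s => F s ^ G s).
Proof.
move=> rF rG.
apply: recursive_ext (recursive_iter (S := fun v s => F s * v) rG (recursive_const _ 1) _) => [s|].
  by rewrite iter_muln_1.
by apply: recursiveM; [exact: recursive_weaken2|exact: recursive_prev].
Qed.

Lemma recursive_pred k (F : k.-tuple nat -> nat) : recursive F -> recursive (fun s => (F s).-1).
Proof.
move=> rF.
apply: recursive_ext (recursive_nat_rec (S := fun i _ _ => i) rF (recursive_const _ 0) _) => [s|].
  by case: (F s).
exact: recursive_head.
Qed.

Lemma recursiveB k (F G : k.-tuple nat -> nat) : recursive F -> recursive G -> recursive (fun s => F s - G s).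
Proof.
move=> rF rG; apply: recursive_ext (recursive_iter (S := fun v _ => v.-1) rG rF _) => [s|].
  exact: iter_predn.
exact: recursive_pred (@recursive_prev _).
Qed.

Lemma recursive_negb k (b : k.-tuple nat -> bool) :
  recursive (fun s => b s : nat) -> recursive (fun s => ~~ b s : nat).
Proof.
move=> rb; apply: recursive_ext (recursiveB (recursive_const _ 1) rb) => s; by case: (b s).
Qed.

Lemma recursive_andb k (b c : k.-tuple nat -> bool) :
  recursive (fun s => b s : nat) -> recursive (fun s => c s : nat) ->
  recursive (fun s => b s && c s : nat).
Proof. by move=> rb rc; apply: recursive_ext (recursiveM rb rc) => s; rewrite mulnb. Qed.

Lemma recursive_leq k (F G : k.-tuple nat -> nat) : recursive F -> recursive G -> recursive (fun s => F s <= G s : nat).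
Proof.
move=> rF rG; apply: recursive_ext (recursiveB (recursive_const _ 1) (recursiveB rF rG)) => s.
by rewrite /leq; case: (F s - G s).
Qed.

Lemma recursive_eqn k (F G : k.-tuple nat -> nat) : recursive F -> recursive G -> recursive (fun s => F s == G s : nat).
Proof.
move=> rF rG; apply: recursive_ext (recursive_andb (recursive_leq rF rG) (recursive_leq rG rF)) => s.
by rewrite eqn_leq.
Qed.

Lemma recursive_if k (b : k.-tuple nat -> bool) (F G : k.-tuple nat -> nat) :
  recursive (fun s => b s : nat) -> recursive F -> recursive G ->
  recursive (fun s => if b s then F s else G s).
Proof.
move=> rb rF rG.
apply: recursive_ext (recursiveD (recursiveM rb rF) (recursiveM (recursive_negb rb) rG)) => s.
by case: (b s); rewrite ?mul1n ?mul0n ?addn0.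
Qed.

Lemma recursive_odd k (F : k.-tuple nat -> nat) : recursive F -> recursive (fun s => odd (F s) : nat).
Proof.
move=> rF; apply: recursive_ext
  (recursive_iter (S := fun v _ => 1 - v) rF (recursive_const _ 0) _) => [s|].
  by elim: (F s) => //= i ->; case: (odd i).
apply: recursiveB (recursive_const _ 1) _; exact: recursive_prev.
Qed.

Lemma recursive_half k (F : k.-tuple nat -> nat) : recursive F -> recursive (fun s => (F s)./2).
Proof.
move=> rF; apply: recursive_ext
  (recursive_nat_rec (S := fun i v _ => odd i + v) rF (recursive_const _ 0) _) => [s|].
  by elim: (F s) => //= i ->; rewrite uphalf_half.
apply: recursiveD; [exact: recursive_odd (@recursive_head _) | exact: recursive_prev].
Qed.

(* The step has the shape of a primitive recursion step whose previous value is ignored. *)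
Lemma recursive_sum k (N : k.-tuple nat -> nat) (F : nat -> k.-tuple nat -> nat) : recursive N ->
  recursive (fun s : k.+2.-tuple nat => F (thead s) (behead_tuple (behead_tuple s))) ->
  recursive (fun s => \sum_(i < N s) F i s).
Proof.
move=> rN rF; apply: recursive_ext
  (recursive_nat_rec (S := fun i v s => v + F i s) rN (recursive_const _ 0) _) => [s|].
  by elim: (N s) => [|i IH]; rewrite ?big_ord0 // big_ord_recr /= IH.
apply: recursiveD => //; exact: recursive_prev.
Qed.

Lemma recursive_exists k (N : k.-tuple nat -> nat) (P : nat -> k.-tuple nat -> bool) :
  recursive N ->
  recursive (fun s : k.+2.-tuple nat => P (thead s) (behead_tuple (behead_tuple s)) : nat) ->
  recursive (fun s => [exists i : 'I_(N s), P i s] : nat).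
Proof.
move=> rN rP; apply: recursive_ext
  (recursive_leq (recursive_const _ 1) (recursive_sum (F := fun i s => P i s : nat) rN rP)) => s.
congr nat_of_bool; apply/idP/existsP => [|[i Pi]]; last by rewrite (bigD1 i) //= Pi.
rewrite lt0n sum_nat_eq0 negb_forall => /existsP[i /=]; rewrite eqb0 negbK; by exists i.
Qed.

Lemma sum_delta N i0 (F : nat -> nat) (P : pred nat) : i0 < N ->
  (forall i, P i = (i == i0)) -> \sum_(i < N) F i * P i = F i0.
Proof.
move=> lt Pi; rewrite (bigD1 (Ordinal lt)) //= big1 => [|i ne].
  by rewrite Pi eqxx muln1 addn0.
rewrite Pi; have [E|_] := eqVneq (i : nat) i0; last by rewrite muln0.
by case/eqP: ne; apply: val_inj.
Qed.

(** * Primitive recursion on coded lists *)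

Local Notation code := CodeSeq.code.
Local Notation decode := CodeSeq.decode.

Definition code_cons h t := 2 ^ h * t.*2.+1.
(** Decoding by bounded search: at most one term of the sum is non-zero, and head and tail are below
    the code. The empty list, of code 0, gives 0. *)
Definition code_head c := \sum_(h < c) h * [exists t : 'I_c, code_cons h t == c].
Definition code_behead c := \sum_(t < c) t * [exists h : 'I_c, code_cons h t == c].

Lemma code_cons_inj a l h t : (code_cons h t == code (a :: l)) = (h == a) && (t == code l).
Proof.
have -> : code_cons h t = code (h :: decode t) by rewrite /= CodeSeq.decodeK.
rewrite (inj_eq (can_inj CodeSeq.codeK)) eqseq_cons; congr (_ && _).
by rewrite -(inj_eq (can_inj CodeSeq.codeK)) CodeSeq.decodeK.
Qed.

Lemma code_cons_gt a l : a < code (a :: l) /\ code l < code (a :: l).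
Proof.
split; rewrite /=.
  by apply: leq_trans (ltn_expl a (ltnSn 1)) _; rewrite leq_pmulr.
apply: (@leq_trans (1 * (code l).*2.+1)); first by rewrite mul1n ltnS -addnn leq_addr.
by rewrite leq_mul2r expn_gt0.
Qed.

Lemma code_headE l : code_head (code l) = head 0 l.
Proof.
case: l => [|a l]; first by rewrite /code_head big_ord0.
have [ha hl] := code_cons_gt a l; apply: (@sum_delta _ _ id
  (fun h => [exists t : 'I_(code (a :: l)), code_cons h t == code (a :: l)]) ha) => h.
apply/existsP/eqP => [[t]|->]; first by rewrite code_cons_inj => /andP[/eqP].
by exists (Ordinal hl); rewrite code_cons_inj !eqxx.
Qed.

Lemma code_beheadE l : code_behead (code l) = code (behead l).
Proof.
case: l => [|a l]; first by rewrite /code_behead big_ord0.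
have [ha hl] := code_cons_gt a l; apply: (@sum_delta _ _ id
  (fun t => [exists h : 'I_(code (a :: l)), code_cons h t == code (a :: l)]) hl) => t.
apply/existsP/eqP => [[h]|->]; first by rewrite code_cons_inj => /andP[_ /eqP].
by exists (Ordinal ha); rewrite code_cons_inj !eqxx.
Qed.

Definition recursive_seq k (L : k.-tuple nat -> seq nat) := recursive (fun s => code (L s)).

Section RecursiveSeq.
Implicit Types k : nat.

Lemma recursive_seq_ext k (L M : k.-tuple nat -> seq nat) :
  (forall s, L s = M s) -> recursive_seq L -> recursive_seq M.
Proof. by move=> LM; apply: recursive_ext => s; rewrite LM. Qed.

Lemma recursive_seq_weaken k (L : k.-tuple nat -> seq nat) : recursive_seq L ->
  recursive_seq (fun s : k.+2.-tuple nat => L (behead_tuple (behead_tuple s))).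
Proof. exact: recursive_weaken2. Qed.

Lemma recursive_decode k (N : k.-tuple nat -> nat) :
  recursive N -> recursive_seq (fun s => decode (N s)).
Proof. by apply: recursive_ext => s; rewrite CodeSeq.decodeK. Qed.

Lemma recursive_code_cons k (F G : k.-tuple nat -> nat) :
  recursive F -> recursive G -> recursive (fun s => code_cons (F s) (G s)).
Proof.
move=> rF rG; apply: recursiveM; first exact: recursiveX (recursive_const _ 2) rF.
apply: recursive_ext (recursiveS (recursiveD rG rG)) => s; by rewrite addnn.
Qed.

Lemma recursive_nil k : recursive_seq (fun _ : k.-tuple nat => [::]).
Proof. exact: recursive_const. Qed.

Lemma recursive_cons k (F : k.-tuple nat -> nat) L :
  recursive F -> recursive_seq L -> recursive_seq (fun s => F s :: L s).
Proof. exact: recursive_code_cons. Qed.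

Lemma recursive_shead k (L : k.-tuple nat -> seq nat) :
  recursive_seq L -> recursive (fun s => head 0 (L s)).
Proof.
move=> rL; apply: recursive_ext (_ : recursive (fun s => code_head (code (L s)))) => [s|].
  exact: code_headE.
have rL2 := recursive_weaken2 rL; have rL4 := recursive_weaken2 rL2.
apply: (recursive_sum (F := fun h s => h * [exists t : 'I_(code (L s)), code_cons h t == code (L s)]) rL).
apply: recursiveM; first exact: recursive_head.
apply: (recursive_exists (P := fun t (s : k.+2.-tuple nat) =>
  code_cons (thead s) t == code (L (behead_tuple (behead_tuple s)))) rL2).
apply: recursive_eqn => //; apply: recursive_code_cons; last exact: recursive_head.
exact: recursive_weaken2 (@recursive_head _).
Qed.

Lemma recursive_behead k (L : k.-tuple nat -> seq nat) :
  recursive_seq L -> recursive_seq (fun s => behead (L s)).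
Proof.
move=> rL; apply: recursive_ext (_ : recursive (fun s => code_behead (code (L s)))) => [s|].
  exact: code_beheadE.
have rL2 := recursive_weaken2 rL; have rL4 := recursive_weaken2 rL2.
apply: (recursive_sum (F := fun t s => t * [exists h : 'I_(code (L s)), code_cons h t == code (L s)]) rL).
apply: recursiveM; first exact: recursive_head.
apply: (recursive_exists (P := fun h (s : k.+2.-tuple nat) =>
  code_cons h (thead s) == code (L (behead_tuple (behead_tuple s)))) rL2).
apply: recursive_eqn => //; apply: recursive_code_cons; first exact: recursive_head.
exact: recursive_weaken2 (@recursive_head _).
Qed.

Lemma recursive_iter_seq k (N : k.-tuple nat -> nat) B (S : seq nat -> k.-tuple nat -> seq nat) :
  recursive N -> recursive_seq B ->
  recursive_seq (fun s : k.+2.-tuple nat =>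
    S (decode (thead (behead_tuple s))) (behead_tuple (behead_tuple s))) ->
  recursive_seq (fun s => iter (N s) (fun v => S v s) (B s)).
Proof.
move=> rN rB rS; apply: recursive_ext
  (recursive_iter (S := fun v s => code (S (decode v) s)) rN rB rS) => s.
by elim: (N s) => //= i ->; rewrite CodeSeq.codeK.
Qed.

Lemma recursive_nth k (L : k.-tuple nat -> seq nat) N :
  recursive_seq L -> recursive N -> recursive (fun s => nth 0 (L s) (N s)).
Proof.
move=> rL rN; apply: recursive_ext
  (recursive_shead (recursive_iter_seq (S := fun v _ => behead v) rN rL _)) => [s|].
  rewrite -nth0; have -> : iter (N s) behead (L s) = drop (N s) (L s).
    by elim: (N s) (L s) => [|i IH] l; rewrite ?drop0 // iterSr IH -drop1 drop_drop addn1.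
  by rewrite nth_drop addn0.
exact: recursive_behead (recursive_decode (@recursive_prev _)).
Qed.

Lemma recursive_eqseq k (L M : k.-tuple nat -> seq nat) :
  recursive_seq L -> recursive_seq M -> recursive (fun s => L s == M s : nat).
Proof.
move=> rL rM; apply: recursive_ext (recursive_eqn rL rM) => s.
by rewrite (inj_eq (can_inj CodeSeq.codeK)).
Qed.

Lemma recursive_if_seq k (b : k.-tuple nat -> bool) L M :
  recursive (fun s => b s : nat) -> recursive_seq L -> recursive_seq M ->
  recursive_seq (fun s => if b s then L s else M s).
Proof. by move=> rb rL rM; apply: recursive_ext (recursive_if rb rL rM) => s; case: (b s). Qed.

Lemma recursive_size k (L : k.-tuple nat -> seq nat) :
  recursive_seq L -> recursive (fun s => size (L s)).
Proof.
move=> rL; apply: recursive_ext (_ : recursive (fun s =>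
  \sum_(i < code (L s)) (iter i behead (L s) != [::]))) => [s|].
  have E l i : (iter i behead l != [::]) = (i < size l).
    elim: i l => [|i IH] [|a l] //; rewrite iterSr IH //.
  under eq_bigr do rewrite E.
  have : size (L s) <= code (L s).
    elim: (L s) => // a l IH; have [_ h] := code_cons_gt a l; exact: leq_ltn_trans IH h.
  move: (size _) (code _) => p q pq; rewrite -(subnKC pq) big_split_ord /=.
  rewrite [X in _ + X]big1 => [|i _]; last by rewrite ltnNge leq_addr.
  by rewrite addn0 (eq_bigr (fun=> 1)) ?sum1_card ?card_ord // => i _; rewrite ltn_ord.
apply: (recursive_sum (F := fun i s => iter i behead (L s) != [::])) => //.
apply: recursive_negb; apply: recursive_eqseq; last exact: recursive_nil.
apply: (recursive_iter_seq (S := fun v _ => behead v)); first exact: recursive_head.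
  exact: recursive_seq_weaken.
exact: recursive_behead (recursive_decode (@recursive_prev _)).
Qed.

Lemma recursive_foldr k (L : k.-tuple nat -> seq nat) (B : k.-tuple nat -> nat)
    (F : nat -> nat -> k.-tuple nat -> nat) :
  recursive_seq L -> recursive B ->
  recursive (fun s : k.+2.-tuple nat =>
    F (thead s) (thead (behead_tuple s)) (behead_tuple (behead_tuple s))) ->
  recursive (fun s => foldr (fun a v => F a v s) (B s) (L s)).
Proof.
move=> rL rB rF; apply: recursive_ext (recursive_nat_rec (S := fun i v s =>
  F (nth 0 (L s) (size (L s) - i.+1)) v s) (recursive_size rL) rB _) => [s|].
  move: (L s) => l; set f := (f in nat_rec _ _ f _).
  suff H i : i <= size l -> nat_rec (fun=> nat) (B s) f i =
      foldr (fun a v => F a v s) (B s) (drop (size l - i) l).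
    by rewrite H // subnn drop0.
  elim: i => [|i IH] il; first by rewrite subn0 drop_size.
  rewrite /= IH ?(ltnW il) // [in RHS](drop_nth 0) /=; last by rewrite ltn_subrL (leq_trans _ il).
  by rewrite /f -subSn // subSS.
have rX : recursive (fun s : k.+2.-tuple nat => nth 0 (L (behead_tuple (behead_tuple s)))
    (size (L (behead_tuple (behead_tuple s))) - (thead s).+1)).
  apply: recursive_nth; first exact: recursive_seq_weaken.
  apply: recursiveB; last exact: recursiveS (@recursive_head _).
  by apply: recursive_size; exact: recursive_seq_weaken.
apply: recursive_ext (recursive_subst rF (recursive_map_cons rX (recursive_map_cons (@recursive_prev k)
  (recursive_map_behead (recursive_map_behead (@recursive_map_id k.+2)))))) => s.
by rewrite !behead_cons !theadE.
Qed.

Lemma recursive_foldr_seq k (L B : k.-tuple nat -> seq nat)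
    (F : nat -> seq nat -> k.-tuple nat -> seq nat) :
  recursive_seq L -> recursive_seq B ->
  recursive_seq (fun s : k.+2.-tuple nat =>
    F (thead s) (decode (thead (behead_tuple s))) (behead_tuple (behead_tuple s))) ->
  recursive_seq (fun s => foldr (fun a v => F a v s) (B s) (L s)).
Proof.
move=> rL rB rF; apply: recursive_ext
  (recursive_foldr (F := fun a v s => code (F a (decode v) s)) rL rB rF) => s.
by elim: (L s) => //= a l ->; rewrite CodeSeq.codeK.
Qed.

Lemma recursive_cat k (L M : k.-tuple nat -> seq nat) :
  recursive_seq L -> recursive_seq M -> recursive_seq (fun s => L s ++ M s).
Proof.
move=> rL rM; apply: recursive_seq_ext (recursive_foldr_seq (F := fun a v _ => a :: v) rL rM _) => [s|].
  by elim: (L s) => //= a l ->.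
apply: recursive_cons; [exact: recursive_head | exact/recursive_decode/recursive_prev].
Qed.

Lemma recursive_count k (L : k.-tuple nat -> seq nat) (P : nat -> k.-tuple nat -> bool) :
  recursive_seq L ->
  recursive (fun s : k.+2.-tuple nat => P (thead s) (behead_tuple (behead_tuple s)) : nat) ->
  recursive (fun s => count (fun a => P a s) (L s)).
Proof.
move=> rL rP; apply: recursive_ext
  (recursive_foldr (F := fun a v s => P a s + v) rL (recursive_const _ 0) _) => [s|].
  by elim: (L s) => //= a l ->.
apply: recursiveD => //; exact: recursive_prev.
Qed.

Lemma recursive_tuple_seq k (r : seq 'I_k) : recursive_seq (fun s => map (tnth s) r).
Proof.
elim: r => [|i r IH]; first exact: recursive_nil.
apply: recursive_cons IH; exact: recursive_proj.
Qed.

Lemma recursive_input k : recursive_seq (fun s : k.-tuple nat => s).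
Proof.
apply: recursive_seq_ext (recursive_tuple_seq (enum 'I_k)) => s; exact: map_tnth_enum.
Qed.

End RecursiveSeq.

(** * The algorithm *)

Section CodedWords.
Implicit Types (a : nat) (l w : seq nat).

Definition linv_code a := if odd a then a.-1 else a.+1.

Definition winv_code w := foldr (fun a v => v ++ [:: linv_code a]) [::] w.

Definition wlet_code l a :=
  let u := decode (nth 0 l a./2) in if odd a then winv_code u else u.

Definition wsub_code l w := foldr (fun a v => wlet_code l a ++ v) [::] w.

Definition push_code a w :=
  if (0 < size w) && (head 0 w == linv_code a) then behead w else a :: w.

(** Skipping the codes from 2n on performs [projF] together with the reduction. *)
Definition reduce_code n w :=
  foldr (fun a v => if a < n.*2 then push_code a v else v) [::] w.

(** Equality of the exponents of t_j, with the counts of inverse letters moved across to stay within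
    the natural numbers. *)
Definition conj_test n m u v g :=
  (reduce_code n (u ++ g) == reduce_code n (g ++ v)) &&
  all (fun j => count_mem (n + j).*2 u + count_mem (n + j).*2.+1 v ==
                count_mem (n + j).*2 v + count_mem (n + j).*2.+1 u) (iota 0 m).

(** The length of a list is at most its code, so the sum of the input bounds the lengths of all the
    words given. *)
Definition search_bound h l := tower h ((sumn l).+1 + h).

(* l lists the codes of the images of the generators, then those of the two words. *)
Definition search n m h l :=
  [exists k : 'I_(search_bound h l).+1, exists g : 'I_(search_bound h l).+1,
    conj_test n m (iter k (wsub_code l) (decode (nth 0 l (n + m))))
      (decode (nth 0 l (n + m).+1)) (decode g)].

End CodedWords.

Lemma recursive_linv k (F : k.-tuple nat -> nat) :
  recursive F -> recursive (fun s => linv_code (F s)).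
Proof.
move=> rF; apply: recursive_if; [exact: recursive_odd|exact: recursive_pred|exact: recursiveS].
Qed.

Lemma recursive_winv k (L : k.-tuple nat -> seq nat) :
  recursive_seq L -> recursive_seq (fun s => winv_code (L s)).
Proof.
move=> rL; apply: (recursive_foldr_seq (F := fun a v _ => v ++ [:: linv_code a])) => //.
  exact: recursive_nil.
apply: recursive_cat; first exact/recursive_decode/recursive_prev.
apply: recursive_cons; last exact: recursive_nil.
exact/recursive_linv/recursive_head.
Qed.

Lemma recursive_wsub k (L W : k.-tuple nat -> seq nat) :
  recursive_seq L -> recursive_seq W -> recursive_seq (fun s => wsub_code (L s) (W s)).
Proof.
move=> rL rW; apply: (recursive_foldr_seq (F := fun a v s => wlet_code (L s) a ++ v)) => //.
  exact: recursive_nil.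
apply: recursive_cat; last exact/recursive_decode/recursive_prev.
have rh := @recursive_head k.+1.
have ru : recursive_seq (fun s : k.+2.-tuple nat =>
    decode (nth 0 (L (behead_tuple (behead_tuple s))) (thead s)./2)).
  apply: recursive_decode; apply: recursive_nth; last exact: recursive_half.
  exact: recursive_seq_weaken.
apply: recursive_if_seq => //; [exact: recursive_odd | exact: recursive_winv].
Qed.

Lemma recursive_reduce k n (L : k.-tuple nat -> seq nat) :
  recursive_seq L -> recursive_seq (fun s => reduce_code n (L s)).
Proof.
move=> rL; apply: (recursive_foldr_seq
  (F := fun a v _ => if a < n.*2 then push_code a v else v)) => //.
  exact: recursive_nil.
have rh := @recursive_head k.+1; have rp := recursive_decode (@recursive_prev k).
apply: recursive_if_seq => //.
  by apply: recursive_leq; [exact: recursiveS | exact: recursive_const].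
apply: recursive_if_seq.
- apply: recursive_andb.
    by apply: recursive_leq; [exact: recursive_const | exact: recursive_size].
  by apply: recursive_eqn; [exact: recursive_shead | exact: recursive_linv].
- exact: recursive_behead.
- exact: recursive_cons.
Qed.

Lemma recursive_conj_test k n m (U V G : k.-tuple nat -> seq nat) :
  recursive_seq U -> recursive_seq V -> recursive_seq G ->
  recursive (fun s => conj_test n m (U s) (V s) (G s) : nat).
Proof.
move=> rU rV rG; apply: recursive_andb.
  by apply: recursive_eqseq; apply: recursive_reduce; apply: recursive_cat.
elim: (iota 0 m) => [|j r IH]; first exact: recursive_const.
apply: recursive_andb IH.
have rc a (L : k.-tuple nat -> seq nat) : recursive_seq L -> recursive (fun s => count_mem a (L s)).
  move=> rL; apply: (recursive_count (P := fun b _ => b == a) rL).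
  by apply: recursive_eqn; [exact: recursive_head | exact: recursive_const].
by apply: recursive_eqn; apply: recursiveD; apply: rc.
Qed.

Lemma recursive_search k n m h : recursive (fun s : k.-tuple nat => search n m h s : nat).
Proof.
have rl := @recursive_input k.
have rb : recursive (fun s : k.-tuple nat => (search_bound h s).+1).
  apply: recursiveS; rewrite /search_bound /tower.
  elim: {1}h => [|i IH] /=; last exact: recursiveX (recursive_const _ 2) IH.
  apply: recursiveD; last exact: recursive_const.
  apply: recursiveS; apply: (recursive_foldr (F := fun a v _ => a + v)) => //.
    exact: recursive_const.
  by apply: recursiveD; [exact: recursive_head | exact: recursive_prev].
apply: (recursive_exists (P := fun k s => [exists g : 'I_(search_bound h s).+1,
    conj_test n m (iter k (wsub_code s) (decode (nth 0 s (n + m))))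
      (decode (nth 0 s (n + m).+1)) (decode g)])) => //.
apply: (recursive_exists (N := fun s : k.+2.-tuple nat => (search_bound h (behead_tuple (behead_tuple s))).+1)
  (P := fun g s => conj_test n m (iter (thead s) (wsub_code (behead_tuple (behead_tuple s)))
     (decode (nth 0 (behead_tuple (behead_tuple s)) (n + m))))
      (decode (nth 0 (behead_tuple (behead_tuple s)) (n + m).+1)) (decode g))).
  exact: (recursive_weaken2 rb).
have rl4 := recursive_seq_weaken (recursive_seq_weaken rl).
have rn i := recursive_decode (recursive_nth rl4 (recursive_const _ i)).
apply: recursive_conj_test => //; last exact/recursive_decode/recursive_head.
apply: (recursive_iter_seq (N := fun s : k.+4.-tuple nat => thead (behead_tuple (behead_tuple s)))
  (S := fun v (s : k.+4.-tuple nat) => wsub_code (behead_tuple (behead_tuple (behead_tuple (behead_tuple s)))) v)).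
- exact: recursive_weaken2 (@recursive_head _).
- exact: rn.
apply: recursive_wsub; last exact/recursive_decode/recursive_prev.
exact: recursive_seq_weaken rl4.
Qed.

Section Correctness.
Variables n m : nat.
Implicit Types (u v w : FxZ_word n m).

Definition Fletter_code (a : 'I_n * bool) : nat := (a.1).*2 + a.2.

(** Codes that are not letters of the free part are dropped, so every number tried by the search
    stands for some conjugator. *)
Definition Fword_of (w : seq nat) : word 'I_n :=
  pmap (fun a => omap (fun i : 'I_n => (i, odd a)) (insub a./2)) w.

Lemma half_bit i (b : bool) : (i.*2 + b)./2 = i. Proof. by case: b; lia. Qed.

Lemma odd_bit i (b : bool) : odd (i.*2 + b) = b.
Proof. by rewrite oddD odd_double; case: b. Qed.

Lemma Fletter_code_inj : injective Fletter_code.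
Proof.
move=> [i b] [j c]; rewrite /Fletter_code /= => E; congr (_, _).
  by apply: val_inj; rewrite /= -(half_bit i b) E half_bit.
by rewrite -(odd_bit i b) E odd_bit.
Qed.

Lemma letter_code_inj : injective (@letter_code n m).
Proof.
move=> [g b] [h c]; rewrite /letter_code /= => E.
have E1 := congr1 half E; have E2 := congr1 odd E.
rewrite !odd_bit in E2; rewrite !half_bit in E1; congr (_, _) => //.
case: g h E1 {E E2} => [i|i] [j|j] /= E.
- by congr inl; apply: val_inj.
- by have := ltn_ord i; rewrite E; lia.
- by have := ltn_ord j; rewrite -E; lia.
- by congr inr; apply: val_inj; move/addnI: E.
Qed.

Lemma linv_bit i (b : bool) : linv_code (i.*2 + b) = i.*2 + ~~ b.
Proof. by rewrite /linv_code odd_bit; case: b; rewrite ?addn1 ?addn0. Qed.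

Lemma winv_codeE w : winv_code (map (@letter_code n m) w) = map (@letter_code n m) (winv w).
Proof.
by elim: w => //= a w ->; rewrite winv_cons map_rcons -cats1 /letter_code linv_bit.
Qed.

Lemma push_codeE a (w : word 'I_n) :
  push_code (Fletter_code a) (map Fletter_code w) = map Fletter_code (push a w).
Proof.
case: w => [//|b w]; rewrite /push_code /= {2}/Fletter_code linv_bit.
rewrite -[a.1.*2 + _]/(Fletter_code (linv a)) (inj_eq Fletter_code_inj).
by case: eqP.
Qed.

Lemma reduce_codeE (w : seq nat) : reduce_code n w = map Fletter_code (reduce (Fword_of w)).
Proof.
elim: w => //= a w ->; case: insubP => [i ai iE|] /=; rewrite -ltn_half_double.
  by rewrite ai -/(reduce _) -push_codeE /Fletter_code /= iE addnC odd_double_half.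
by move/negbTE ->.
Qed.

Lemma Fword_of_map w : Fword_of (map (@letter_code n m) w) = projF w.
Proof.
elim: w => //= -[[i|j] b] w <- /=; rewrite /letter_code /= half_bit odd_bit.
  by case: insubP => [i' _ /val_inj -> //|]; rewrite ltn_ord.
by rewrite insubF // ltnNge leq_addr.
Qed.

Lemma count_code (a : ('I_n + 'I_m) * bool) w :
  count_mem (letter_code a) (map (@letter_code n m) w) = count_mem a w.
Proof. by rewrite count_map; apply: eq_count => b /=; rewrite (inj_eq letter_code_inj). Qed.

Lemma conj_testP u v (g : seq nat) :
  conj_test n m (map (@letter_code n m) u) (map (@letter_code n m) v) g <->
  reduce (projF u ++ Fword_of g) = reduce (Fword_of g ++ projF v) /\
  forall j, expo (inr j) u = expo (inr j) v.
Proof.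
rewrite /conj_test !reduce_codeE (inj_eq (inj_map Fletter_code_inj)).
rewrite /Fword_of !pmap_cat -!/(Fword_of _) !Fword_of_map.
have E (j : 'I_m) : (count_mem (n + j).*2 (map (@letter_code n m) u) +
      count_mem (n + j).*2.+1 (map (@letter_code n m) v) ==
    count_mem (n + j).*2 (map (@letter_code n m) v) +
      count_mem (n + j).*2.+1 (map (@letter_code n m) u)) =
    (expo (inr j) u == expo (inr j) v).
  have l0 : (n + j).*2 = @letter_code n m (inr j, false) by rewrite /letter_code addn0.
  have l1 : (n + j).*2.+1 = @letter_code n m (inr j, true) by rewrite /letter_code addn1.
  rewrite l1 l0 !count_code !expo_count.
  move: (count_mem _ _) (count_mem _ _) (count_mem _ _) (count_mem _ _) => a b c d.
  by apply/eqP/eqP; lia.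
split=> [/andP[/eqP -> /allP h]|[-> h]].
  split=> // j; apply/eqP; rewrite -E; apply: h; by rewrite mem_iota ltn_ord.
rewrite eqxx; apply/allP => j; rewrite mem_iota => jm.
by rewrite (E (Ordinal jm)) h.
Qed.

End Correctness.

Section Input.
Variables n m : nat.
Variables (us : n.-tuple (FxZ_word n m)) (vs : m.-tuple (FxZ_word n m)).
Variables wx wy : FxZ_word n m.
Local Notation l := (BrCP_input us vs wx wy).
Local Notation f := (images us vs).

Lemma nth_input_gen (g : 'I_n + 'I_m) :
  nth 0 l (match g with inl i => i : nat | inr j => n + j end) = word_code (f g).
Proof.
case: g => i /=; rewrite (nth_map [::]) ?size_cat ?size_tuple ?ltn_add2l ?ltn_addr //=.
  by rewrite nth_cat size_tuple ltn_ord (tnth_nth [::]).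
rewrite nth_cat size_tuple ltnNge leq_addr /= addKn nth_cat size_tuple ltn_ord.
by rewrite (tnth_nth [::]).
Qed.

Let size_gens : size (us ++ vs) = n + m.
Proof. by rewrite size_cat !size_tuple. Qed.

Lemma nth_input_x : nth 0 l (n + m) = word_code wx.
Proof.
rewrite (nth_map [::]) ?size_cat ?size_tuple ?ltn_add2l ?addn2 // catA nth_cat.
by rewrite size_gens ltnn subnn.
Qed.

Lemma nth_input_y : nth 0 l (n + m).+1 = word_code wy.
Proof.
rewrite (nth_map [::]) ?size_cat ?size_tuple ?addn2 // ?addnS // catA nth_cat.
by rewrite size_gens ltnNge leqnSn /= subSnn.
Qed.

Lemma wsub_codeE w : wsub_code l (map (@letter_code n m) w) = map (@letter_code n m) (wsub f w).
Proof.
elim: w => // -[g b] w IH; rewrite wsub_cons map_cat -{}IH; congr (_ ++ _).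
rewrite /wlet_code {1 3}/letter_code /= half_bit odd_bit nth_input_gen CodeSeq.codeK.
by rewrite /wlet /=; case: b; rewrite ?winv_codeE.
Qed.

Lemma iter_wsub_code k w :
  iter k (wsub_code l) (map (@letter_code n m) w) = map (@letter_code n m) (iter k (wsub f) w).
Proof. by elim: k => //= k ->; rewrite wsub_codeE. Qed.

Lemma size_word_code i : size (decode (nth 0 l i)) <= (sumn l).+1.
Proof.
apply: leq_trans (size_code _) _; rewrite CodeSeq.decodeK.
elim: (val l) i => [|a r IH] [|i] //=; first by rewrite -addnS leq_addr.
by apply: leq_trans (IH i) _; rewrite ltnS leq_addl.
Qed.

Lemma searchP h (Phi : {multiplicative FxZ n m -> FxZ n m}) :
  (forall s, k_bound n m s + conjugator_bound n m s <= tower h (s + h)) ->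
  represents Phi us vs ->
  search n m h l <-> exists k, conjugate (iter k Phi (FxZ_eval wx)) (FxZ_eval wy).
Proof.
move=> bound rep; rewrite /search nth_input_x nth_input_y !CodeSeq.codeK.
split=> [/existsP[k /existsP[g]]|ex].
  rewrite iter_wsub_code => /conj_testP[E1 E2]; exists k.
  by rewrite -(FxZ_eval_iter rep); apply/FxZ_conjP; split=> //; apply/conj_words; eexists; exact: E1.
set s := (sumn l).+1.
have fs g : size (f g) <= s.
  rewrite -(size_map (@letter_code n m)) -[map _ _]CodeSeq.codeK -[code _]/(word_code _).
  by rewrite -nth_input_gen; exact: size_word_code.
have xs : size wx <= s.
  by rewrite -(size_map (@letter_code n m)) -[map _ _]CodeSeq.codeK -[code _]/(word_code _)
    -nth_input_x; exact: size_word_code.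
have ys : size wy <= s.
  by rewrite -(size_map (@letter_code n m)) -[map _ _]CodeSeq.codeK -[code _]/(word_code _)
    -nth_input_y; exact: size_word_code.
have [k kb] := bounded_exponent rep (ltn0Sn _) fs xs ys ex.
rewrite -(FxZ_eval_iter rep) => /FxZ_conjP[/short_conjugator[g [sg Eg]] E2].
have B := bound s.
have kK : k < (search_bound h l).+1 by rewrite ltnS (leq_trans kb) // (leq_trans (leq_addr _ _) B).
have gK : code (map (@Fletter_code n) g) < (search_bound h l).+1.
  rewrite ltnS; apply: leq_trans (leq_trans (leq_addl _ _) B).
  apply: leq_trans (ltnW (code_bound (L := n.*2) _)) _.
    apply/allP => _ /mapP[[i b] _ ->]; rewrite /Fletter_code /=.
    by have := ltn_ord i; case: (b); lia.
  rewrite leq_exp2l // leq_mul2l; apply/orP; right; rewrite size_map; apply: leq_trans sg _.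
  apply: leq_add; last exact: leq_trans (size_projF _) ys.
  rewrite leq_mul2l /=; apply: leq_trans (size_projF _) _.
  apply: leq_trans (size_iter_wsub _ _ fs) _; apply: leq_mul xs.
  by rewrite leq_pexp2l.
apply/existsP; exists (Ordinal kK); apply/existsP; exists (Ordinal gK) => /=.
rewrite CodeSeq.codeK iter_wsub_code; apply/conj_testP; split=> //.
have -> : Fword_of n (map (@Fletter_code n) g) = g; last by [].
elim: (g) => //= -[i b] r -> /=; rewrite /Fletter_code /= half_bit odd_bit.
by case: insubP => [i' _ /val_inj -> //|]; rewrite ltn_ord.
Qed.

End Input.

Theorem theorem2p9 (n m : nat) :
  exists A : recfun (n + (m + 2)),
    forall (Phi : {multiplicative FxZ n m -> FxZ n m})
      (us : n.-tuple (FxZ_word n m)) (vs : m.-tuple (FxZ_word n m))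
      (wx wy : FxZ_word n m),
      represents Phi us vs ->
      answers A (BrCP_input us vs wx wy)
        (exists k : nat, conjugate (iter k Phi (FxZ_eval wx)) (FxZ_eval wy)).
Proof.
(* The height [h] depends on n and m only, so the program is fixed before the input. *)
have [h bound] := elementary_search n m.
have [A cA] := recursive_search (n + (m + 2)) n m h.
exists A => Phi us vs wx wy rep; exists (search n m h (BrCP_input us vs wx wy)).
by split; [exact: cA | exact: searchP].
Qed.
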